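(* Let $X$ be a locally compact separable metrizable space, $m$ a positive Radon measure on $X$ with full support, and $\mathscr{E}$ a regular symmetric Dirichlet form on $L^2(X)=L^2(X,m)$ with associated self-adjoint operator $H$ and semigroup $T_t=e^{-tH}$. Assume that $\mathscr{E}$ has the weak Feller property and that $\mathscr{E}$ is weakly spatially locally compact, i.e. $\mathbf{1}_K T_t$ is a compact operator on $L^2(X)$ for all compact $K\subset X$ and all $t>0$. Then for every open $U\subset X$ with $X\setminus U$ compact one has $\sigma_{\mathrm{ess}}(H_U)=\sigma_{\mathrm{ess}}(H)$.
   Context: A semi-Dirichlet form on $L^2(X)$ is a pair $(\mathscr{E},\mathscr{F})$ with $\mathscr{F}\subset L^2(X)$ a dense subspace and $\mathscr{E}:\mathscr{F}\times\mathscr{F}\to\mathbb{R}$ bilinear such that: $\mathscr{E}(u,u)\ge 0$; (sector condition) there is $C\ge 1$ with $|\mathscr{E}(u,v)|\le C\,\mathscr{E}(u,u)^{1/2}\mathscr{E}(v,v)^{1/2}$; $\mathscr{F}$ is complete with respect to $\|u\|_{\mathscr{E}}=(\mathscr{E}(u,u)+\|u\|_2^2)^{1/2}$; (Markovian property) for all $u\in\mathscr{F}$, $a\ge 0$ one has $u\wedge a\in\mathscr{F}$ and $\mathscr{E}(u\wedge a,u-u\wedge a)\ge 0$. It is regular if $\mathscr{F}\cap C_c(X)$ is dense in $(\mathscr{F},\|\cdot\|_{\mathscr{E}})$ and in $(C_c(X),\|\cdot\|_\infty)$; it is symmetric if $\mathscr{E}(u,v)=\mathscr{E}(v,u)$.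 A regular symmetric Dirichlet form is a regular semi-Dirichlet form that is symmetric. $H$ is the nonnegative self-adjoint operator in $L^2(X)$ associated with $\mathscr{E}$, and $T_t=e^{-tH}$; $(T_t)$ is sub-Markovian and extends consistently to a weak-*-continuous contraction semigroup on $L^\infty(X)$, also denoted $T_t$. Inequalities between functions are meant $m$-a.e. $L^\infty_0(X)$ is the space of all $u\in L^\infty(X)$ such that for every $\epsilon>0$ there is a compact $K\subset X$ with $\|\mathbf{1}_{X\setminus K}u\|_\infty<\epsilon$. $\mathscr{E}$ has the weak Feller property if ($\alpha$) $T_t(L^\infty_0(X))\subset L^\infty_0(X)$ for all $t>0$, and ($\beta$) for every compact $K\subset X$ there is $0\le w\in L^2(X)\cap L^\infty_0(X)$ with $(H+1)^{-1}w\ge \mathbf{1}_K$. For $U\subset X$ open, $\mathscr{E}_U$ is the restriction of $\mathscr{E}$ to the $\|\cdot\|_{\mathscr{E}}$-closure of $\mathscr{F}\cap C_c(U)$; it is a regular symmetric Dirichlet form on $L^2(U)\subset L^2(X)$, and $H_U$ denotes the associated self-adjoint operator in $L^2(U)$. The essential spectrum of a self-adjoint operator $S$ is $\sigma_{\mathrm{ess}}(S)=\{\lambda\in\mathbb{C}: S-\lambda \text{ is not a Fredholm operator}\}$. *)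

(* Defs.v *)
From HB Require Import structures.
From mathcomp Require Import all_boot all_order all_algebra.
From mathcomp Require Import complex.
From mathcomp Require Import all_classical all_reals all_analysis.
From mathcomp Require Import measurable_realfun ess_sup_inf.

Set Implicit Arguments.
Unset Strict Implicit.
Unset Printing Implicit Defensive.

Import Order.TTheory GRing.Theory Num.Theory.
Import numFieldNormedType.Exports.

Local Open Scope classical_set_scope.
Local Open Scope ring_scope.

(* The library type [LfunType mu p1] consists of functions; [Lp mu p1] is its
   quotient by equality almost everywhere, hence a normed space. *)

Section Lp.
Context d (T : measurableType d) (R : realType).
Variables (mu : {measure set T -> \bar R}) (p : \bar R) (p1 : (1 <= p)%E).

Definition Lp_eq (f g : LfunType mu p1) := `[< f = g %[ae mu] >].

Fact Lp_eq_refl : reflexive Lp_eq.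
Proof. by move=> f; apply/asboolP; apply: aeW. Qed.

Fact Lp_eq_sym : symmetric Lp_eq.
Proof. by move=> f g; apply/asboolP/asboolP => /ae_eq_sym. Qed.

Fact Lp_eq_trans : transitive Lp_eq.
Proof.
by move=> f g h /asboolP gf /asboolP fh; apply/asboolP/(ae_eq_trans gf fh).
Qed.

Canonical Lp_eq_equiv := EquivRel Lp_eq Lp_eq_refl Lp_eq_sym Lp_eq_trans.

Local Open Scope quotient_scope.

Definition Lp : Type := {eq_quot Lp_eq}.
HB.instance Definition _ := Choice.on Lp.
HB.instance Definition _ := EqQuotient.on Lp.

(* An arbitrary representative; it is only meaningful up to null sets. *)
Definition Lp_repr (u : Lp) : LfunType mu p1 := repr u.
Definition Lp_fun (u : Lp) : T -> R := Lp_repr u.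

Definition Lp_pi (f : LfunType mu p1) : Lp := \pi_Lp f.

Lemma Lp_piP (f g : LfunType mu p1) : Lp_pi f = Lp_pi g <-> f = g %[ae mu].
Proof.
by split => [/eqquotP/asboolP|fg] //; apply/eqquotP/asboolP.
Qed.

Fact Lp_reprK u : Lp_pi (Lp_repr u) = u. Proof. exact: reprK. Qed.

Fact Lp_repr_pi f : Lp_repr (Lp_pi f) = f %[ae mu].
Proof. by apply/Lp_piP; rewrite Lp_reprK. Qed.

Definition Lp_add (u v : Lp) := Lp_pi (Lp_repr u + Lp_repr v).
Definition Lp_opp (u : Lp) := Lp_pi (- Lp_repr u).
Definition Lp_scale (a : R) (u : Lp) := Lp_pi (a *: Lp_repr u).
Definition Lp_norm (u : Lp) : R := fine ('N[mu]_p[EFin \o Lp_fun u]).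

Fact Lp_addE f g : Lp_add (Lp_pi f) (Lp_pi g) = Lp_pi (f + g).
Proof.
apply/Lp_piP; have := Lp_repr_pi f; have := Lp_repr_pi g.
apply: filterS2 => x gx fx _.
by rewrite -[LHS]/(Lp_repr (Lp_pi f) x + Lp_repr (Lp_pi g) x) (fx I) (gx I).
Qed.

Fact Lp_oppE f : Lp_opp (Lp_pi f) = Lp_pi (- f).
Proof.
apply/Lp_piP; have := Lp_repr_pi f.
by apply: filterS => x fx _; rewrite -[LHS]/(- Lp_repr (Lp_pi f) x) (fx I).
Qed.

Fact Lp_scaleE a f : Lp_scale a (Lp_pi f) = Lp_pi (a *: f).
Proof.
apply/Lp_piP; have := Lp_repr_pi f.
by apply: filterS => x fx _; rewrite -[LHS]/(a * Lp_repr (Lp_pi f) x) (fx I).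
Qed.

Fact Lp_addA : associative Lp_add.
Proof.
by move=> u v w; rewrite -(Lp_reprK u) -(Lp_reprK v) -(Lp_reprK w) !Lp_addE addrA.
Qed.

Fact Lp_addC : commutative Lp_add.
Proof. by move=> u v; rewrite -(Lp_reprK u) -(Lp_reprK v) !Lp_addE addrC. Qed.

Fact Lp_add0 : left_id (Lp_pi 0) Lp_add.
Proof. by move=> u; rewrite -(Lp_reprK u) Lp_addE add0r. Qed.

Fact Lp_addN : left_inverse (Lp_pi 0) Lp_opp Lp_add.
Proof. by move=> u; rewrite -(Lp_reprK u) Lp_oppE Lp_addE addNr. Qed.

HB.instance Definition _ := GRing.isZmodule.Build Lp Lp_addA Lp_addC Lp_add0 Lp_addN.

Fact Lp_piD f g : Lp_pi f + Lp_pi g = Lp_pi (f + g). Proof. exact: Lp_addE. Qed.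

Fact Lp_scaleA a b v : Lp_scale a (Lp_scale b v) = Lp_scale (a * b) v.
Proof. by rewrite -(Lp_reprK v) !Lp_scaleE scalerA. Qed.

Fact Lp_scale1 : left_id 1 Lp_scale.
Proof. by move=> v; rewrite -(Lp_reprK v) Lp_scaleE scale1r. Qed.

Fact Lp_scaleDr : right_distributive Lp_scale +%R.
Proof.
move=> a u v; rewrite -(Lp_reprK u) -(Lp_reprK v) Lp_piD !Lp_scaleE.
by rewrite Lp_piD scalerDr.
Qed.

Fact Lp_scaleDl v : {morph Lp_scale^~ v : a b / a + b}.
Proof.
move=> a b; rewrite -(Lp_reprK v) !Lp_scaleE.
by rewrite Lp_piD scalerDl.
Qed.

HB.instance Definition _ :=
  GRing.Zmodule_isLmodule.Build R Lp Lp_scaleA Lp_scale1 Lp_scaleDr Lp_scaleDl.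

Fact Lp_eq_norm (f g : LfunType mu p1) : f = g %[ae mu] ->
  ('N[mu]_p[EFin \o f] = 'N[mu]_p[EFin \o g])%E.
Proof.
move=> fg; rewrite unlock; case: p p1 f g fg => [r| |] // r1 f g fg.
- congr (_ `^ _)%E; apply: ae_eq_integral => //=.
  + apply/measurable_EFinP/(measurableT_comp (measurable_powR r)).
    exact: measurableT_comp.
  + apply/measurable_EFinP/(measurableT_comp (measurable_powR r)).
    exact: measurableT_comp.
  + by apply: filterS fg => x fg _ /=; rewrite (fg I).
- case: ifPn => // _; apply: eq_ess_sup.
  by apply: filterS fg => x fg /=; rewrite (fg I).
Qed.

Fact Lp_normE f : Lp_norm (Lp_pi f) = fine ('N[mu]_p[EFin \o f]).
Proof. by congr fine; apply: Lp_eq_norm; exact: Lp_repr_pi. Qed.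

Fact Lp_ler_normD u v : Lp_norm (u + v) <= Lp_norm u + Lp_norm v.
Proof. by rewrite -[u + v]/(Lp_pi _) Lp_normE; exact: ler_LnormD. Qed.

Fact Lp_normZ (l : R) u : Lp_norm (l *: u) = `|l| * Lp_norm u.
Proof.
rewrite -[l *: u]/(Lp_pi _) Lp_normE [X in fine X](LnormZ (Lp_repr u) l).
by rewrite fineM// fin_numElt (lt_le_trans ltNy0 (Lnorm_ge0 _ _ _))//=;
  exact: Lfunction_finite.
Qed.

Fact Lp_norm0_eq0 u : Lp_norm u = 0 -> u = 0.
Proof.
move=> /fine_Lnormr_eq0 u0; rewrite -(Lp_reprK u).
by apply/Lp_piP; exact: u0.
Qed.

HB.instance Definition _ :=
  Lmodule_isNormed.Build R Lp Lp_ler_normD Lp_normZ Lp_norm0_eq0.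

End Lp.

Coercion Lp_fun : Lp >-> Funclass.

Fact le1_two (R : realType) : (1 <= 2%:R%:E :> \bar R)%E.
Proof. by rewrite lee_fin ler1n. Qed.

Notation L1 mu := (Lp mu (lexx 1%E)).
Notation L2 mu := (Lp mu (le1_two _)).
Notation Linf mu := (Lp mu (leey 1%E)).

Section LpTheory.
Context d (T : measurableType d) (R : realType).
Variable mu : {measure set T -> \bar R}.

Section AnyExponent.
Variables (p : \bar R) (p1 : (1 <= p)%E).

(* The class of [f] when [f] belongs to L^p, and the junk value 0 otherwise. *)
Definition Lp_class (f : T -> R) : Lp mu p1 :=
  if pselect (f \in Lfun mu p) is left fL
  then Lp_pi (Lfun_Sub p1 fL) else 0.

Lemma Lp_classE (f : T -> R) : f \in Lfun mu p -> Lp_class f = f %[ae mu].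
Proof.
move=> fL; rewrite /Lp_class; case: pselect => // fL'.
exact: (Lp_repr_pi (Lfun_Sub p1 fL')).
Qed.

Definition cutoff (A : set T) (u : Lp mu p1) : Lp mu p1 :=
  Lp_class (fun x => \1_A x * u x).

Definition truncation (a : R) (u : Lp mu p1) : Lp mu p1 :=
  Lp_class (fun x => Num.min (u x) a).

End AnyExponent.

Definition inner (u v : L2 mu) : R := (\int[mu]_x (u x * v x))%R.

Definition pairing (u : Linf mu) (v : L1 mu) : R := (\int[mu]_x (u x * v x))%R.

End LpTheory.

Definition metrizable (R : realType) (X : topologicalType) :=
  exists dist : X -> X -> R,
    [/\ forall x y, 0 <= dist x y,
        forall x y, dist x y = 0 <-> x = y,
        forall x y, dist x y = dist y x,
        forall x y z, dist x z <= dist x y + dist y z &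
        forall x (A : set X), nbhs x A <->
          exists2 e : R, 0 < e & [set y | dist x y < e] `<=` A].

Definition separable (X : topologicalType) :=
  exists2 D : set X, countable D & dense D.

Notation borel X := (g_sigma_algebraType (@open X)).

Section RadonMeasure.
Context (R : realType) (X : ptopologicalType).
Variable m : {measure set (borel X) -> \bar R}.

Record radon_measure : Prop := {
  radon_compact_lty : forall K : set X, compact K -> (m K < +oo)%E ;
  radon_inner_regular : forall B : set (borel X), measurable B ->
    m B = ereal_sup [set m K | K in [set K : set X | compact K /\ K `<=` B]] }.

Definition full_support : Prop :=
  forall V : set X, open V -> V !=set0 -> (0 < m V)%E.

End RadonMeasure.

(* C_c(U), the functions being extended by 0 outside [U] *)
Definition Cc (R : realType) (X : topologicalType) (U : set X) : set (X -> R) :=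
  [set f | [/\ continuous f, compact (closure [set x | f x != 0]) &
              closure [set x | f x != 0] `<=` U]].

(* A form is a pair of a domain [F] and a function [E] whose values outside of
   [F] are irrelevant. *)

Section DirichletForms.
Context (R : realType) (X : ptopologicalType).
Variable m : {measure set (borel X) -> \bar R}.
Implicit Types (F : set (L2 m)) (E : L2 m -> L2 m -> R).

Definition energy_norm E (u : L2 m) : R := Num.sqrt (E u u + `|u| ^+ 2).

Record semi_dirichlet_form F E : Prop := {
  sdf_zero : F 0 ;
  sdf_linear : forall a u v, F u -> F v -> F (a *: u + v) ;
  sdf_dense : dense F ;
  sdf_bilinear_l : forall a u v w, F u -> F v -> F w ->
    E (a *: u + v) w = a * E u w + E v w ;
  sdf_bilinear_r : forall a u v w, F u -> F v -> F w ->
    E w (a *: u + v) = a * E w u + E w v ;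
  sdf_ge0 : forall u, F u -> 0 <= E u u ;
  sdf_sector : exists2 C : R, 1 <= C & forall u v, F u -> F v ->
    `|E u v| <= C * Num.sqrt (E u u) * Num.sqrt (E v v) ;
  sdf_complete : forall u_ : nat -> L2 m, (forall n, F (u_ n)) ->
    (forall e : R, 0 < e -> exists N : nat, forall i j : nat,
       (N <= i)%N -> (N <= j)%N -> energy_norm E (u_ i - u_ j) < e) ->
    exists2 u, F u & energy_norm E (u_ n - u) @[n --> \oo] --> (0 : R) ;
  sdf_markov : forall u (a : R), F u -> 0 <= a ->
    F (truncation a u) /\ 0 <= E (truncation a u) (u - truncation a u) }.

Definition form_core (U : set X) F : set (L2 m) :=
  [set u | F u /\ exists2 f : X -> R, Cc U f & u = f %[ae m]].

Record regular_form F E : Prop := {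
  regular_energy : forall u, F u -> forall e : R, 0 < e ->
    exists2 v, form_core setT F v & energy_norm E (u - v) < e ;
  regular_uniform : forall f : X -> R, Cc setT f -> forall e : R, 0 < e ->
    exists g : X -> R, [/\ Cc setT g, exists2 u, F u & u = g %[ae m] &
                           forall x, `|f x - g x| < e] }.

Definition symmetric_form F E : Prop :=
  forall u v, F u -> F v -> E u v = E v u.

Record regular_symmetric_dirichlet_form F E : Prop := {
  rsdf_semi_dirichlet : semi_dirichlet_form F E ;
  rsdf_regular : regular_form F E ;
  rsdf_symmetric : symmetric_form F E }.

(* The domain of the part of the form on [U]; the part itself is [E]
   restricted to this domain. *)
Definition form_part (U : set X) F E : set (L2 m) :=
  [set u | F u /\ forall e : R, 0 < e ->
     exists2 v, form_core U F v & energy_norm E (u - v) < e].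

(* L^2(U) as a subspace of L^2(X) *)
Definition L2on (U : set X) : set (L2 m) :=
  [set u | {ae m, forall x, ~ U x -> u x = 0}].

(* The graph of the operator associated with the form (E, F) in the closed
   subspace [W] of L^2(X). *)
Definition form_operator (W F : set (L2 m)) E : set (L2 m * L2 m) :=
  [set uf | [/\ F uf.1, W uf.2 & forall v, F v -> E uf.1 v = inner uf.2 v]].

End DirichletForms.

(* [T] is e^{-tA}, i.e. the strongly continuous semigroup of bounded operators
   whose generator is -A; the operator A is given by its graph. *)
Record semigroup_of (R : realType) (V : normedModType R) (A : set (V * V))
    (T : R -> V -> V) : Prop := {
  sg_linear : forall t, 0 <= t -> forall (a : R) u v,
    T t (a *: u + v) = a *: T t u + T t v ;
  sg_continuous : forall t, 0 <= t -> continuous (T t) ;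
  sg_0 : forall u, T 0 u = u ;
  sg_add : forall s t, 0 <= s -> 0 <= t -> forall u,
    T (s + t) u = T s (T t u) ;
  sg_strong : forall u, T t u @[t --> 0^'+] --> u ;
  sg_generator : forall u f,
    A (u, f) <-> t^-1 *: (u - T t u) @[t --> 0^'+] --> f }.

Definition compact_operator (R : realType) (V : normedModType R)
    (S : V -> V) : Prop :=
  forall B : set V, bounded_set B -> precompact (S @` B).

Section WeakFeller.
Context (R : realType) (X : ptopologicalType).
Variable m : {measure set (borel X) -> \bar R}.

(* continuity for the topology sigma(L^oo, L^1) of a linear map *)
Definition weak_star_continuous (S : Linf m -> Linf m) : Prop :=
  forall (v : L1 m) (e : R), 0 < e ->
    exists s : seq (L1 m), exists2 r : R, 0 < r &
      forall u, (forall w, w \in s -> `|pairing u w| < r) ->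
        `|pairing (S u) v| < e.

(* [Tinf] is the extension of the semigroup [T] on L^2 to a weak-*-continuous
   contraction semigroup on L^oo; being weak-*-continuous, it is determined by
   its values on L^2 `&` L^oo. *)
Record Linf_extension (T : R -> L2 m -> L2 m) (Tinf : R -> Linf m -> Linf m) :
    Prop := {
  lie_linear : forall t, 0 <= t -> forall (a : R) u v,
    Tinf t (a *: u + v) = a *: Tinf t u + Tinf t v ;
  lie_contraction : forall t, 0 <= t -> forall u, `|Tinf t u| <= `|u| ;
  lie_0 : forall u, Tinf 0 u = u ;
  lie_add : forall s t, 0 <= s -> 0 <= t -> forall u,
    Tinf (s + t) u = Tinf s (Tinf t u) ;
  lie_weak_star : forall t, 0 <= t -> weak_star_continuous (Tinf t) ;
  lie_weak_star_0 : forall u v,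
    pairing (Tinf t u) v @[t --> 0^'+] --> pairing u v ;
  lie_consistent : forall t, 0 <= t -> forall (u : L2 m) (w : Linf m),
    u = w %[ae m] -> T t u = Tinf t w %[ae m] }.

Definition Linf0 : set (Linf m) :=
  [set u : Linf m | forall e : R, 0 < e ->
     exists2 K : set X, compact K & `|cutoff (~` K : set (borel X)) u| < e].

(* [H] is the graph of the operator, so that [H (g, w - g)] says that
   g = (H + 1)^-1 w. *)
Record weak_feller (H : set (L2 m * L2 m)) (Tinf : R -> Linf m -> Linf m) :
    Prop := {
  wf_semigroup : forall t, 0 < t -> forall u, Linf0 u -> Linf0 (Tinf t u) ;
  wf_resolvent : forall K : set X, compact K ->
    exists w : L2 m, exists2 w' : Linf m, w = w' %[ae m] /\ Linf0 w' &
    exists g : L2 m,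
      [/\ {ae m, forall x, 0 <= w x}, H (g, w - g) &
          {ae m, forall x, \1_K x <= g x}] }.

Definition weakly_spatially_locally_compact (T : R -> L2 m -> L2 m) : Prop :=
  forall (K : set X) (t : R), compact K -> 0 < t ->
    compact_operator (fun u : L2 m => cutoff (K : set (borel X)) (T t u)).

End WeakFeller.

Section Fredholm.
Context (K : numDomainType) (V : preTopologicalLmodType K).
Implicit Types (A W : set V) (S : set (V * V)).

Definition finite_dimensional A : Prop :=
  exists n (b : 'I_n -> V), forall x, A x ->
    exists c : 'I_n -> K, x = \sum_i c i *: b i.

Definition finite_codimensional W A : Prop :=
  exists n (b : 'I_n -> V), (forall i, W (b i)) /\
    forall x, W x -> exists c : 'I_n -> K, A (x - \sum_i c i *: b i).

(* [S] is the graph of a closed densely defined operator in the closed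
   subspace [W]. *)
Record fredholm W S : Prop := {
  fredholm_ker : finite_dimensional [set u | S (u, 0)] ;
  fredholm_closed : closed [set f | exists u, S (u, f)] ;
  fredholm_coker : finite_codimensional W [set f | exists u, S (u, f)] }.

End Fredholm.

Section Complexification.
Context (R : realType) (V : normedModType R).

(* (u, v) stands for u + iv *)
Definition complexification : Type := (V * V)%type.

HB.instance Definition _ := GRing.Zmodule.copy complexification (V * V)%type.
HB.instance Definition _ := Topological.copy complexification (V * V)%type.

Definition complex_scale (z : R[i]) (w : complexification) : complexification :=
  (complex.Re z *: w.1 - complex.Im z *: w.2,
   complex.Re z *: w.2 + complex.Im z *: w.1).

Fact complex_scaleA a b v : complex_scale a (complex_scale b v) = complex_scale (a * b) v.
Proof.
case: a b v => [a1 a2] [b1 b2] [v1 v2]; rewrite /complex_scale/=; congr pair.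
  rewrite !scalerDr !scalerN !scalerA scalerBl scalerDl !opprD !addrA.
  by rewrite -!addrA; congr (_ + _); rewrite addrA addrC.
rewrite !scalerDr !scalerN !scalerA scalerBl scalerDl.
by rewrite -!addrA; congr (_ + _); rewrite addrA addrC.
Qed.

Fact complex_scale1 : left_id 1 complex_scale.
Proof.
by case=> v1 v2; rewrite /complex_scale/= !scale1r !scale0r subr0 addr0.
Qed.

Fact complex_scaleDr : right_distributive complex_scale +%R.
Proof.
move=> [a1 a2] [u1 u2] [v1 v2]; rewrite /complex_scale/=; congr pair => /=.
  by rewrite !scalerDr opprD addrACA.
by rewrite !scalerDr addrACA.
Qed.

Fact complex_scaleDl v : {morph complex_scale^~ v : a b / a + b}.
Proof.
case: v => v1 v2 [a1 a2] [b1 b2]; rewrite /complex_scale/=; congr pair => /=.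
  by rewrite !scalerDl opprD addrACA.
by rewrite !scalerDl addrACA.
Qed.

HB.instance Definition _ := GRing.Zmodule_isLmodule.Build R[i] complexification
  complex_scaleA complex_scale1 complex_scaleDr complex_scaleDl.

Definition cset (W : set V) : set complexification :=
  [set w | W w.1 /\ W w.2].

(* the graph of (the complexification of S) - z *)
Definition shifted_operator (S : set (V * V)) (z : R[i]) :
    set (complexification * complexification) :=
  [set uf : complexification * complexification |
     exists h : complexification,
     [/\ S (uf.1.1, h.1), S (uf.1.2, h.2) & uf.2 = h - z *: uf.1]].

Definition essential_spectrum (W : set V) (S : set (V * V)) : set R[i] :=
  [set z | ~ fredholm (cset W) (shifted_operator S z)].

End Complexification.

(* Main.v *)
(* Let [G] be the resolvent [(H + 1)^-1] and [G_U] that of the part on [U],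
   extended by 0 off [L^2(U)]. The operator [H - z] is Fredholm iff
   [1 - (z + 1) G] is, and for the normal operator [1 - (z + 1) G] this means
   that every bounded ultrafilter along which its image is norm Cauchy is
   itself norm Cauchy, a condition insensitive to compact perturbations of [G].
   The difference [D = G - G_U] is positivity preserving, with
   [|D x|^2 <= <D x, x>] and [0 <= <D x, x> <= <G x, x>], so that it is compact
   as soon as [<D x, x>] is small along weakly null bounded [x]. The weak Feller
   property gives [g = G w >= 1] near the complement of [U]; then
   [D 1_A <= g] for every [A], and a Schur test yields
   [<D z, z> <= int g z^2]. As [G] has the Feller property, being a Laplace
   transform of the semigroup, [g] is small off a compact set [K], which leaves
   [1_K G 1_K], compact because the [1_K T_t] are. *)
Require Import Defs.
From HB Require Import structures.
From mathcomp Require Import all_boot all_order all_algebra.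
From mathcomp Require Import complex.
From mathcomp Require Import all_classical all_reals all_analysis.
From mathcomp Require Import measurable_realfun ess_sup_inf ring lra.

Set Implicit Arguments.
Unset Strict Implicit.
Unset Printing Implicit Defensive.

Import Order.TTheory GRing.Theory Num.Theory.
Import numFieldNormedType.Exports.

Local Open Scope classical_set_scope.
Local Open Scope ring_scope.

(** [G] need not be compact, so the comparison has to live on [D]. The inequality |D x|^2 <= <D x,
    x> is what turns norms into quadratic forms, which can be compared and localized; it holds
    because <D x, x> is the full energy of [D x], the vector [D x] being orthogonal, for the energy
    inner product, to the domain of the part. That domain is only the closure of a core of
    continuous functions, and lattice operations are not assumed continuous for the energy norm. The
    substitute for capacities and quasi-continuity is closedness under L^2 limits of bounded energy:
    it makes the domain an order ideal which contains each bounded nonnegative form element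
    vanishing on an open neighbourhood of the complement of [U]. Compactness of the complement
    enters there, through a cutoff function in the form domain, and once more in the choice of [g].
    Ultrafilters replace weak limits: inner products of a bounded family converge along each of
    them, without passing to subsequences. All complex [z] are treated alike, since the Fredholm
    argument rests on normality and on a conjugation exchanging the operator with its adjoint. *)

Lemma inv_nat_small (R : realType) (e : R) : 0 < e ->
  exists N : nat, forall n, (N <= n)%N -> n.+1%:R^-1 < e.
Proof.
move=> e0; exists (Num.truncn e^-1) => n Nn.
rewrite -[e]invrK ltf_pV2 ?posrE ?invr_gt0//.
by apply: lt_le_trans (truncnS_gt _) _; rewrite ler_nat ltnS.
Qed.

(** * Positive forms and Hilbert spaces *)

Section PositiveForms.
Context (R : realType) (V : lmodType R).
Implicit Types (F S : set V) (B : V -> V -> R).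

Definition subspace F : Prop :=
  F 0 /\ forall a u v, F u -> F v -> F (a *: u + v).

Record positive_form F B : Prop := {
  pf_subspace : subspace F ;
  pf_linear : forall a u v w, F u -> F v -> F w ->
    B (a *: u + v) w = a * B u w + B v w ;
  pf_sym : forall u v, F u -> F v -> B u v = B v u ;
  pf_ge0 : forall u, F u -> 0 <= B u u }.

Definition form_norm B (u : V) : R := Num.sqrt (B u u).

Definition form_closure B S : set V :=
  [set u | forall e : R, 0 < e -> exists2 s, S s & form_norm B (u - s) < e].

Definition form_complete F B : Prop :=
  forall u_ : nat -> V, (forall n, F (u_ n)) ->
    (forall e : R, 0 < e -> exists N : nat, forall i j : nat,
       (N <= i)%N -> (N <= j)%N -> form_norm B (u_ i - u_ j) < e) ->
    exists2 u, F u & forall e : R, 0 < e ->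
      exists N : nat, forall n, (N <= n)%N -> form_norm B (u_ n - u) < e.

Section Subspace.
Context (F : set V) (sF : subspace F).

Lemma subspace0 : F 0. Proof. by case: sF. Qed.
Lemma subspaceD u v : F u -> F v -> F (u + v).
Proof. by case: sF => _ h Fu Fv; rewrite -[u]scale1r; apply: h. Qed.
Lemma subspaceZ a u : F u -> F (a *: u).
Proof. by case: sF => F0 h Fu; rewrite -[_ *: _]addr0; apply: h. Qed.
Lemma subspaceN u : F u -> F (- u).
Proof. by move=> Fu; rewrite -scaleN1r; exact: subspaceZ. Qed.
Lemma subspaceB u v : F u -> F v -> F (u - v).
Proof. by move=> Fu Fv; apply/subspaceD/subspaceN. Qed.
Lemma subspace_sum (I : eqType) (r : seq I) (f : I -> V) :
  (forall i, i \in r -> F (f i)) -> F (\sum_(i <- r) f i).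
Proof.
move=> Ff; rewrite big_seq; elim/big_ind: _ => //; first exact: subspace0.
exact: subspaceD.
Qed.
End Subspace.

Section Form.
Context (F : set V) (B : V -> V -> R) (fB : positive_form F B).
Let sF := pf_subspace fB.

Lemma pf0l w : F w -> B 0 w = 0.
Proof.
move=> Fw; have := pf_linear fB 1 (subspace0 sF) (subspace0 sF) Fw.
by rewrite scale1r addr0 mul1r => /eqP; rewrite eq_sym addrC -subr_eq0 addrK => /eqP.
Qed.
Lemma pfDl u v w : F u -> F v -> F w -> B (u + v) w = B u w + B v w.
Proof. by move=> Fu Fv Fw; rewrite -{1}[u]scale1r (pf_linear fB)// mul1r. Qed.
Lemma pfZl a u w : F u -> F w -> B (a *: u) w = a * B u w.
Proof.
move=> Fu Fw; rewrite -[a *: u]addr0 (pf_linear fB)//; last exact: subspace0.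
by rewrite pf0l// addr0.
Qed.
Lemma pfNl u w : F u -> F w -> B (- u) w = - B u w.
Proof. by move=> Fu Fw; rewrite -scaleN1r pfZl// mulN1r. Qed.
Lemma pfBl u v w : F u -> F v -> F w -> B (u - v) w = B u w - B v w.
Proof. by move=> Fu Fv Fw; rewrite pfDl ?pfNl//; exact: subspaceN. Qed.
Lemma pf0r w : F w -> B w 0 = 0.
Proof. by move=> Fw; rewrite (pf_sym fB)// ?pf0l//; exact: subspace0. Qed.
Lemma pfDr u v w : F u -> F v -> F w -> B w (u + v) = B w u + B w v.
Proof.
move=> Fu Fv Fw; rewrite (pf_sym fB)// ?pfDl//; last exact: subspaceD.
by rewrite (pf_sym fB Fu)// (pf_sym fB Fv).
Qed.
Lemma pfZr a u w : F u -> F w -> B w (a *: u) = a * B w u.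
Proof.
by move=> Fu Fw; rewrite (pf_sym fB)// ?pfZl ?(pf_sym fB Fu)//; exact: subspaceZ.
Qed.
Lemma pfNr u w : F u -> F w -> B w (- u) = - B w u.
Proof. by move=> Fu Fw; rewrite -scaleN1r pfZr// mulN1r. Qed.
Lemma pfBr u v w : F u -> F v -> F w -> B w (u - v) = B w u - B w v.
Proof. by move=> Fu Fv Fw; rewrite pfDr ?pfNr//; exact: subspaceN. Qed.

Lemma pf_sqrB u v : F u -> F v -> B (u - v) (u - v) = B u u - 2 * B u v + B v v.
Proof.
move=> Fu Fv; have Fuv := subspaceB sF Fu Fv.
rewrite pfBl// !pfBr// (pf_sym fB Fv Fu); ring.
Qed.

Lemma pf_sqrD u v : F u -> F v -> B (u + v) (u + v) = B u u + 2 * B u v + B v v.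
Proof.
move=> Fu Fv; have Fuv := subspaceD sF Fu Fv.
rewrite pfDl// !pfDr// (pf_sym fB Fv Fu); ring.
Qed.

Lemma form_norm_ge0 u : 0 <= form_norm B u. Proof. exact: sqrtr_ge0. Qed.

Lemma form_norm_sqr u : F u -> form_norm B u ^+ 2 = B u u.
Proof. by move=> Fu; rewrite sqr_sqrtr// (pf_ge0 fB). Qed.

Lemma form_normZ a u : F u -> form_norm B (a *: u) = `|a| * form_norm B u.
Proof.
move=> Fu; rewrite /form_norm pfZl// ?pfZr//; last exact: subspaceZ.
by rewrite mulrA -expr2 sqrtrM ?sqr_ge0// sqrtr_sqr.
Qed.

Lemma form_normN u : F u -> form_norm B (- u) = form_norm B u.
Proof. by move=> Fu; rewrite -scaleN1r form_normZ// normrN1 mul1r. Qed.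

Lemma form_normC u v : F u -> F v -> form_norm B (u - v) = form_norm B (v - u).
Proof. by move=> Fu Fv; rewrite -opprB form_normN//; exact: subspaceB. Qed.

Lemma form_normP u c : F u -> 0 <= c -> (form_norm B u <= c) = (B u u <= c ^+ 2).
Proof.
by move=> Fu c0; rewrite -form_norm_sqr// ler_pXn2r ?nnegrE ?form_norm_ge0.
Qed.

Lemma form_CauchySchwarz u v : F u -> F v ->
  `|B u v| <= form_norm B u * form_norm B v.
Proof.
move=> Fu Fv; have a0 := pf_ge0 fB Fu; have b0 := pf_ge0 fB Fv.
have pos t : 0 <= t ^+ 2 * B u u + 2 * t * B u v + B v v.
  have Ftu : F (t *: u) by exact: subspaceZ.
  have := pf_ge0 fB (subspaceD sF Ftu Fv).
  by rewrite pf_sqrD// !pfZl// pfZr// mulrA -expr2 !mulrA.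
suff le2 : B u v ^+ 2 <= B u u * B v v.
  by rewrite -sqrtrM// -sqrtr_sqr ler_wsqrtr.
have [a_eq0|a_neq0] := eqVneq (B u u) 0.
  have [->|c_neq0] := eqVneq (B u v) 0; first by rewrite a_eq0 mul0r expr0n.
  (* The polynomial in [t] is affine here; this [t] makes it take the value -1. *)
  have := pos (- (B v v + 1) / (2 * B u v)); rewrite a_eq0 mulr0 add0r.
  have -> : 2 * (- (B v v + 1) / (2 * B u v)) * B u v = - (B v v + 1) by field.
  by rewrite opprD addrAC addNr add0r ler0N1.
have := pos (- B u v / B u u).
have -> : (- B u v / B u u) ^+ 2 * B u u + 2 * (- B u v / B u u) * B u v + B v v =
   (B u u * B v v - B u v ^+ 2) / B u u by field.
have a_gt0 : 0 < B u u by rewrite lt_def a_neq0.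
by rewrite pmulr_lge0 ?invr_gt0// subr_ge0.
Qed.

Lemma form_normD u v : F u -> F v ->
  form_norm B (u + v) <= form_norm B u + form_norm B v.
Proof.
move=> Fu Fv; rewrite form_normP ?addr_ge0 ?form_norm_ge0//; last exact: subspaceD.
rewrite pf_sqrD// sqrrD !form_norm_sqr// lerD2r lerD2l mulr2n -mulr_natl.
have := ler_norm (B u v); have := form_CauchySchwarz Fu Fv; lra.
Qed.

Lemma form_norm_triangle u v w : F u -> F v -> F w ->
  form_norm B (u - w) <= form_norm B (u - v) + form_norm B (v - w).
Proof.
move=> Fu Fv Fw; have -> : u - w = (u - v) + (v - w) by rewrite addrA subrK.
by apply: form_normD; exact: subspaceB.
Qed.

(* A bounded functional on [S] attains the minimum of [B s s - 2 l s] in the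
   closure of [S]. *)
Lemma form_representation S (l : V -> R) (C : R) :
  form_complete F B -> subspace S -> S `<=` F ->
  (forall a u v, S u -> S v -> l (a *: u + v) = a * l u + l v) ->
  (forall u, S u -> `|l u| <= C * form_norm B u) ->
  exists q, [/\ F q, form_closure B S q & forall s, S s -> B q s = l s].
Proof.
move=> cF sS SF ll lC.
have l0 : l 0 = 0.
  by have := ll 1 0 0 (subspace0 sS) (subspace0 sS);
     rewrite scale1r addr0 mul1r => /eqP; rewrite eq_sym addrC -subr_eq0 addrK => /eqP.
have lZ a u : S u -> l (a *: u) = a * l u.
  by move=> Su; rewrite -[a *: u]addr0 ll ?l0 ?addr0//; exact: subspace0.
have lD u v : S u -> S v -> l (u + v) = l u + l v.
  by move=> Su Sv; rewrite -[u in LHS]scale1r ll// mul1r.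
pose J s := B s s - 2 * l s.
have Jlb s : S s -> - C ^+ 2 <= J s.
  move=> Ss; rewrite /J -form_norm_sqr; last exact: SF.
  have := lC _ Ss; have := ler_norm (l s); set n := form_norm _ _.
  have := sqr_ge0 (n - C); rewrite sqrrB; lra.
pose im := [set J s | s in S].
have him : has_inf im.
  split; first by exists (J 0), 0 => //; exact: subspace0.
  by exists (- C ^+ 2) => _ [s Ss <-]; exact: Jlb.
have Jinf s : S s -> inf im <= J s by move=> Ss; apply: ge_inf; [case: him|exists s].
have /choice [s_ s_P] : forall n : nat, exists s, S s /\ J s < inf im + n.+1%:R^-1.
  move=> n; have [|_ [s Ss <-] sn] := @inf_adherent _ im n.+1%:R^-1 _ him.
    by rewrite invr_gt0.
  by exists s.
have Ss n : S (s_ n) by case: (s_P n).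
have Js n : J (s_ n) < inf im + n.+1%:R^-1 by case: (s_P n).
have Fs n : F (s_ n) by exact/SF/Ss.
(* Parallelogram law: [J] at the midpoint of [s_ i] and [s_ j] is the mean of the two values minus a
   quarter of this quantity, and it cannot go below the infimum. *)
have par i j : B (s_ i - s_ j) (s_ i - s_ j) <= 2 * i.+1%:R^-1 + 2 * j.+1%:R^-1.
  have := Jinf _ (subspaceZ sS 2^-1 (subspaceD sS (Ss i) (Ss j))).
  rewrite /J pfZl ?pfZr//; try (by apply: subspaceZ => //; exact: subspaceD);
    try exact: subspaceD.
  rewrite lZ ?lD//; last exact: subspaceD.
  rewrite pf_sqrD// pf_sqrB//; have := Js i; have := Js j; rewrite /J.
  move: (i.+1%:R^-1) (j.+1%:R^-1) (inf im) => x y z; lra.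
have cs (e : R) : 0 < e -> exists N : nat, forall i j : nat,
    (N <= i)%N -> (N <= j)%N -> form_norm B (s_ i - s_ j) < e.
  move=> e0; have [|N hN] := @inv_nat_small _ (e ^+ 2 / 4).
    by rewrite divr_gt0// exprn_gt0.
  exists N => i j /hN hi /hN hj; have Fij := subspaceB sF (Fs i) (Fs j).
  rewrite -(@ltr_pXn2r _ 2)// ?nnegrE ?form_norm_ge0// ?(ltW e0)//.
  rewrite form_norm_sqr//; move: (par i j) hi hj.
  move: (i.+1%:R^-1) (j.+1%:R^-1) => x y; lra.
have [q Fq sq] := cF s_ Fs cs; exists q; split => //.
  move=> e e0; have [N hN] := sq _ e0; exists (s_ N) => //.
  by rewrite form_normC// hN.
move=> s Ss'; have Fs' := SF _ Ss'.
(* This is J (q + t s) - J q >= 0. As [q] may lie outside [S], where [l] is not controlled, the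
   inequality is taken at [s_ n] and passed to the limit. *)
have key t : 0 <= 2 * t * (B q s - l s) + t ^+ 2 * B s s.
  apply/ler_addgt0Pl => e e0.
  pose K := 2 * `|t| * form_norm B s + 1.
  have K0 : 0 < K by rewrite ltr_wpDl// !mulr_ge0// form_norm_ge0.
  have [|N1 hN1] := sq (e / 2 / K); first by rewrite !divr_gt0.
  have [|N2 hN2] := @inv_nat_small _ (e / 2); first by rewrite divr_gt0.
  pose n := maxn N1 N2.
  have := hN1 n (leq_maxl _ _); have := hN2 n (leq_maxr _ _) => n2 n1.
  have := Jinf _ (subspaceD sS (Ss n) (subspaceZ sS t Ss')).
  have Fts : F (t *: s) by exact: subspaceZ.
  have Sts : S (t *: s) by exact: subspaceZ.
  rewrite /J pf_sqrD// !pfZl// !pfZr// lD// lZ// => h.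
  have Jn := Js n; rewrite /J in Jn.
  have : `|B (s_ n - q) s| <= e / 2 / K * form_norm B s.
    apply: le_trans (form_CauchySchwarz (subspaceB sF (Fs n) Fq) Fs') _.
    by rewrite ler_wpM2r ?form_norm_ge0// ltW.
  rewrite pfBl// => hB.
  have h2 : `|2 * t * (B (s_ n) s - B q s)| <= e / 2.
    rewrite normrM (@normrM _ 2) gtr0_norm//.
    apply: le_trans (ler_wpM2l _ hB) _; first by rewrite mulr_ge0.
    have -> : 2 * `|t| * (e / 2 / K * form_norm B s) =
      (e / 2) * ((2 * `|t| * form_norm B s) / K) by ring.
    rewrite ler_piMr ?divr_ge0 ?(ltW e0)// ler_pdivrMr// mul1r /K lerDl ler01.
    by [].
  have := ler_norm (2 * t * (B (s_ n) s - B q s)).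
  move: h2 h Jn n2; set x := 2 * t * (_ - _) => hx h Jn n2 hx2.
  have xE : x = 2 * (t * B (s_ n) s) - 2 * t * B q s by rewrite /x; ring.
  move: Jn n2 h; move: (n.+1%:R^-1) (inf im) => y z; lra.
apply/eqP; rewrite -subr_eq0; apply/eqP; set b := B q s - l s in key *.
have Bs0 := pf_ge0 fB Fs'.
(* The minimizing [t] would be - b / B s s; adding 1 covers the degenerate case B s s = 0. *)
have := key (- b / (B s s + 1)).
have Bs1 : B s s + 1 != 0 by rewrite gt_eqF// ltr_wpDl.
have -> : 2 * (- b / (B s s + 1)) * b + (- b / (B s s + 1)) ^+ 2 * B s s =
  - (b ^+ 2 * (B s s + 2) / (B s s + 1) ^+ 2) by field.
rewrite oppr_ge0 pmulr_lle0 ?invr_gt0 ?exprn_gt0 ?ltr_wpDl//.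
by rewrite pmulr_lle0 ?ltr_wpDl// => h; apply/eqP; rewrite -sqrf_eq0 eq_le h sqr_ge0.
Qed.

Lemma form_closure_eq S u v w : S `<=` F -> F u -> F v -> F w ->
  form_closure B S w -> (forall s, S s -> B u s = B v s) -> B u w = B v w.
Proof.
move=> SF Fu Fv Fw cw h; have Fuv := subspaceB sF Fu Fv.
apply/eqP; rewrite -subr_eq0 -pfBl// -normr_le0; apply/ler_addgt0Pr => e e0.
pose K := form_norm B (u - v) + 1.
have K0 : 0 < K by rewrite ltr_wpDl// form_norm_ge0.
have [|s Ss ws] := cw (e / K); first by rewrite divr_gt0.
have Fs := SF _ Ss; rewrite add0r.
have -> : B (u - v) w = B (u - v) (w - s).
  by rewrite (pfBr Fw Fs Fuv) (pfBl Fu Fv Fs) h// subrr subr0.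
apply: le_trans (form_CauchySchwarz Fuv (subspaceB sF Fw Fs)) _.
apply: le_trans (_ : K * (e / K) <= e); last by rewrite mulrC divfK// gt_eqF.
by apply: ler_pM; rewrite ?form_norm_ge0// ?ltW// ltrDl.
Qed.

End Form.
End PositiveForms.

(** * Real Hilbert spaces, finite projections, and Cauchy families along filters *)

Section Hilbert.
Context (R : realType) (H : lmodType R).
Implicit Types (ip : H -> H -> R) (S W : set H) (e : seq H).

(** The carrier is a bare module, so the uniform boundedness principle is carried as a field: weakly
    bounded sets are norm bounded. It does the work of the closed range theorem below. *)
Record hilbert ip : Prop := {
  hilbert_form : positive_form setT ip ;
  hilbert_definite : forall x, ip x x = 0 -> x = 0 ;
  hilbert_complete : form_complete setT ip ;
  hilbert_barrelled : forall S,
    (forall y, exists M, forall x, S x -> `|ip x y| <= M) ->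
    exists M, forall x, S x -> form_norm ip x <= M }.

Context (ip : H -> H -> R) (hip : hilbert ip).
Let fip := hilbert_form hip.
Let N := form_norm ip.

Lemma ipC x y : ip x y = ip y x. Proof. exact: (pf_sym fip). Qed.
Lemma ipDl x y z : ip (x + y) z = ip x z + ip y z. Proof. exact: (pfDl fip). Qed.
Lemma ipDr x y z : ip z (x + y) = ip z x + ip z y. Proof. exact: (pfDr fip). Qed.
Lemma ipBl x y z : ip (x - y) z = ip x z - ip y z. Proof. exact: (pfBl fip). Qed.
Lemma ipBr x y z : ip z (x - y) = ip z x - ip z y. Proof. exact: (pfBr fip). Qed.
Lemma ipNl x z : ip (- x) z = - ip x z. Proof. exact: (pfNl fip). Qed.
Lemma ipNr x z : ip z (- x) = - ip z x. Proof. exact: (pfNr fip). Qed.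
Lemma ipZl a x z : ip (a *: x) z = a * ip x z. Proof. exact: (pfZl fip). Qed.
Lemma ipZr a x z : ip z (a *: x) = a * ip z x. Proof. exact: (pfZr fip). Qed.
Lemma ip0l z : ip 0 z = 0. Proof. exact: (pf0l fip). Qed.
Lemma ip0r z : ip z 0 = 0. Proof. exact: (pf0r fip). Qed.
Lemma ip_ge0 x : 0 <= ip x x. Proof. exact: (pf_ge0 fip). Qed.
Lemma ip_normN x : N (- x) = N x. Proof. exact: (form_normN fip). Qed.
Lemma ip_normC x y : N (x - y) = N (y - x). Proof. exact: (form_normC fip). Qed.
Lemma ip_normZ a x : N (a *: x) = `|a| * N x. Proof. exact: (form_normZ fip). Qed.
Lemma ip_normD x y : N (x + y) <= N x + N y. Proof. exact: (form_normD fip). Qed.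
Lemma ip_norm_ge0 x : 0 <= N x. Proof. exact: form_norm_ge0. Qed.
Lemma ip_norm_sqr x : N x ^+ 2 = ip x x. Proof. exact: (form_norm_sqr fip). Qed.
Lemma ip_CS x y : `|ip x y| <= N x * N y. Proof. exact: (form_CauchySchwarz fip). Qed.
Lemma ip_norm0 : N 0 = 0.
Proof. by rewrite /N /form_norm ip0l sqrtr0. Qed.
Lemma ip_norm_eq0 x : N x = 0 -> x = 0.
Proof. by move=> x0; apply: (hilbert_definite hip); rewrite -ip_norm_sqr x0 expr0n. Qed.
Lemma ip_normB x y : N (x - y) <= N x + N y.
Proof. by rewrite -(ip_normN y); exact: ip_normD. Qed.

Lemma ip_ext x y : (forall z, ip x z = ip y z) -> x = y.
Proof.
move=> h; apply/eqP; rewrite -subr_eq0; apply/eqP/(hilbert_definite hip).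
by rewrite ipBl h subrr.
Qed.

Definition ip_closed S : Prop := form_closure ip S `<=` S.

Lemma ip_orthogonal_closure S x y : (forall s, S s -> ip s y = 0) ->
  form_closure ip S x -> ip x y = 0.
Proof.
move=> hS xS; rewrite ipC -[RHS](ip0l x).
apply: (@form_closure_eq _ _ setT _ fip S) => // s Ss.
by rewrite ip0l ipC hS.
Qed.

Lemma orthogonal_projection S x : subspace S -> ip_closed S ->
  exists2 p, S p & forall s, S s -> ip (x - p) s = 0.
Proof.
move=> sS cS.
have [//|||q [_ /cS Sq qS]] :=
  @form_representation _ _ _ _ fip S (ip x) (N x) (hilbert_complete hip) sS.
- by move=> a u v _ _; rewrite ipDr ipZr.
- by move=> u _; exact: ip_CS.
by exists q => // s Ss; rewrite ipBl qS// subrr.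
Qed.

Lemma ip_closed_setT : ip_closed setT. Proof. by []. Qed.

Lemma ip_closed_cvg S (u_ : nat -> H) u : ip_closed S -> (forall n, S (u_ n)) ->
  (forall e : R, 0 < e -> exists M : nat, forall n, (M <= n)%N -> N (u_ n - u) < e) ->
  S u.
Proof.
move=> cS Su uu; apply: cS => e /uu[M hM]; exists (u_ M) => //.
by rewrite -/N ip_normC hM.
Qed.

Definition ip_proj e (x : H) : H := \sum_(y <- e) ip x y *: y.

Lemma ip_proj_linear e : linear (ip_proj e).
Proof.
move=> a x y; rewrite /ip_proj scaler_sumr -big_split/=; apply: eq_bigr => z _.
by rewrite ipDl ipZl scalerDl scalerA.
Qed.

Lemma ip_proj_orthogonal e x z : (forall y, y \in e -> ip y z = 0) ->
  ip (ip_proj e x) z = 0.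
Proof.
rewrite /ip_proj; elim: e => [_|y e IH he]; first by rewrite big_nil ip0l.
rewrite big_cons ipDl ipZl he ?mem_head// mulr0 add0r IH// => y' y'e.
by rewrite he// inE y'e orbT.
Qed.

Lemma ip_proj_eq0 e x : (forall y, y \in e -> ip y x = 0) -> ip_proj e x = 0.
Proof.
by move=> h; rewrite /ip_proj big_seq big1// => y ye; rewrite ipC h// scale0r.
Qed.

(** For [x] = [y] in [e] the second clause reads \sum_z (ip y z)^2 = ip y y = 1, so that the entries
    are pairwise orthogonal and none is repeated; in general it makes [ip_proj e] the orthogonal
    projection onto the span. *)
Definition ip_orthonormal e : Prop :=
  (forall x, x \in e -> ip x x = 1) /\
  forall x y, y \in e -> ip (x - ip_proj e x) y = 0.

Lemma gram_schmidt S (l : seq H) : subspace S -> (forall x, x \in l -> S x) ->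
  exists e, [/\ ip_orthonormal e, forall x, x \in e -> S x &
                forall x, x \in l -> ip_proj e x = x].
Proof.
move=> sS; elim: l => [_|a l IH lS].
  by exists [::]; split => //; split.
have [x xl|e [[e1 eo] eS el]] := IH; first by apply: lS; rewrite inE xl orbT.
pose r := a - ip_proj e a.
have Sr : S r.
  apply: subspaceB => //; first by apply: lS; rewrite mem_head.
  by apply: subspace_sum => // y ye; apply: subspaceZ => //; exact: eS.
have [r0|rn0] := eqVneq r 0.
  exists e; split => // x; rewrite inE => /orP[/eqP->|]; last exact: el.
  by apply/eqP; rewrite eq_sym -subr_eq0; apply/eqP.
have Nr0 : N r != 0 by apply: contra_neq rn0; exact: ip_norm_eq0.
pose r' := (N r)^-1 *: r.
have r'e y : y \in e -> ip r' y = 0 by move=> ye; rewrite ipZl eo// mulr0.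
have r'1 : ip r' r' = 1.
  by rewrite ipZl ipZr -ip_norm_sqr expr2; field.
have projE x : ip_proj (r' :: e) x = ip x r' *: r' + ip_proj e x.
  by rewrite /ip_proj big_cons.
have per x : ip (ip_proj e x) r' = 0.
  by apply: ip_proj_orthogonal => y ye; rewrite ipC r'e.
exists (r' :: e); split.
- split=> [x|x y]; rewrite inE => /orP[/eqP->//|].
  + exact: e1.
  + by rewrite projE ipBl ipDl ipZl r'1 mulr1 per addr0 subrr.
  + move=> ye; rewrite projE opprD addrCA ipDl -scaleNr ipZl r'e// mulr0 add0r.
    exact: eo.
- move=> x; rewrite inE => /orP[/eqP->|]; last exact: eS.
  exact: subspaceZ.
- move=> x; rewrite inE => /orP[/eqP->|xl]; rewrite projE.
    have aE : a = r + ip_proj e a by rewrite subrK.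
    have arr : ip a r' = N r.
      rewrite {1}aE ipDl per addr0 ipZr -ip_norm_sqr expr2 mulrA.
      by rewrite mulVf// mul1r.
    by rewrite arr scalerA divff// scale1r subrK.
  have := el _ xl => xE; rewrite xE -{1}xE per scale0r add0r//.
Qed.

Lemma ip_orthonormal_le e x : ip_orthonormal e -> ip_proj e x = x ->
  N x <= \sum_(y <- e) `|ip x y|.
Proof.
move=> [e1 _] {1}<-; rewrite /ip_proj big_seq [leRHS]big_seq.
elim/big_ind2 : _ => [|a b c d ab cd|y ye]; first by rewrite ip_norm0.
  by apply: le_trans (ip_normD _ _) _; exact: lerD.
by rewrite ip_normZ /N /form_norm e1// sqrtr1 mulr1.
Qed.

Definition ultra_cauchy (I : Type) (U : set_system I) (f : I -> H) : Prop :=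
  forall e : R, 0 < e -> exists2 S, U S & forall x y, S x -> S y -> N (f x - f y) < e.

Lemma ultra_cauchyD I (U : set_system I) (f g : I -> H) : Filter U ->
  ultra_cauchy U f -> ultra_cauchy U g -> ultra_cauchy U (fun i => f i + g i).
Proof.
move=> FU hf hg e e0.
have e2 : 0 < e / 2 by rewrite divr_gt0.
have [S US fS] := hf _ e2; have [S' US' gS] := hg _ e2.
exists (S `&` S'); first exact: filterI.
move=> x y [Sx S'x] [Sy S'y]; rewrite opprD addrACA.
apply: le_lt_trans (ip_normD _ _) _.
by rewrite [e]splitr ltrD// ?fS ?gS.
Qed.

Lemma ultra_cauchy_lin I (U : set_system I) (f : I -> H) (L : H -> H) c :
  linear L -> (forall x, N (L x) <= c * N x) ->
  ultra_cauchy U f -> ultra_cauchy U (fun i => L (f i)).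
Proof.
move=> lL Lc hf e e0.
have c0 : 0 < `|c| + 1 by rewrite ltr_wpDl.
have [S US fS] := hf _ (divr_gt0 e0 c0); exists S => // x y Sx Sy /=.
have -> : L (f x) - L (f y) = L (f x - f y).
  by have := lL (-1) (f y) (f x); rewrite !scaleN1r => h; rewrite addrC -h addrC.
apply: le_lt_trans (Lc _) _.
have := fS _ _ Sx Sy; rewrite ltr_pdivlMr// mulrC; apply: le_lt_trans.
by rewrite ler_wpM2r ?ip_norm_ge0// (le_trans (ler_norm c))// lerDl.
Qed.

(** Compactness of [-M, M]. Applied to inner products with a fixed vector, this takes the place of
    extracting weakly convergent subsequences. *)
Lemma ultra_bounded_real I (U : set_system I) (f : I -> R) (M : R) :
  UltraFilter U -> U [set i | `|f i| <= M] ->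
  forall e : R, 0 < e -> exists2 S, U S & forall x y, S x -> S y -> `|f x - f y| < e.
Proof.
move=> UU fM e e0.
(* The image of [U] is already an ultrafilter, so [G] adds nothing to it: members of [G] pull back
   to members of [U], by the dichotomy on the preimage. *)
have [G [UG sG]] := @ultraFilterLemma _ (f @ U) (fmap_proper_filter f _).
have UGE A : G A -> U (f @^-1` A).
  move=> GA; have [//|nA] := in_ultra_setVsetC (f @^-1` A) UU.
  have GnA : G (~` A) by apply: sG.
  by have [x []] := filter_ex (filterI GA GnA).
have cM : compact `[- M, M] by exact: segment_compact.
rewrite compact_ultra in cM.
have [|p [_ /= Gp]] := cM G UG.
  apply: sG; apply: (@filterS _ U _ [set i | `|f i| <= M]) => // i /=.
  by rewrite in_itv/= ler_norml.
have e2 : 0 < e / 2 by rewrite divr_gt0.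
have := Gp _ (nbhsx_ballx p (e / 2) e2).
move=> /UGE hS; exists (f @^-1` ball p (e / 2)) => // x y /= px py.
rewrite [e]splitr; apply: le_lt_trans (ler_distD p _ _) _.
by rewrite ltrD// distrC.
Qed.

Lemma ultra_nat_cauchy_near (f : nat -> H) (U : set_system nat) : UltraFilter U ->
  \oo `<=` U -> ultra_cauchy U f -> forall e : R, 0 < e ->
  exists i j : nat, (i < j)%N /\ N (f j - f i) < e.
Proof.
move=> UU sU hf e /hf[S US fS]; have [i Si] := filter_ex US.
have Ui : U [set j | (i < j)%N] by apply: sU; exists i.+1.
have [j [ij Sj]] := filter_ex (filterI Ui US).
by exists i, j; split => //; exact: fS.
Qed.

(** [U] need not have a countable base. A diagonal choice [n_ k] in the intersection of the first
    [k + 1] small sets, and beyond [k], gives an ordinary Cauchy sequence whose limit is approached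
    at arbitrarily late indices. *)
Lemma ultra_cauchy_cvg (f : nat -> H) (U : set_system nat) : UltraFilter U ->
  \oo `<=` U -> ultra_cauchy U f ->
  exists x, forall e : R, 0 < e -> forall m : nat, exists2 n, (m <= n)%N & N (f n - x) < e.
Proof.
move=> UU sU hf.
have hf' (k : nat) : exists S : set nat, U S /\
    forall x y, S x -> S y -> N (f x - f y) < k.+1%:R^-1.
  by have [|S US fS] := hf k.+1%:R^-1; [rewrite invr_gt0|exists S].
have [S_ hS] := choice hf'.
have UI k : U [set j | forall i, (i < k)%N -> S_ i j].
  elim: k => [|k IH]; first by apply: filterS (filterT) => j _ i.
  have [US _] := hS k; apply: filterS (filterI IH US) => j [h Sk] i.
  by rewrite ltnS leq_eqVlt => /orP[/eqP->//|]; exact: h.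
have Uge k : U [set j | (k <= j)%N] by apply: sU; exists k.
have /choice[n_ hn] (k : nat) : exists n, (forall i, (i < k.+1)%N -> S_ i n) /\ (k <= n)%N.
  by have [n [? ?]] := filter_ex (filterI (UI k.+1) (Uge k)); exists n.
have cau i j k : (k <= i)%N -> (k <= j)%N -> N (f (n_ i) - f (n_ j)) < k.+1%:R^-1.
  move=> ki kj; have [_ h] := hS k; apply: h; apply: (hn _).1 => /=.
    by rewrite ltnS.
  by rewrite ltnS.
have [//||x _ hx] := hilbert_complete hip (u_ := f \o n_).
  move=> e /inv_nat_small[k hk]; exists k => i j ki kj.
  by apply: lt_trans (hk k (leqnn _)); exact: cau.
exists x => e /hx[k hk] m; exists (n_ (maxn k m)).
  by apply: leq_trans (hn _).2; exact: leq_maxr.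
by apply: hk; exact: leq_maxl.
Qed.

End Hilbert.

(** * Fredholm operators and ultrafilters *)

Section NormalOperator.
Context (R : realType) (H : lmodType R) (ip : H -> H -> R) (hip : hilbert ip).
Let N := form_norm ip.

(** For a bounded operator on a closed subspace this characterizes the upper semi-Fredholm ones:
    finite-dimensional kernel and closed range. Normality later supplies the cokernel. *)
Definition proper_on (W : set H) (A : H -> H) : Prop :=
  forall (I : Type) (U : set_system I) (f : I -> H), UltraFilter U ->
    (forall i, W (f i)) -> (exists M, U [set i | N (f i) <= M]) ->
    ultra_cauchy ip U (A \o f) -> ultra_cauchy ip U f.

Context (W : set H) (sW : subspace W) (cW : ip_closed ip W).
Context (A A' J : H -> H) (lA : linear A) (lJ : linear J).
Context (c : R) (Ac : forall x, N (A x) <= c * N x).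
Hypothesis AA' : forall x y, ip (A x) y = ip x (A' y).
Hypothesis A_normal : forall x, A (A' x) = A' (A x).
Hypothesis AW : forall x, W x -> W (A x).
Hypothesis A'W : forall x, W x -> W (A' x).
(** [J] abstracts complex conjugation, which exchanges 1 - (z + 1) G with its adjoint. It carries
    closedness of the range over from [A] to [A']. *)
Hypothesis JJ : forall x, J (J x) = x.
Hypothesis J_ip : forall x y, ip (J x) y = ip x (J y).
Hypothesis JA : forall x, J (A x) = A' (J x).
Hypothesis JW : forall x, W x -> W (J x).

Definition ker_on : set H := [set x | W x /\ A x = 0].
Definition ran_on : set H := [set A x | x in W].
Definition coker_on : set H := [set x | W x /\ forall y, ker_on y -> ip x y = 0].

Lemma lin0 (L : H -> H) : linear L -> L 0 = 0.
Proof.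
move=> lL; have := lL 1 0 0; rewrite !scale1r addr0 => /esym/eqP.
by rewrite -subr_eq0 addrK => /eqP.
Qed.
Lemma linB (L : H -> H) : linear L -> forall x y, L (x - y) = L x - L y.
Proof.
move=> lL x y; have := lL (-1) y x; rewrite !scaleN1r => h.
by rewrite addrC h addrC.
Qed.

(** Normality makes [A x] and [A' x] equal in norm. *)
Lemma ker_adjoint x : A x = 0 <-> A' x = 0.
Proof.
have E : ip (A x) (A x) = ip (A' x) (A' x).
  by rewrite -[RHS]AA' A_normal (ipC hip (A' (A x))) AA'.
split => x0; apply: (hilbert_definite hip); first by rewrite -E x0 (ip0l hip).
by rewrite E x0 (ip0l hip).
Qed.

Lemma subspace_ker : subspace ker_on.
Proof.
split; first by split; [exact: subspace0|exact: lin0].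
move=> a u v [Wu Au] [Wv Av]; split; last by rewrite lA Au Av scaler0 addr0.
exact: sW.2.
Qed.

Lemma A_small x y (e : R) : 0 < e -> N (x - y) < e / (`|c| + 1) -> N (A x - A y) < e.
Proof.
move=> e0; rewrite ltr_pdivlMr ?ltr_wpDl// => xy; rewrite -linB//.
apply: le_lt_trans (Ac _) _; apply: le_lt_trans xy; rewrite mulrC.
by rewrite ler_wpM2l ?(ip_norm_ge0 ip)// (le_trans (ler_norm c))// lerDl.
Qed.

Lemma small_scale (e : R) : 0 < e -> 0 < e / (`|c| + 1).
Proof. by move=> e0; rewrite divr_gt0// ltr_wpDl. Qed.

Lemma ip_small_eq0 x : (forall e : R, 0 < e -> N x < e) -> x = 0.
Proof.
move=> h; apply: (ip_norm_eq0 hip); apply/eqP; rewrite eq_le (ip_norm_ge0 ip) andbT.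
by apply/ler_addgt0Pr => e e0; rewrite add0r ltW// h.
Qed.

Lemma closed_ker : ip_closed ip ker_on.
Proof.
move=> x xK; split; first by apply: cW => e /xK[s [Ws _] xs]; exists s.
apply: ip_small_eq0 => e e0; have [s [_ As] xs] := xK _ (small_scale e0).
by have := A_small e0 xs; rewrite As subr0.
Qed.

Lemma subspace_ran : subspace ran_on.
Proof.
split; first by exists 0; [exact: subspace0|exact: lin0].
by move=> a _ _ [x Wx <-] [y Wy <-]; exists (a *: x + y); [exact: sW.2|rewrite lA].
Qed.

Lemma subspace_coker : subspace coker_on.
Proof.
split; first by split; [exact: subspace0|move=> y _; rewrite (ip0l hip)].
move=> a u v [Wu uK] [Wv vK]; split; first exact: sW.2.
by move=> y Ky; rewrite (ipDl hip) (ipZl hip) uK// vK// mulr0 addr0.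
Qed.

Lemma closed_coker : ip_closed ip coker_on.
Proof.
move=> x xC; split; first by apply: cW => e /xC[s [Ws _] xs]; exists s.
by move=> y Ky; apply: (ip_orthogonal_closure hip (S := coker_on)) => // s [_]; apply.
Qed.

Lemma ran_ker_orthogonal x y : ker_on y -> ip (A x) y = 0.
Proof. by move=> [_ /ker_adjoint Ay]; rewrite AA' Ay (ip0r hip). Qed.

Lemma ker_coker_eq0 x : ker_on x -> coker_on x -> x = 0.
Proof. by move=> Kx [_ /(_ x Kx)]; exact: (hilbert_definite hip). Qed.

(* If the range is closed then so is the range of the adjoint, which then
   exhausts the orthogonal complement of the kernel; hence the vectors [x]
   orthogonal to the kernel with [N (A x) <= 1] are weakly bounded. *)
Lemma closed_range_bounded_below : ip_closed ip ran_on ->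
  exists C : R, forall x, coker_on x -> N x <= C * N (A x).
Proof.
move=> cR.
(* The defect [s] of [J w] from the range of [A] is killed by [A'], hence lies in the kernel, and so
   does [J s]. Thus [s] is orthogonal to the projection [r], and [J s] to [w]; therefore [s] is
   orthogonal to itself. *)
have ranA' w : coker_on w -> exists2 v, W v & w = A' v.
  move=> [Ww wK].
  have [r Rr rR] := orthogonal_projection hip (J w) subspace_ran cR.
  have Wr : W r by case: Rr => x Wx <-; exact: AW.
  pose s := J w - r.
  have Ws : W s by apply: subspaceB => //; exact: JW.
  have A's : A' s = 0.
    apply: (hilbert_definite hip); rewrite -AA' (ipC hip).
    by apply: rR; exists (A' s) => //; exact: A'W.
  have Ks : ker_on s by split=> //; apply/ker_adjoint.
  have KJs : ker_on (J s).
    split; first exact: JW.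
    by apply/ker_adjoint; rewrite -JA (ker_adjoint s).2// lin0.
  have s0 : s = 0.
    apply: (hilbert_definite hip); rewrite {1}/s (ipBl hip) J_ip wK// sub0r.
    by case: Rr => x Wx <-; rewrite ran_ker_orthogonal// oppr0.
  case: Rr => v Wv Av; exists (J v); first exact: JW.
  rewrite -JA Av -[w]JJ; congr J; apply/eqP; rewrite -subr_eq0; exact/eqP.
pose S := [set x | coker_on x /\ N (A x) <= 1].
have [y|M hM] := hilbert_barrelled hip (S := S).
  have [w Ww wy] := orthogonal_projection hip y sW cW.
  have [p Kp pw] := orthogonal_projection hip w subspace_ker closed_ker.
  have [|v Wv vE] := ranA' (w - p).
    by split; [apply: subspaceB => //; case: Kp|exact: pw].
  exists (N v) => x [[Wx xK] Ax].
  have -> : ip x y = ip (A x) v.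
    rewrite AA' -vE (ipBr hip) (xK _ Kp) subr0; apply/eqP; rewrite -subr_eq0 -(ipBr hip).
    by rewrite (ipC hip) wy.
  apply: le_trans (ip_CS hip _ _) _.
  by rewrite ler_piMl// (ip_norm_ge0 ip).
exists (`|M| + 1) => x Cx; have [Ax0|Ax0] := eqVneq (N (A x)) 0.
  suff -> : x = 0 by rewrite /N (ip_norm0 hip) mulr_ge0// ?addr_ge0// form_norm_ge0.
  apply: ker_coker_eq0 => //; split; first by case: Cx.
  exact: (ip_norm_eq0 hip).
have Ax_gt0 : 0 < N (A x) by rewrite lt_def Ax0 (ip_norm_ge0 ip).
have lAZ a u : A (a *: u) = a *: A u.
  by rewrite -[a *: u]addr0 lA lin0// addr0.
have : N ((N (A x))^-1 *: x) <= M.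
  apply: hM; split; first exact: (subspaceZ subspace_coker).
  by rewrite lAZ /N (ip_normZ hip) gtr0_norm ?invr_gt0// mulVf.
rewrite /N (ip_normZ hip) gtr0_norm ?invr_gt0// ler_pdivrMl// => h.
apply: le_trans h _; rewrite mulrC ler_wpM2r ?(ltW Ax_gt0)//.
by rewrite (le_trans (ler_norm M))// lerDl.
Qed.

(** The component orthogonal to the kernel is controlled by [A x], and the kernel component by
    finitely many bounded scalars, which are Cauchy along every ultrafilter. *)
Lemma fredholm_proper e : ip_orthonormal ip e ->
  (forall x, ker_on x -> ip_proj ip e x = x) -> ip_closed ip ran_on ->
  proper_on W A.
Proof.
move=> oe Ke cR I U f UU Wf [M fM] Af.
have [C hC] := closed_range_bounded_below cR.
(* The coordinates of the kernel component [p] are those of [x] up to inner products with [x - p],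
   whose norm is at most [|C| * N (A x)]; this accounts for the sum inside the first constant. *)
have bound x : W x ->
    N x <= (`|C| + \sum_(y <- e) N y * `|C|) * N (A x) + \sum_(y <- e) `|ip x y| + 0.
  move=> Wx; have [p Kp px] := orthogonal_projection hip x subspace_ker closed_ker.
  have Wp : W p by case: Kp.
  have Cx : coker_on (x - p) by split => //; exact: subspaceB.
  have AxE : A (x - p) = A x by rewrite linB//; case: Kp => _ ->; rewrite subr0.
  have h1 := hC _ Cx; rewrite AxE in h1.
  have h2 : N (x - p) <= `|C| * N (A x).
    by apply: le_trans h1 _; rewrite ler_wpM2r ?(ip_norm_ge0 ip)// ler_norm.
  have h3 := ip_orthonormal_le hip oe (Ke _ Kp).
  have -> : x = (x - p) + p by rewrite subrK.
  apply: le_trans (ip_normD hip _ _) _; rewrite subrK.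
  rewrite addr0 mulrDl -addrA lerD//; apply: le_trans h3 _.
  rewrite mulr_suml -big_split/= !big_seq; apply: ler_sum => y ye.
  have -> : ip p y = ip x y - ip (x - p) y by rewrite (ipBl hip) opprB addrC subrK.
  rewrite addrC; apply: le_trans (ler_normB _ _) _; rewrite lerD2l -mulrA.
  apply: le_trans (ip_CS hip _ _) _.
  by rewrite mulrC ler_wpM2l ?(ip_norm_ge0 ip).
move: bound; set K := `|C| + _ => bound.
have K0 : 0 <= K by rewrite addr_ge0// sumr_ge0// => y _; rewrite mulr_ge0// form_norm_ge0.
move=> d d0.
have [|S1 US1 hS1] := Af (d / 2 / (K + 1)); first by rewrite !divr_gt0// ltr_wpDl.
have [S2 US2 hS2] : exists2 S, U S & forall x y, S x -> S y ->
    \sum_(z <- e) `|ip (f x - f y) z| < d / 2.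
  have : forall d : R, 0 < d -> exists2 S, U S & forall x y, S x -> S y ->
    \sum_(z <- e) `|ip (f x - f y) z| < d.
    elim: (e) => [|z e' IH] d' d'0.
      by exists setT; [exact: filterT|move=> *; rewrite big_nil].
    have d'2 : 0 < d' / 2 by rewrite divr_gt0.
    have [S1' US1' hS1'] := IH _ d'2.
    have [|S2' US2' hS2'] := @ultra_bounded_real _ _ U (fun i => ip (f i) z)
        (M * N z) UU _ _ d'2.
      apply: filterS fM => i /= fiM; apply: le_trans (ip_CS hip _ _) _.
      by rewrite ler_wpM2r ?(ip_norm_ge0 ip).
    exists (S1' `&` S2'); first exact: filterI.
    move=> x y [? ?] [? ?]; rewrite big_cons (ipBl hip) [d']splitr.
    by rewrite ltrD// ?hS1' ?hS2'.
  by apply; rewrite divr_gt0.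
exists (S1 `&` S2); first exact: filterI.
move=> x y [S1x S2x] [S1y S2y].
apply: le_lt_trans (bound _ _) _; first exact: subspaceB.
rewrite addr0 linB// [d]splitr ler_ltD ?hS2//.
have := hS1 _ _ S1x S1y; rewrite ltr_pdivlMr ?ltr_wpDl// /= => /ltW h.
apply: le_trans h; rewrite mulrC ler_wpM2l ?(ip_norm_ge0 ip)//.
by rewrite lerDl.
Qed.

(** Otherwise there are unit vectors orthogonal to the kernel with images tending to 0. Along an
    ultrafilter refining [\oo] they are Cauchy, and a limit of norm 1 would lie both in the kernel
    and in its orthogonal complement. *)
Lemma proper_bounded_below : proper_on W A ->
  exists2 C : R, 0 < C & forall x, coker_on x -> N x <= C * N (A x).
Proof.
move=> pA; apply: contrapT => nC.
have /choice[x_ hx] (n : nat) : exists x, [/\ coker_on x, N x = 1 & N (A x) < n.+1%:R^-1].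
  apply: contrapT => nx; apply: nC; exists n.+1%:R => // x Cx.
  rewrite leNgt; apply/negP => Nx.
  have x0 : 0 < N x by apply: le_lt_trans Nx; rewrite mulr_ge0// (ip_norm_ge0 ip).
  apply: nx; exists ((N x)^-1 *: x); split.
  - exact: (subspaceZ subspace_coker).
  - by rewrite /N (ip_normZ hip) gtr0_norm ?invr_gt0// mulVf// gt_eqF.
  - have -> : A ((N x)^-1 *: x) = (N x)^-1 *: A x.
      by rewrite -[_ *: x]addr0 lA lin0// addr0.
    rewrite /N (ip_normZ hip) gtr0_norm ?invr_gt0// ltr_pdivrMl//.
    by rewrite ltr_pdivlMr// mulrC.
have [U [UU sU]] := @ultraFilterLemma nat \oo _.
have xc : ultra_cauchy ip U x_.
  apply: pA => //.
  - by move=> i; case: (hx i) => -[].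
  - by exists 1; apply: filterS filterT => i _ /=; case: (hx i) => _ ->.
  move=> e e0; have e2 : 0 < e / 2 by rewrite divr_gt0.
  have [n hn] := inv_nat_small e2.
  exists [set k | (n <= k)%N]; first by apply: sU; exists n.
  move=> i j /= ni nj; apply: le_lt_trans (ip_normB hip _ _) _.
  rewrite [e]splitr ltrD//; [case: (hx i) => _ _|case: (hx j) => _ _].
    by move/lt_trans; apply; exact: hn.
  by move/lt_trans; apply; exact: hn.
have [x hxl] := ultra_cauchy_cvg hip UU sU xc.
have Cx : coker_on x.
  apply: closed_coker => e /hxl/(_ 0%N)[n _ nx]; exists (x_ n); first by case: (hx n).
  by rewrite (form_normC (hilbert_form hip)).
have Ax : A x = 0.
  apply: ip_small_eq0 => e e0; have e2 : 0 < e / 2 by rewrite divr_gt0.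
  have [n hn] := inv_nat_small e2.
  have [k nk kx] := hxl _ (small_scale e2) n.
  have -> : A x = A (x_ k) - (A (x_ k) - A x) by rewrite opprB addrC subrK.
  apply: le_lt_trans (ip_normB hip _ _) _; rewrite [e]splitr ltrD//.
    by case: (hx k) => _ _ /lt_trans; apply; exact: hn.
  exact: A_small.
have x0 : x = 0 by apply: ker_coker_eq0 => //; split => //; case: Cx.
have [|n _] := hxl 1 _ 0%N => //.
by rewrite x0 subr0; case: (hx n) => _; rewrite /N => ->; rewrite ltxx.
Qed.

(** An infinite orthonormal sequence in the kernel has images equal to 0, which are trivially
    Cauchy, although its members stay at squared distance 2 from each other. *)
Lemma proper_finite_ker : proper_on W A ->
  exists e, [/\ ip_orthonormal ip e, forall x, x \in e -> ker_on x &
                forall x, ker_on x -> ip_proj ip e x = x].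
Proof.
move=> pA; apply: contrapT => ne.
(* The premise on [l] stays under the existential so that [choice] yields a function on all lists,
   which can then be iterated; lists not contained in the kernel get the junk value 0. *)
have step (l : seq H) : exists x, (forall y, y \in l -> ker_on y) ->
    [/\ ker_on x, N x = 1 & forall y, y \in l -> ip x y = 0].
  have [lK|lK] := pselect (forall y, y \in l -> ker_on y); last by exists 0.
  have [e [oe eK el]] := gram_schmidt hip subspace_ker lK.
  have [x [Kx px]] : exists x, ker_on x /\ ip_proj ip e x <> x.
    apply: contrapT => nx; apply: ne; exists e; split => // x Kx.
    by apply: contrapT => px; apply: nx; exists x.
  pose y := x - ip_proj ip e x.
  have Ky : ker_on y.
    apply: (subspaceB subspace_ker) => //; apply: (subspace_sum subspace_ker) => z ze.
    by apply: (subspaceZ subspace_ker); exact: eK.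
  have y0 : N y != 0.
    apply/eqP => /(ip_norm_eq0 hip) /eqP; rewrite subr_eq0 => /eqP xE.
    exact/px/esym.
  have y_gt0 : 0 < N y by rewrite lt_def y0 (ip_norm_ge0 ip).
  exists ((N y)^-1 *: y) => _; split.
  - exact: (subspaceZ subspace_ker).
  - by rewrite /N (ip_normZ hip) gtr0_norm ?invr_gt0// mulVf.
  - move=> z zl; rewrite (ipZl hip) -(el _ zl) (ipC hip) (ip_proj_orthogonal hip) ?mulr0//.
    by move=> t te; rewrite (ipC hip); apply: oe.2.
have [nx hnx] := choice step.
pose L := fix L n := if n is n'.+1 then nx (L n') :: L n' else [::].
have LK n : forall y, y \in L n -> ker_on y.
  elim: n => // n IH y; rewrite inE => /orP[/eqP->|]; last exact: IH.
  by case: (hnx _ IH).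
have Lin m n : (m < n)%N -> nx (L m) \in L n.
  elim: n => // n IH; rewrite ltnS leq_eqVlt => /orP[/eqP->|/IH h].
    by rewrite mem_head.
  by rewrite inE h orbT.
have [U [UU sU]] := @ultraFilterLemma nat \oo _.
have [||i [j [ij]]] := @ultra_nat_cauchy_near _ _ ip (nx \o L) U UU sU _ 1.
- apply: pA => //.
  + by move=> i; case: (hnx _ (LK i)) => -[].
  + by exists 1; apply: filterS filterT => i _ /=; case: (hnx _ (LK i)) => _ ->.
  + move=> e e0; exists setT; first exact: filterT.
    move=> i j _ _ /=; case: (hnx _ (LK i)) => -[_ ->] _ _.
    by case: (hnx _ (LK j)) => -[_ ->] _ _; rewrite subrr (ip_norm0 hip).
- by [].
case: (hnx _ (LK j)) => _ j1 /(_ _ (Lin _ _ ij)) ji.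
case: (hnx _ (LK i)) => _ i1 _ /=.
rewrite ltNge => /negP; apply.
rewrite -(@ler_pXn2r _ 2)// ?nnegrE ?(ip_norm_ge0 ip)// (ip_norm_sqr hip) expr1n.
rewrite (pf_sqrB (hilbert_form hip))// ji mulr0 subr0 -!(ip_norm_sqr hip).
by rewrite -/N i1 j1 expr1n lerDl.
Qed.

(** [A y] is the best approximation of [x] in the range, obtained by Riesz for the form <A u, A v>,
    complete on the complement of the kernel since [A] is bounded below there. The residual is
    orthogonal to the range, hence lies in the kernel of [A'], which is that of [A]. *)
Lemma proper_fredholm : proper_on W A ->
  exists e, [/\ ip_orthonormal ip e, forall x, x \in e -> ker_on x,
   forall x, ker_on x -> ip_proj ip e x = x &
   forall x, W x -> exists2 y, W y & x = A y + ip_proj ip e x].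
Proof.
move=> pA; have [e [oe eK Ke]] := proper_finite_ker pA; exists e; split => //.
have [C C0 hC] := proper_bounded_below pA.
move=> x Wx.
have fB : positive_form coker_on (fun u v => ip (A u) (A v)).
  split; first exact: subspace_coker.
  - by move=> a u v w _ _ _; rewrite lA (ipDl hip) (ipZl hip).
  - by move=> u v _ _; rewrite (ipC hip).
  - by move=> u _; exact: (ip_ge0 hip).
have [||||q [Cq _ qx]] := @form_representation _ _ _ _ fB coker_on
    (fun v => ip x (A v)) (N x) _ subspace_coker _ _ _.
- move=> u_ Cu cu.
  have [//||u _ uu] := hilbert_complete hip (u_ := u_).
    move=> d d0; have dC : 0 < d / C by rewrite divr_gt0.
    have [M hM] := cu _ dC; exists M => i j Mi Mj.
    have := hM i j Mi Mj; rewrite {1}/form_norm -/(form_norm ip _) => h.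
    apply: le_lt_trans (hC _ (subspaceB subspace_coker (Cu i) (Cu j))) _.
    by rewrite mulrC -ltr_pdivlMr.
  exists u.
    exact: (ip_closed_cvg hip closed_coker Cu uu).
  move=> d d0; have [M hM] := uu _ (small_scale d0); exists M => n /hM h.
  by rewrite /form_norm linB//; exact: A_small.
- by [].
- by move=> a u v _ _; rewrite lA (ipDr hip) (ipZr hip).
- by move=> u _; exact: (ip_CS hip).
have Wq : W q by case: Cq.
exists q => //; pose r := x - A q.
have Wr : W r by apply: subspaceB => //; exact: AW.
have rA v : W v -> ip r (A v) = 0.
  move=> Wv; have [p Kp pv] := orthogonal_projection hip v subspace_ker closed_ker.
  have Cv : coker_on (v - p) by split => //; apply: subspaceB => //; case: Kp.
  have -> : A v = A (v - p) by rewrite linB//; case: Kp => _ ->; rewrite subr0.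
  by rewrite (ipBl hip) qx// subrr.
have Kr : ker_on r.
  split => //; apply/ker_adjoint; apply: (hilbert_definite hip).
  by rewrite -AA' (ipC hip) rA//; exact: A'W.
have <- : ip_proj ip e r = ip_proj ip e x.
  have -> : ip_proj ip e x = ip_proj ip e (A q) + ip_proj ip e r.
    have := ip_proj_linear hip e 1 (A q) r; rewrite !scale1r => <-.
    by rewrite addrC subrK.
  rewrite [ip_proj _ _ (A q)](ip_proj_eq0 hip) ?add0r// => y /eK Ky.
  by rewrite (ipC hip) ran_ker_orthogonal.
by rewrite Ke// addrC subrK.
Qed.

End NormalOperator.

(** * Complexification, and the Fredholm property of H - z in terms of the resolvent *)

Section SquareHilbert.
Context (R : realType) (V : normedModType R) (ip : V -> V -> R) (hip : hilbert ip).
Let N := form_norm ip.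

(** The real part of the Hermitian product on the complexification. It has the same norm, so the
    real theory above applies; complex scalars return only when dimensions are counted. *)
Definition ip2 (x y : V * V) : R := ip x.1 y.1 + ip x.2 y.2.
Let N2 := form_norm ip2.

Lemma positive_form_ip2 : positive_form setT ip2.
Proof.
split => //.
- by move=> a u v w _ _ _; rewrite /ip2/= !(ipDl hip) !(ipZl hip); ring.
- by move=> u v _ _; rewrite /ip2 (ipC hip) [ip u.2 _](ipC hip).
- by move=> u _; rewrite addr_ge0// (ip_ge0 hip).
Qed.

Lemma form_norm_ip2_fst x : N x.1 <= N2 x.
Proof. by rewrite /N /N2 /form_norm ler_wsqrtr// lerDl (ip_ge0 hip). Qed.

Lemma form_norm_ip2_snd x : N x.2 <= N2 x.
Proof. by rewrite /N /N2 /form_norm ler_wsqrtr// lerDr (ip_ge0 hip). Qed.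

Lemma form_norm_ip2_le x : N2 x <= N x.1 + N x.2.
Proof.
rewrite /N2 (form_normP positive_form_ip2)// ?addr_ge0 ?form_norm_ge0//.
rewrite sqrrD /N !(ip_norm_sqr hip) /ip2 -addrA lerD2l lerDr.
by rewrite mulrn_wge0// mulr_ge0// form_norm_ge0.
Qed.

Lemma form_complete_ip2 : form_complete setT ip2.
Proof.
move=> u_ _ cu.
have [//||x _ hx] := hilbert_complete hip (u_ := fun n => (u_ n).1).
  move=> e /cu[M hM]; exists M => i j Mi Mj.
  exact: le_lt_trans (form_norm_ip2_fst (u_ i - u_ j)) (hM _ _ Mi Mj).
have [//||y _ hy] := hilbert_complete hip (u_ := fun n => (u_ n).2).
  move=> e /cu[M hM]; exists M => i j Mi Mj.
  exact: le_lt_trans (form_norm_ip2_snd (u_ i - u_ j)) (hM _ _ Mi Mj).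
exists (x, y) => // e e0; have e2 : 0 < e / 2 by rewrite divr_gt0.
have [M1 h1] := hx _ e2; have [M2 h2] := hy _ e2.
exists (maxn M1 M2) => n; rewrite geq_max => /andP[n1 n2].
apply: le_lt_trans (form_norm_ip2_le _) _; rewrite [e]splitr ltrD//.
  exact: h1.
exact: h2.
Qed.

Lemma hilbert_ip2 : hilbert ip2.
Proof.
split; [exact: positive_form_ip2| |exact: form_complete_ip2|].
- move=> [x y] /eqP; rewrite /ip2 paddr_eq0 ?(ip_ge0 hip)//= => /andP[/eqP x0 /eqP y0].
  by congr pair; apply: (hilbert_definite hip).
- move=> S hS.
  have [y|M1 h1] := hilbert_barrelled hip (S := [set x.1 | x in S]).
    have [M hM] := hS (y, 0); exists M => _ [x Sx <-].
    by have := hM _ Sx; rewrite /ip2/= (ip0r hip) addr0.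
  have [y|M2 h2] := hilbert_barrelled hip (S := [set x.2 | x in S]).
    have [M hM] := hS (0, y); exists M => _ [x Sx <-].
    by have := hM _ Sx; rewrite /ip2/= (ip0r hip) add0r.
  exists (M1 + M2) => x Sx; apply: le_trans (form_norm_ip2_le x) _.
  by rewrite lerD ?h1 ?h2//; exists x.
Qed.

(* [x |-> x - (a + ib) G x] on the complexification of [V] *)
Definition one_minus (a b : R) (G : V -> V) (x : V * V) : V * V :=
  (x.1 - (a *: G x.1 - b *: G x.2), x.2 - (a *: G x.2 + b *: G x.1)).

Definition conj2 (x : V * V) : V * V := (x.1, - x.2).

Section OneMinus.
Context (G : V -> V) (lG : linear G) (G_sym : forall x y, ip (G x) y = ip x (G y)).
Context (C : R) (GC : forall x, N (G x) <= C * N x).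
Context (W : set V) (sW : subspace W) (cW : ip_closed ip W) (GW : forall x, W (G x)).

Lemma linZ (L : V -> V) : linear L -> forall k x, L (k *: x) = k *: L x.
Proof. by move=> lL k x; rewrite -[k *: x]addr0 lL lin0// addr0. Qed.
Lemma linD (L : V -> V) : linear L -> forall x y, L (x + y) = L x + L y.
Proof. by move=> lL x y; rewrite -[x]scale1r lL !scale1r. Qed.

Lemma linN (L : V -> V) : linear L -> forall x, L (- x) = - L x.
Proof. by move=> lL x; rewrite -scaleN1r (linZ lL) scaleN1r. Qed.
Lemma linB2 k (p p' q q' : V) :
  (k *: p + p') - (k *: q + q') = k *: (p - q) + (p' - q').
Proof. by rewrite opprD addrACA scalerBr. Qed.
Lemma linD2 k (p p' q q' : V) :
  (k *: p + p') + (k *: q + q') = k *: (p + q) + (p' + q').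
Proof. by rewrite addrACA scalerDr. Qed.

Lemma one_minus_linear a b : linear (one_minus a b G).
Proof.
have E c k x y : c *: G (k *: x + y) = k *: (c *: G x) + c *: G y.
  by rewrite lG scalerDr !scalerA mulrC.
move=> k [x1 x2] [y1 y2]; rewrite /one_minus/= !E; congr pair => /=.
  by rewrite !linB2.
by rewrite linD2 linB2.
Qed.

Lemma conj2_linear : linear conj2.
Proof.
by move=> k [x1 x2] [y1 y2]; rewrite /conj2/=; congr pair => /=; rewrite scalerN opprD.
Qed.

Lemma one_minus_bounded a b x :
  N2 (one_minus a b G x) <= (2 + 2 * (`|a| + `|b|) * `|C|) * N2 x.
Proof.
have GC' u : N (G u) <= `|C| * N u.
  by apply: le_trans (GC _) _; rewrite ler_wpM2r ?(ip_norm_ge0 ip)// ler_norm.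
have cb k u : N u <= N2 x -> N (k *: G u) <= `|k| * `|C| * N2 x.
  move=> ux; rewrite /N (ip_normZ hip) -mulrA ler_wpM2l//.
  by apply: le_trans (GC' _) _; rewrite ler_wpM2l.
have x1 := form_norm_ip2_fst x; have x2 := form_norm_ip2_snd x.
apply: le_trans (form_norm_ip2_le _) _; rewrite /one_minus/=.
have h1 := ip_normB hip x.1 (a *: G x.1 - b *: G x.2).
have h2 := ip_normB hip x.2 (a *: G x.2 + b *: G x.1).
have h3 := ip_normB hip (a *: G x.1) (b *: G x.2).
have h4 := ip_normD hip (a *: G x.2) (b *: G x.1).
have := cb a _ x1; have := cb a _ x2; have := cb b _ x1; have := cb b _ x2.
rewrite /N /N2 in h1 h2 h3 h4 x1 x2 *; lra.
Qed.

Lemma one_minus_adjoint a b x y :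
  ip2 (one_minus a b G x) y = ip2 x (one_minus a (- b) G y).
Proof.
rewrite /ip2 /one_minus/= !scaleNr opprK.
rewrite !(ipDl hip, ipDr hip, ipNl hip, ipNr hip, ipZl hip, ipZr hip) !G_sym; ring.
Qed.

Lemma one_minus_normal a b x :
  one_minus a b G (one_minus a (- b) G x) = one_minus a (- b) G (one_minus a b G x).
Proof.
case: x => x1 x2; rewrite /one_minus/=; congr pair => /=; apply: (ip_ext hip) => z;
  rewrite !(ipDl hip, ipNl hip, ipZl hip, G_sym); ring.
Qed.

Lemma conj2K x : conj2 (conj2 x) = x.
Proof. by case: x => x y; rewrite /conj2/= opprK. Qed.

Lemma conj2_sym x y : ip2 (conj2 x) y = ip2 x (conj2 y).
Proof. by rewrite /ip2 /conj2/= (ipNl hip) (ipNr hip). Qed.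

Lemma conj2_one_minus a b x :
  conj2 (one_minus a b G x) = one_minus a (- b) G (conj2 x).
Proof.
case: x => x1 x2; rewrite /one_minus /conj2/=; congr pair => /=; apply: (ip_ext hip) => z;
  rewrite !(ipDl hip, ipNl hip, ipZl hip, G_sym); ring.
Qed.

Lemma subspace_cset : subspace (cset W : set (V * V)%type).
Proof.
split; first by split; exact: subspace0.
by move=> a u v [u1 u2] [v1 v2]; split; apply: sW.2.
Qed.

Lemma closed_cset : ip_closed ip2 (cset W).
Proof.
move=> x xW; split; apply: cW => e /xW[s [s1 s2] xs].
  by exists s.1 => //; apply: le_lt_trans (form_norm_ip2_fst (x - s)) xs.
by exists s.2 => //; apply: le_lt_trans (form_norm_ip2_snd (x - s)) xs.
Qed.

Lemma one_minus_cset a b x : cset W x -> cset W (one_minus a b G x).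
Proof.
move=> [x1 x2]; split; apply: subspaceB => //.
  by apply: subspaceB => //; exact: subspaceZ.
by apply: subspaceD => //; exact: subspaceZ.
Qed.

Lemma conj2_cset x : cset W x -> cset W (conj2 x).
Proof. by move=> [x1 x2]; split => //; exact: subspaceN. Qed.

(* The complex span of the [b i] is the real span of the [b i] and [i b i]. *)
Lemma complex_span_proj (n : nat) (b : 'I_n -> complexification V) :
  exists e, ip_orthonormal ip2 e /\
    forall c : 'I_n -> R[i], ip_proj ip2 e (\sum_i c i *: b i) = \sum_i c i *: b i.
Proof.
pose ib i : V * V := (- (b i).2, (b i).1).
have [//|//|e [oe _ el]] := gram_schmidt hilbert_ip2 (S := setT)
  (l := [seq (b i : V * V) | i <- enum 'I_n] ++ [seq ib i | i <- enum 'I_n]).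
exists e; split => // c.
have pl := ip_proj_linear hilbert_ip2 e.
pose K (x : complexification V) := ip_proj ip2 e x = x.
apply: (@big_ind _ K).
- by rewrite /K lin0.
- rewrite /K => x y xE yE; have := pl 1 x y; by rewrite xE yE !scale1r.
- rewrite /K => i _; have cE : c i *: b i = complex.Re (c i) *: (b i : V * V) + complex.Im (c i) *: ib i.
    rewrite [LHS]/(complex_scale _ _) /complex_scale; congr pair => //=.
    by rewrite scalerN.
  have b1 : ip_proj ip2 e (b i) = b i.
    by apply: el; rewrite mem_cat map_f// mem_enum.
  have b2 : ip_proj ip2 e (ib i) = ib i.
    by apply: el; rewrite mem_cat orbC (map_f ib)// mem_enum.
  have := pl (complex.Re (c i)) (b i) (complex.Im (c i) *: ib i).
  have := pl (complex.Im (c i)) (ib i) 0.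
  by rewrite b1 b2 (lin0 pl) !addr0 cE => -> ->.
Qed.

Lemma ip_proj_complex_span (e : seq (V * V)) :
  exists n (b : 'I_n -> complexification V), (forall i, b i \in e) /\
    forall x, exists c : 'I_n -> R[i], ip_proj ip2 e x = \sum_i c i *: b i.
Proof.
exists (size e), (fun i => nth 0 e i); split; first by move=> i; exact: mem_nth.
move=> x; exists (fun i => (ip2 x (nth 0 e i))%:C%C).
rewrite /ip_proj (big_nth 0) big_mkord.
apply: (@eq_bigr (V * V)%type _ _ _ _ _ _ _) => i _.
by rewrite [RHS]/(complex_scale _ _) /complex_scale/= !scale0r subr0 addr0.
Qed.

Section Fredholm.
Hypothesis norm_ip : forall x : V, `|x| = form_norm ip x.

Lemma closed_ip2 (S : set (V * V)) : closed S <-> ip_closed ip2 S.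
Proof.
split => cS x xS.
  apply: cS => B /nbhs_ballP[e /= e0 eB]; have [s Ss xs] := xS _ e0.
  exists s; split => //; apply: eB; split; rewrite -ball_normE /ball_/= norm_ip.
    exact: le_lt_trans (form_norm_ip2_fst (x - s)) xs.
  exact: le_lt_trans (form_norm_ip2_snd (x - s)) xs.
apply: cS => e e0; have e2 : 0 < e / 2 by rewrite divr_gt0.
have [s [Ss [s1 s2]]] := xS _ (nbhsx_ballx x (e / 2) e2).
exists s => //; apply: le_lt_trans (form_norm_ip2_le _) _.
by rewrite [e]splitr /N -!norm_ip ltrD//; [move: s1|move: s2]; rewrite -ball_normE.
Qed.

Context (S : set (V * V)) (hS : forall u h, S (u, h) <-> W h /\ u = G (h + u)).
Variable z : R[i].
Let a := complex.Re z + 1.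
Let b := complex.Im z.
Let A := one_minus a b G.

(** By [hS], [G] is (S + 1)^-1. Writing u = G x with x = (S + 1) u gives (S - z) u = x - (z + 1) G
    x, whence the 1 in [a]. *)
Lemma shifted_operatorP (u f : complexification V) :
  shifted_operator S z (u, f) <->
  exists x : V * V, [/\ cset W x, u = (G x.1, G x.2) & f = A x].
Proof.
have E (x1 x2 u1 u2 : V) : u1 = G x1 -> u2 = G x2 ->
    A (x1, x2) = ((x1 - u1, x2 - u2) : complexification V) - z *: ((u1, u2) : complexification V).
  move=> -> ->.
  have -> : z *: ((G x1, G x2) : complexification V) = complex_scale z (G x1, G x2) by [].
  rewrite /A /one_minus /complex_scale/=.
  congr pair => /=; apply: (ip_ext hip) => t;
  rewrite !(ipDl hip, ipNl hip, ipZl hip) /a /b; ring.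
case: u f => u1 u2 f; split.
  move=> [[h1 h2] /= [/hS[Wh1 uh1] /hS[Wh2 uh2] fE]].
  exists (h1 + u1, h2 + u2) => /=; split.
  - split => /=; apply: subspaceD => //; first by rewrite uh1.
    by rewrite uh2.
  - by rewrite -uh1 -uh2.
  - by rewrite (E _ _ u1 u2)// !addrK.
move=> [[x1 x2] [[/= Wx1 Wx2] [u1E u2E] ->]].
exists (x1 - u1, x2 - u2); split => /=.
- by apply/hS; rewrite subrK; split => //; apply: subspaceB => //; rewrite u1E.
- by apply/hS; rewrite subrK; split => //; apply: subspaceB => //; rewrite u2E.
- exact: E.
Qed.

Lemma shifted_operator_ran :
  [set f | exists u, shifted_operator S z (u, f)] = ran_on (cset W) A.
Proof.
apply/seteqP; split => f /=.
  by move=> [u /shifted_operatorP[x [Wx _ ->]]]; exists x.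
by move=> [x Wx <-]; exists (G x.1, G x.2); apply/shifted_operatorP; exists x.
Qed.

(** S - z and 1 - (z + 1) G have the same range, and their kernels correspond under [G]. Real
    spanning families are exchanged for complex ones, which changes dimensions only by a bounded
    factor. *)
Lemma fredholm_shiftedP :
  fredholm (cset W) (shifted_operator S z) <-> proper_on ip2 (cset W) A.
Proof.
pose hip2 := hilbert_ip2.
split => [[[n [bs kbs]] cl _]|pA].
  have [e [oe ebs]] := complex_span_proj bs.
  apply: (fredholm_proper hip2 subspace_cset closed_cset (one_minus_linear a b)
    conj2_linear (one_minus_bounded a b) (one_minus_adjoint a b)
    (one_minus_normal a b) (@one_minus_cset a b) (@one_minus_cset a (- b))
    conj2K conj2_sym (conj2_one_minus a b) conj2_cset oe); last first.
    by apply/closed_ip2; rewrite -shifted_operator_ran.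
  move=> x [Wx Ax].
  have [c uE] : exists c : 'I_n -> R[i],
      ((G x.1, G x.2) : complexification V) = \sum_i c i *: bs i.
    by apply: kbs; apply/shifted_operatorP; exists x.
  (* [A x = 0] says that [x] is z + 1 times [G x], an element of the kernel of S - z, and so lies in
     the complex span of [bs]. The case z = -1, where [x] is 0, is included. *)
  have xE : x = (a +i* b)%C *: ((G x.1, G x.2) : complexification V).
    rewrite [RHS]/(complex_scale _ _) /complex_scale/=.
    move: Ax; rewrite /A /one_minus; case: x {Wx uE} => x1 x2 /= [].
    by move=> /eqP + /eqP; rewrite !subr_eq0 => /eqP x1E /eqP x2E; congr pair.
  rewrite xE uE scaler_sumr; under eq_bigr do rewrite scalerA; exact: ebs.
have [e [oe eK Ke ran]] := proper_fredholm hip2 subspace_cset closed_cset (one_minus_linear a b)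
    (one_minus_bounded a b) (one_minus_adjoint a b)
    (one_minus_normal a b) (@one_minus_cset a b) (@one_minus_cset a (- b)) pA.
have [n [bs [be bsE]]] := ip_proj_complex_span e.
split.
- exists n, bs => u /shifted_operatorP[x [Wx uE Ax]].
  (* [u] is [G x] with [A x = 0], and [G] commutes with [A]. *)
  have Ku : ker_on (cset W) A u.
    split; first by rewrite uE; split; exact: GW.
    have {}Ax : A x = ((0, 0) : V * V) by rewrite -Ax.
    move: Ax; rewrite uE /A /one_minus/=.
    case: x {Wx uE} => x1 x2 /= -[] /eqP; rewrite subr_eq0 => /eqP x1E.
    move=> /eqP; rewrite subr_eq0 => /eqP x2E; congr pair => /=.
      by rewrite {1}x1E; apply: (ip_ext hip) => t;
       rewrite !(ipDl hip, ipNl hip, ipZl hip, G_sym, ip0l hip); ring.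
    by rewrite {1}x2E; apply: (ip_ext hip) => t;
       rewrite !(ipDl hip, ipNl hip, ipZl hip, G_sym, ip0l hip); ring.
  by have [c cE] := bsE u; exists c; rewrite -cE Ke.
- rewrite shifted_operator_ran; apply/closed_ip2 => x xR.
  have Wx : cset W x.
    apply: closed_cset => d /xR[_ [y Wy <-] xy]; exists (A y) => //.
    exact: one_minus_cset.
  have [y Wy xE] := ran _ Wx; exists y => //; rewrite [RHS]xE.
  rewrite (ip_proj_eq0 hip2) ?addr0// => t /eK Kt.
  rewrite (ipC hip2); apply: (ip_orthogonal_closure hip2 _ xR) => _ [v _ <-].
  exact: (ran_ker_orthogonal hip2 (one_minus_adjoint a b) (one_minus_normal a b) v Kt).
- exists n, bs; split; first by move=> i; case: (eK _ (be i)).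
  move=> x Wx; have [y Wy xE] := ran _ Wx; have [c cE] := bsE x; exists c.
  have hu : ran_on (cset W) A (x - ip_proj ip2 e x).
    by exists y => //; rewrite {1}xE addrK.
  by rewrite -shifted_operator_ran in hu; rewrite -cE.
Qed.

End Fredholm.
End OneMinus.

Lemma ultra_cauchy_ip2 I (U : set_system I) (f : I -> V * V) : Filter U ->
  ultra_cauchy ip2 U f <->
  ultra_cauchy ip U (fun i => (f i).1) /\ ultra_cauchy ip U (fun i => (f i).2).
Proof.
move=> FU; split => [hf|[h1 h2]].
  split => e /hf[S US fS]; exists S => // x y Sx Sy; have := fS _ _ Sx Sy.
    exact: le_lt_trans (form_norm_ip2_fst (f x - f y)).
  exact: le_lt_trans (form_norm_ip2_snd (f x - f y)).
move=> e e0; have e2 : 0 < e / 2 by rewrite divr_gt0.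
have [S1 US1 fS1] := h1 _ e2; have [S2 US2 fS2] := h2 _ e2.
exists (S1 `&` S2); first exact: filterI.
move=> x y [? ?] [? ?]; apply: le_lt_trans (form_norm_ip2_le _) _.
by rewrite [e]splitr ltrD//; [exact: fS1|exact: fS2].
Qed.

Lemma ultra_cauchyZ I (U : set_system I) (f : I -> V) k :
  ultra_cauchy ip U f -> ultra_cauchy ip U (fun i => k *: f i).
Proof.
move=> hf.
have lk : linear (fun x : V => k *: x).
  by move=> c x y; rewrite scalerDr !scalerA mulrC.
have bk x : form_norm ip (k *: x) <= `|k| * form_norm ip x by rewrite (ip_normZ hip).
exact: (ultra_cauchy_lin lk bk hf).
Qed.

Lemma ultra_cauchyN I (U : set_system I) (f : I -> V) :
  ultra_cauchy ip U f -> ultra_cauchy ip U (fun i => - f i).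
Proof.
by move=> /(ultra_cauchyZ (-1)); under eq_fun do rewrite scaleN1r.
Qed.

(** Equivalent to total boundedness of the images of balls, since a set is totally bounded exactly
    when every ultrafilter on it is Cauchy. *)
Definition compact_along_ultra (D : V -> V) : Prop :=
  forall (I : Type) (U : set_system I) (f : I -> V), UltraFilter U ->
    (exists M, U [set i | N (f i) <= M]) -> ultra_cauchy ip U (D \o f).

Definition zmul2 (a b : R) (G : V -> V) (x : V * V) : V * V :=
  (a *: G x.1 - b *: G x.2, a *: G x.2 + b *: G x.1).

Lemma one_minusE a b G x : one_minus a b G x = x - zmul2 a b G x.
Proof. by []. Qed.

Lemma ultra_cauchy_zmul2 a b G I (U : set_system I) (f : I -> V * V) : Filter U ->
  ultra_cauchy ip U (fun i => G (f i).1) -> ultra_cauchy ip U (fun i => G (f i).2) ->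
  ultra_cauchy ip2 U (fun i => zmul2 a b G (f i)).
Proof.
move=> FU h1 h2; apply/ultra_cauchy_ip2; split => /=.
  apply: (ultra_cauchyD hip); first exact: ultra_cauchyZ.
  by apply: ultra_cauchyN; exact: ultra_cauchyZ.
by apply: (ultra_cauchyD hip); exact: ultra_cauchyZ.
Qed.

(** The compact term can be added to or removed from a Cauchy image. What remains is that properness
    on [W] implies properness on the whole space: if g = f - c G2 f is Cauchy, with c = a + ib, then
    h = c G2 f takes values in [W] and its image h - c G2 h = c G2 g is Cauchy, so h and f = g + h
    are Cauchy. *)
Lemma proper_on_perturbation (W : set V) (G1 G2 D : V -> V) a b :
  linear G2 -> (exists C, forall x, N (G2 x) <= C * N x) ->
  (forall x, W (G2 x)) -> subspace W ->
  (forall x, G1 x = G2 x + D x) -> compact_along_ultra D ->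
  proper_on ip2 setT (one_minus a b G1) <-> proper_on ip2 (cset W) (one_minus a b G2).
Proof.
move=> lG2 [C G2C] WG2 sW GD cD.
have hip2 := hilbert_ip2.
have bnd I (U : set_system I) (f : I -> V * V) : Filter U ->
    (exists M, U [set i | N2 (f i) <= M]) ->
    (exists M, U [set i | N (f i).1 <= M]) /\ (exists M, U [set i | N (f i).2 <= M]).
  move=> FU [M fM]; split; exists M; apply: filterS fM => i /=.
    exact: le_trans (form_norm_ip2_fst _).
  exact: le_trans (form_norm_ip2_snd _).
have ext I (U : set_system I) (f g : I -> V * V) : f =1 g ->
    ultra_cauchy ip2 U f -> ultra_cauchy ip2 U g by move=> /funext->.
have Dc I (U : set_system I) (f : I -> V * V) : UltraFilter U ->
    (exists M, U [set i | N2 (f i) <= M]) ->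
    ultra_cauchy ip2 U (fun i => zmul2 a b D (f i)).
  by move=> UU /bnd[b1 b2]; apply: ultra_cauchy_zmul2; apply: cD.
have zD x : zmul2 a b G1 x = zmul2 a b G2 x + zmul2 a b D x.
  rewrite /zmul2/= !GD; congr pair => /=; apply: (ip_ext hip) => t;
  rewrite !(ipDl hip, ipNl hip, ipZl hip); ring.
split => pA I U f UU Wf fM Af; have FU : Filter U by typeclasses eauto.
  apply: pA => //.
  have hP : ultra_cauchy ip2 U (fun i => - zmul2 a b D (f i)).
    apply: (ext _ _ (fun i => zmul2 (- a) (- b) D (f i))).
      move=> i; rewrite /zmul2; congr pair => /=; apply: (ip_ext hip) => t;
      rewrite !(ipDl hip, ipNl hip, ipZl hip); ring.
    have [b1 b2] := bnd _ _ _ _ fM.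
    by apply: ultra_cauchy_zmul2; apply: cD.
  have := ultra_cauchyD hip2 FU Af hP; apply: ext => i /=.
  by rewrite !one_minusE zD opprD addrA.
pose g i := one_minus a b G2 (f i).
have gc : ultra_cauchy ip2 U g.
  have := ultra_cauchyD hip2 FU Af (Dc _ _ _ UU fM); apply: ext => i /=.
  by rewrite /g !one_minusE zD opprD addrA subrK.
pose h i := zmul2 a b G2 (f i).
have [g1 g2] := (ultra_cauchy_ip2 _ _).1 gc.
have hc : ultra_cauchy ip2 U h.
  apply: pA => //.
  - move=> i; split; rewrite /h/=.
      by apply: subspaceB => //; exact: subspaceZ.
    by apply: subspaceD => //; exact: subspaceZ.
  - have [M fM'] := fM; exists ((2 * (`|a| + `|b|)) * `|C| * M).
    apply: filterS fM' => i /= fiM; apply: le_trans (form_norm_ip2_le _) _.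
    have GC' u : N u <= M -> N (G2 u) <= `|C| * M.
      move=> uM; apply: le_trans (G2C _) _.
      apply: le_trans (_ : `|C| * N u <= _); first by rewrite ler_wpM2r ?form_norm_ge0// ler_norm.
      by rewrite ler_wpM2l.
    have cb k u : N u <= M -> N (k *: G2 u) <= `|k| * (`|C| * M).
      by move=> uM; rewrite /N (ip_normZ hip) ler_wpM2l// GC'.
    have x1 := le_trans (form_norm_ip2_fst (f i)) fiM.
    have x2 := le_trans (form_norm_ip2_snd (f i)) fiM.
    have h3 := ip_normB hip (a *: G2 (f i).1) (b *: G2 (f i).2).
    have h4 := ip_normD hip (a *: G2 (f i).2) (b *: G2 (f i).1).
    have := cb a _ x1; have := cb a _ x2; have := cb b _ x1; have := cb b _ x2.
    rewrite /h /zmul2/= /N in h3 h4 *; lra.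
  - apply: (ext _ _ (fun i => zmul2 a b G2 (g i))).
      move=> i; rewrite /g /h /= /one_minus /zmul2.
      congr pair => /=; rewrite !(linD lG2, linN lG2, linZ lG2);
      apply: (ip_ext hip) => t; rewrite !(ipDl hip, ipNl hip, ipZl hip); ring.
    apply: ultra_cauchy_zmul2.
      exact: (ultra_cauchy_lin lG2 G2C g1).
    exact: (ultra_cauchy_lin lG2 G2C g2).
have := ultra_cauchyD hip2 FU gc hc; apply: ext => i /=.
by rewrite /g /h one_minusE subrK.
Qed.

End SquareHilbert.

(** * The Hilbert space L^2 *)

Section L2Theory.
Context d (T : measurableType d) (R : realType).
Variable mu : {measure set T -> \bar R}.

Section AnyLp.
Variables (p : \bar R) (p1 : (1 <= p)%E).

Lemma ae_setT (f g : T -> R) : f = g %[ae mu] <-> {ae mu, forall x, f x = g x}.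
Proof. by split; apply: filterS => x; [apply|move=> + _]. Qed.

Lemma Lp_ext (u v : Lp mu p1) : {ae mu, forall x, u x = v x} -> u = v.
Proof. by move=> uv; rewrite -(Lp_reprK u) -(Lp_reprK v); apply/Lp_piP/ae_setT. Qed.

Lemma Lp_add_ae (u v : Lp mu p1) : {ae mu, forall x, Lp_fun (u + v) x = u x + v x}.
Proof. by rewrite -[u + v]/(Lp_pi _); apply/ae_setT; exact: Lp_repr_pi. Qed.

Lemma Lp_opp_ae (u : Lp mu p1) : {ae mu, forall x, Lp_fun (- u) x = - u x}.
Proof. by rewrite -[- u]/(Lp_pi _); apply/ae_setT; exact: Lp_repr_pi. Qed.

Lemma Lp_scale_ae a (u : Lp mu p1) : {ae mu, forall x, Lp_fun (a *: u) x = a * u x}.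
Proof. by rewrite -[a *: u]/(Lp_pi _); apply/ae_setT; exact: Lp_repr_pi. Qed.

Lemma Lp_zero_ae : {ae mu, forall x, Lp_fun (0 : Lp mu p1) x = 0}.
Proof. by rewrite -[0 : Lp mu p1]/(Lp_pi _); apply/ae_setT; exact: Lp_repr_pi. Qed.

Lemma Lp_sub_ae (u v : Lp mu p1) : {ae mu, forall x, Lp_fun (u - v) x = u x - v x}.
Proof. by apply: filterS2 (Lp_add_ae u (- v)) (Lp_opp_ae v) => x -> ->. Qed.

Lemma Lp_measurable (u : Lp mu p1) : measurable_fun setT (u : T -> R).
Proof. by have := LfunP (Lp_repr u); rewrite inE => /andP[/[!inE]]. Qed.

Lemma Lp_class_ae (f : T -> R) : f \in Lfun mu p ->
  {ae mu, forall x, Lp_fun (Lp_class mu p1 f) x = f x}.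
Proof. by move=> fL; apply/ae_setT; exact: Lp_classE. Qed.

End AnyLp.
Hint Resolve Lp_measurable : core.

Lemma Rintegral_ae (f g : T -> R) : measurable_fun setT f -> measurable_fun setT g ->
  {ae mu, forall x, f x = g x} -> (\int[mu]_x f x)%R = (\int[mu]_x g x)%R.
Proof.
move=> mf mg fg; congr fine; apply: ae_eq_integral => //; try exact/measurable_EFinP.
by apply: filterS fg => x /= -> .
Qed.

Lemma Rintegral_ae_le (f g : T -> R) :
  mu.-integrable setT (EFin \o f) -> mu.-integrable setT (EFin \o g) ->
  {ae mu, forall x, f x <= g x} -> (\int[mu]_x f x)%R <= (\int[mu]_x g x)%R.
Proof.
move=> intf intg fg; rewrite -subr_ge0 -RintegralB//.
have mf : measurable_fun setT f by apply/measurable_EFinP; case/integrableP: intf.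
have mg : measurable_fun setT g by apply/measurable_EFinP; case/integrableP: intg.
rewrite (@Rintegral_ae _ (fun x => Num.max (g x - f x) 0)).
- by apply: Rintegral_ge0 => x _; rewrite le_max lexx orbT.
- exact: measurable_funB.
- by apply: measurable_funTS; apply: measurable_maxr => //; exact: measurable_funB.
- by apply: filterS fg => x fgx; rewrite max_l// subr_ge0.
Qed.

Local Notation L2 := (L2 mu).

Lemma Lfun2P (f : T -> R) : measurable_fun setT f ->
  mu.-integrable setT (EFin \o (fun x => f x ^+ 2)) -> f \in Lfun mu 2%:E.
Proof.
move=> mf intf; rewrite inE; apply/andP; split; rewrite inE//=.
rewrite /finite_norm unlock; apply: poweR_lty.
have /integrableP[_] := intf; apply: le_lt_trans; apply: ge0_le_integral => //=.
- apply/measurable_EFinP; apply: (measurableT_comp (measurable_powR 2)).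
  exact: measurableT_comp.
- by apply/measurable_EFinP; apply: measurableT_comp => //; exact: measurable_funX.
- by move=> x _; rewrite /= lee_fin normrX powR_mulrn.
Qed.

Lemma L2_Lfun (u : L2) : (u : T -> R) \in Lfun mu 2%:E.
Proof. exact: LfunP. Qed.

Lemma L2_int (u v : L2) : mu.-integrable setT (EFin \o (fun x => u x * v x)).
Proof. by apply/Lfun1_integrable/Lfun2_mul_Lfun1; exact: L2_Lfun. Qed.

Lemma Lfun2_le (f : T -> R) (u : L2) : measurable_fun setT f ->
  {ae mu, forall x, `|f x| <= `|u x|} -> f \in Lfun mu 2%:E.
Proof.
move=> mf fu; apply: Lfun2P => //; apply/integrableP; split.
  by apply/measurable_EFinP; exact: measurable_funX.
have /integrableP[_] := Lfun2_integrable_sqr (L2_Lfun u); apply: le_lt_trans.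
apply: ae_ge0_le_integral => //.
- apply/measurableT_comp => //; apply/measurable_EFinP; exact: measurable_funX.
- apply/measurableT_comp => //; apply/measurable_EFinP; apply: measurable_funX.
  exact: Lp_measurable.
- apply: filterS fu => x fux _; rewrite /= lee_fin !normrX.
  by rewrite ler_pXn2r ?nnegrE.
Qed.

Lemma inner_mul_ae (u v : L2) (f : T -> R) : measurable_fun setT f ->
  {ae mu, forall x, u x * v x = f x} -> inner u v = (\int[mu]_x f x)%R.
Proof.
move=> mf uvf; apply: Rintegral_ae => //.
by apply: measurable_funM; exact: Lp_measurable.
Qed.

Lemma positive_form_inner : positive_form setT (@inner _ _ R mu).
Proof.
split => //.
- move=> a u v w _ _ _; have iu := L2_int u w; have iv := L2_int v w.
  have iau : mu.-integrable setT (EFin \o (fun x => a * (Lp_fun u x * Lp_fun w x))).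
    have := integrableZl measurableT a iu.
    by apply: eq_integrable => // x _ /=; rewrite EFinM.
  rewrite /inner -RintegralZl// -RintegralD//.
  apply: inner_mul_ae.
    apply: measurable_funD.
      apply: measurable_funM => //; apply: measurable_funM; exact: Lp_measurable.
    by apply: measurable_funM; exact: Lp_measurable.
  apply: filterS2 (Lp_add_ae (a *: u) v) (Lp_scale_ae a u) => x -> ->; ring.
- by move=> u v _ _; apply: eq_Rintegral => x _; rewrite mulrC.
- by move=> u _; apply: Rintegral_ge0 => x _; rewrite -expr2 sqr_ge0.
Qed.

Lemma inner_le (u v u' v' : L2) : {ae mu, forall x, u x * v x <= u' x * v' x} ->
  inner u v <= inner u' v'.
Proof. by move=> h; apply: Rintegral_ae_le => //; exact: L2_int. Qed.

Lemma inner_ge0 (u v : L2) : {ae mu, forall x, 0 <= u x} ->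
  {ae mu, forall x, 0 <= v x} -> 0 <= inner u v.
Proof.
move=> u0 v0; rewrite -(pf0l positive_form_inner (w := v) I); apply: inner_le.
apply: filterS3 (Lp_zero_ae (le1_two R)) u0 v0 => x -> ux vx.
by rewrite mul0r mulr_ge0.
Qed.

Lemma inner_norm (u : L2) : inner u u = `|u| ^+ 2.
Proof.
have uE : (\int[mu]_x (u x * u x)%:E = \int[mu]_x `|(u x)%:E| `^ 2)%E.
  apply: eq_integral => x _ /=; rewrite -expr2 -[u x ^+ 2]real_normK ?num_real//.
  by rewrite -powR_mulrn.
rewrite -[ `|u|]/(Lp_norm u) /Lp_norm unlock /inner /Rintegral uE.
set I := (\int[mu]_x _)%E.
have I0 : (0 <= I)%E by apply: integral_ge0 => x _; exact: poweR_ge0.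
have Ify : I \is a fin_num.
  by rewrite /I -uE; apply: integrable_fin_num => //; exact: L2_int.
rewrite -(fineK Ify) poweR_EFin/= -[RHS]powR_mulrn ?powR_ge0// -powRrM mulVf// powRr1//.
exact: fine_ge0.
Qed.

Lemma normE_inner (u : L2) : `|u| = form_norm (@inner _ _ R mu) u.
Proof. by rewrite /form_norm inner_norm sqrtr_sqr normr_id. Qed.

Lemma le_norm_L2 (u v : L2) : {ae mu, forall x, `|u x| <= `|v x|} -> `|u| <= `|v|.
Proof.
move=> uv; rewrite -(@ler_pXn2r _ 2)// ?nnegrE// -!inner_norm; apply: inner_le.
apply: filterS uv => x uvx; rewrite -!expr2 -[u x ^+ 2]real_normK ?num_real//.
by rewrite -[v x ^+ 2]real_normK ?num_real// ler_pXn2r ?nnegrE.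
Qed.

End L2Theory.

(** The tail of the series c 2^-j from [k] on is 2 c 2^-k, so adding it to [a k] gives a decreasing
    sequence and subtracting it an increasing one; the limit lies between them. *)
Lemma geometric_cauchy (R : realType) (a : nat -> R) (c : R) :
  (forall k, `|a k.+1 - a k| <= c * 2^-1 ^+ k) ->
  exists l, a @ \oo --> l /\ forall k, `|a k - l| <= 2 * c * 2^-1 ^+ k.
Proof.
move=> ac.
have h0 k : 0 <= 2^-1 ^+ k :> R by rewrite exprn_ge0.
have hE k : 2^-1 ^+ k.+1 = 2^-1 ^+ k / 2 :> R by rewrite exprSr.
pose b k := a k + 2 * c * 2^-1 ^+ k; pose b' k := a k - 2 * c * 2^-1 ^+ k.
have c0 : 0 <= c by have := ac 0%N; rewrite expr0 mulr1; exact: le_trans.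
have bS k : b k.+1 <= b k.
  rewrite /b hE; have := ac k; rewrite ler_norml => /andP[_ h]; move: h.
  set x := 2^-1 ^+ k; lra.
have b'S k : b' k <= b' k.+1.
  rewrite /b' hE; have := ac k; rewrite ler_norml => /andP[h _]; move: h.
  set x := 2^-1 ^+ k; lra.
have bm i j : (i <= j)%N -> b j <= b i.
  by elim: j => [|j IH]; [rewrite leqn0 => /eqP->|rewrite leq_eqVlt => /orP[/eqP->//|/IH]; exact: le_trans].
have b'm i j : (i <= j)%N -> b' i <= b' j.
  elim: j => [|j IH]; [by rewrite leqn0 => /eqP->|rewrite leq_eqVlt => /orP[/eqP->//|/IH h]].
  exact: le_trans h (b'S j).
have b'b k : b' k <= b k by rewrite /b /b' lerD2l ge0_cp// !mulr_ge0.
have bb i j : b' i <= b j.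
  apply: le_trans (b'm _ _ (leq_maxl i j)) _.
  exact: le_trans (b'b _) (bm _ _ (leq_maxr i j)).
pose l := inf (range b).
have hi : has_inf (range b).
  by split; [exists (b 0%N), 0%N|exists (b' 0%N) => _ [j _ <-]].
have lb k : l <= b k by apply: ge_inf; [case: hi|exists k].
have lb' k : b' k <= l.
  by apply: lb_le_inf; [case: hi|move=> _ [j _ <-]].
have al k : `|a k - l| <= 2 * c * 2^-1 ^+ k.
  have := lb k; have := lb' k; rewrite /b /b' ler_norml => h1 h2.
  by apply/andP; split; lra.
exists l; split => //; apply/cvgrPdist_le => e e0.
have c1 : 0 < 2 * c + 1 by rewrite ltr_wpDl// mulr_ge0.
have : (fun k => 2^-1 ^+ k : R) @ \oo --> (0 : R).
  by apply: cvg_expr; rewrite ger0_norm// invf_lt1// ltr1n.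
move=> /cvgrPdist_le/(_ (e / (2 * c + 1))); rewrite divr_gt0// => /(_ isT).
apply: filterS => k; rewrite sub0r normrN ger0_norm// ler_pdivlMr// => hk.
rewrite distrC; apply: le_trans (al k) (le_trans _ hk).
by rewrite mulrC ler_wpM2l// lerDl.
Qed.

(** * Completeness of L^2 and the uniform boundedness principle in it *)

Section RieszFischer.
Context d (T : measurableType d) (R : realType).
Variable mu : {measure set T -> \bar R}.
Local Notation L2 := (L2 mu).

(** The factor 2^k in [w] makes the sum [S] of the squares [w k ^+ 2] integrable and bounds the
    [k]-th increment by sqrt(S) 2^-k almost everywhere: pointwise geometric convergence with a
    square-integrable majorant. *)
Lemma L2_cauchy_cvg (u_ : nat -> L2) :
  (forall k, `|u_ k.+1 - u_ k| <= 2^-1 ^+ k ^+ 2 / 2) ->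
  exists u : L2, exists C : R, forall k, `|u_ k - u| <= C * 2^-1 ^+ k.
Proof.
move=> hu.
pose w k (x : T) : R := 2 ^+ k * (u_ k.+1 x - u_ k x).
have mw k : measurable_fun setT (w k).
  by apply: measurable_funM => //; apply: measurable_funB; exact: Lp_measurable.
have w0 k x : (0 <= (w k x ^+ 2)%:E)%E by rewrite lee_fin sqr_ge0.
have mw2 k : measurable_fun setT (fun x => (w k x ^+ 2)%:E).
  by apply/measurable_EFinP; exact: measurable_funX.
pose S x := (\sum_(0 <= k <oo) (w k x ^+ 2)%:E)%E.
have S0 x : (0 <= S x)%E by apply: nneseries_ge0.
have mS : measurable_fun setT S.
  rewrite /S; under eq_fun do rewrite (eq_eseriesl (Q := xpredT)) //.
  exact: ge0_emeasurable_sum.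
have hE k : 2^-1 ^+ k = (2 ^+ k)^-1 :> R by rewrite exprVn.
(* By hypothesis [w k] has norm at most 2^-k / 2, whose square is at most 2^-(k+1); these bounds sum
   to 1. *)
have iw k : (\int[mu]_x (w k x ^+ 2)%:E <= (1 / (2 ^ k.+1)%:R)%:E)%E.
  pose v := 2 ^+ k *: (u_ k.+1 - u_ k).
  have -> : (\int[mu]_x (w k x ^+ 2)%:E = \int[mu]_x (Lp_fun v x * Lp_fun v x)%:E)%E.
    apply: ae_eq_integral => //.
      apply/measurable_EFinP; apply: measurable_funM; exact: Lp_measurable.
    apply: filterS2 (Lp_scale_ae (2 ^+ k) (u_ k.+1 - u_ k)) (Lp_sub_ae (u_ k.+1) (u_ k)).
    by move=> x h1 h2 _; rewrite /v h1 h2.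
  rewrite -[leLHS]fineK; last by apply: integrable_fin_num => //; exact: L2_int.
  rewrite lee_fin [leLHS](_ : _ = inner v v)// inner_norm normrZ ger0_norm ?exprn_ge0//.
  have h1 : 2 ^+ k * `|u_ k.+1 - u_ k| <= 2^-1 ^+ k / 2.
    rewrite -ler_pdivlMl ?exprn_gt0//; apply: le_trans (hu k) _.
    by rewrite -hE expr2 mulrA.
  rewrite natrX [in leRHS]exprS div1r invfM -hE [leRHS]mulrC.
  have h2 : 2^-1 ^+ k <= 1 :> R by rewrite exprn_ile1// invf_le1// ler1n.
  have h3 : 0 <= 2^-1 ^+ k :> R by rewrite exprn_ge0.
  have h4 : 0 <= 2 ^+ k * `|u_ k.+1 - u_ k| by rewrite mulr_ge0// exprn_ge0.
  move: h1 h2 h3 h4; move: (2 ^+ k * _) (2^-1 ^+ k) => p q h1 h2 h3 h4; nra.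
have iS : mu.-integrable setT S.
  apply/integrableP; split => //; under eq_integral do rewrite gee0_abs//.
  rewrite integral_nneseries//; apply: (@le_lt_trans _ _ 1%:E); last exact: ltry.
  apply: le_trans (lee_nneseries _ (fun k _ => iw k)) _.
    by move=> k _ _; apply: integral_ge0.
  exact: epsilon_trick0.
pose s x := Num.sqrt (fine (S x)).
have ms : measurable_fun setT s.
  rewrite (_ : s = (fun x => fine (S x) `^ 2^-1)); last first.
    by apply/funext => x; rewrite powR12_sqrt// fine_ge0.
  apply: (measurableT_comp (measurable_powR _)).
  by apply: measurableT_comp => //; exact: fine_measurable.
have sL : s \in Lfun mu 2%:E.
  apply: Lfun2P => //; apply: le_integrable iS => //.
    by apply/measurable_EFinP; exact: measurable_funX.
  move=> x _; rewrite /s /= sqr_sqrtr ?fine_ge0// ger0_norm ?fine_ge0// gee0_abs//.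
  by case: (S x) (S0 x) => //= r _; rewrite leey.
(* Setting the sequence to 0 where [S] is infinite makes it converge at every point, so the limit
   [f] is measurable. *)
pose A := S @^-1` (~` [set +oo%E]).
have mA : measurable A by rewrite -[A]setTI; apply: mS => //; exact: measurableC.
pose v k x : R := \1_A x * u_ k x.
have mv k : measurable_fun setT (v k).
  by apply: measurable_funM; [exact: measurable_indic|exact: Lp_measurable].
have vS x k : `|v k.+1 x - v k x| <= s x * 2^-1 ^+ k.
  rewrite /v indicE; have [|xA] := boolP (x \in A); last first.
    by rewrite !mul0r subrr normr0 mulr_ge0// ?sqrtr_ge0// exprn_ge0.
  rewrite inE /A /= => Sx; rewrite !mul1r.
  have Sf : S x \is a fin_num by rewrite ge0_fin_numE// ltey; apply/eqP.
  have : ((w k x ^+ 2)%:E <= S x)%E.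
    apply: le_trans (nneseries_lim_ge k.+1 (fun n _ _ => w0 n x)).
    by rewrite big_nat_recr//= leeDr// sume_ge0.
  rewrite -(fineK Sf) lee_fin => h.
  have := ler_wsqrtr h; rewrite sqrtr_sqr normrM ger0_norm ?exprn_ge0// -/(s x).
  by rewrite hE ler_pdivlMr ?exprn_gt0// mulrC.
have /choice[f hf] x := geometric_cauchy (vS x).
have mf : measurable_fun setT f.
  by apply: measurable_fun_cvg mv _ => x _; case: (hf x).
have Aae : {ae mu, forall x, A x}.
  have := integrable_ae measurableT iS; apply: filterS => x /(_ I) Sx.
  by move=> SxE; rewrite SxE in Sx.
pose G : L2 := Lp_class mu (le1_two R) s.
have hG : {ae mu, forall x, G x = s x} by exact: Lp_class_ae.
(* It is this difference, not [f], that the majorant 2 s dominates; it lies in L^2 and brings [f]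
   there. *)
pose f0 x := u_ 0%N x - f x.
have f0L : f0 \in Lfun mu 2%:E.
  apply: (@Lfun2_le _ _ _ _ _ (2 *: G)).
    by apply: measurable_funB => //; exact: Lp_measurable.
  apply: filterS3 (Lp_scale_ae 2 G) hG Aae => x -> -> Ax.
  have := (hf x).2 0%N; rewrite /v indicE mem_set// mul1r expr0 mulr1 => h.
  by apply: le_trans h _; rewrite ler_norm.
pose u := u_ 0%N - Lp_class mu (le1_two R) f0.
have uE : {ae mu, forall x, Lp_fun u x = f x}.
  apply: filterS2 (Lp_sub_ae (u_ 0%N) (Lp_class mu (le1_two R) f0)) (Lp_class_ae (le1_two R) f0L).
  by move=> x -> ->; rewrite /f0 opprB addrC subrK.
exists u, (2 * `|G|) => k.
have -> : 2 * `|G| * 2^-1 ^+ k = `|(2 * 2^-1 ^+ k) *: G|.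
  by rewrite normrZ ger0_norm ?mulr_ge0 ?exprn_ge0// mulrAC.
apply: le_norm_L2.
apply: filterS3 (filterI (Lp_sub_ae (u_ k) u) (Lp_scale_ae (2 * 2^-1 ^+ k) G))
  (filterI uE Aae) hG => x [-> ->] [-> Ax] ->.
have := (hf x).2 k; rewrite /v indicE mem_set// mul1r => h.
by apply: le_trans (ler_norm _); apply: le_trans h _; rewrite mulrAC.
Qed.

Lemma L2_form_complete : form_complete setT (@inner _ _ R mu).
Proof.
move=> u_ _ cu.
have h0 k : 0 < 2^-1 ^+ k :> R by rewrite exprn_gt0.
have /choice[K hK] k : exists N : nat, forall i j : nat, (N <= i)%N -> (N <= j)%N ->
    `|u_ i - u_ j| < 2^-1 ^+ k ^+ 2 / 2.
  have [|N hN] := cu (2^-1 ^+ k ^+ 2 / 2); first by rewrite divr_gt0// exprn_gt0.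
  by exists N => i j Ni Nj; rewrite normE_inner hN.
pose n := fix n k := if k is k'.+1 then (n k' + K k'.+1)%N else K 0%N.
have nK k : (K k <= n k)%N by case: k => //= k; exact: leq_addl.
have [k|u [C hC]] := @L2_cauchy_cvg (u_ \o n).
  rewrite /= ltW// hK ?nK//.
  exact: leq_trans (nK k) (leq_addr _ _).
exists u => // e e0.
have C1 : 0 < `|C| + 1 by rewrite ltr_wpDl.
have : (fun k => 2^-1 ^+ k : R) @ \oo --> (0 : R).
  by apply: cvg_expr; rewrite ger0_norm// invf_lt1// ltr1n.
move=> /cvgrPdist_lt/(_ (Num.min 1 (e / 2 / (`|C| + 1)))).
rewrite lt_min ltr01 !divr_gt0// => /(_ isT)[k _ /(_ k (leqnn k))].
rewrite /= sub0r normrN gtr0_norm// lt_min => /andP[k1 ke].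
have k2 : 2^-1 ^+ k * (`|C| + 1) < e / 2 by rewrite -ltr_pdivlMr.
have kC : `|u_ (n k) - u| < e / 2.
  apply: le_lt_trans (hC k) (le_lt_trans _ k2); rewrite mulrC ler_wpM2l ?ltW//.
  by rewrite (le_lt_trans (ler_norm C))// ltrDl.
exists (n k) => i nki; rewrite -normE_inner.
have -> : u_ i - u = (u_ i - u_ (n k)) + (u_ (n k) - u) by rewrite addrA subrK.
apply: le_lt_trans (ler_normD _ _) _; rewrite [e]splitr ltrD//.
apply: lt_le_trans (hK k _ _ (leq_trans (nK k) nki) (nK k)) _.
apply: ltW; apply: le_lt_trans k2; rewrite expr2 -mulrA ler_wpM2l ?(ltW (h0 k))//.
apply: (@le_trans _ _ 1); last by rewrite lerDr.
by rewrite ler_pdivrMr// mul1r (le_trans (ltW k1))// ler1n.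
Qed.

Lemma L2_complete (U : set_system L2) : ProperFilter U -> cauchy U -> cvg U.
Proof.
move=> PU /cauchyP cU.
have h0 k : 0 < k.+1%:R^-1 :> R by rewrite invr_gt0.
have /choice[v hv] k : exists v, U (ball v k.+1%:R^-1) by exact: cU.
have vv i j : `|v i - v j| < i.+1%:R^-1 + j.+1%:R^-1.
  have [x [xi xj]] := filter_ex (filterI (hv i) (hv j)).
  have -> : v i - v j = (v i - x) + (x - v j) by rewrite addrA subrK.
  apply: le_lt_trans (ler_normD _ _) _; rewrite ltrD//.
  by move: xj; rewrite -ball_normE /= distrC.
have [//||u _ uu] := @L2_form_complete v.
  move=> e e0; have e2 : 0 < e / 2 by rewrite divr_gt0.
  have [N hN] := inv_nat_small e2; exists N => i j Ni Nj; rewrite -normE_inner.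
  by apply: lt_trans (vv i j) _; rewrite [e]splitr ltrD// hN.
apply/cvg_ex; exists u; apply/cvgrPdist_lt => e e0.
have e2 : 0 < e / 2 by rewrite divr_gt0.
have [N hN] := inv_nat_small e2; have [M hM] := uu _ e2.
pose k := maxn N M; apply: filterS (hv k) => x; rewrite -ball_normE /= => kx.
have -> : u - x = (u - v k) + (v k - x) by rewrite addrA subrK.
apply: le_lt_trans (ler_normD _ _) _; rewrite [e]splitr ltrD//.
  by rewrite distrC normE_inner hM// leq_maxr.
by apply: lt_trans kx _; rewrite hN// leq_maxl.
Qed.

HB.instance Definition _ := Uniform_isComplete.Build L2 L2_complete.

Lemma Banach_Steinhaus_L2 (W : normedModType R) (F : set (L2 -> W)) :
  (forall f, F f -> bounded_fun_norm f /\ linear f) ->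
  pointwise_bounded F -> uniform_bounded F.
Proof. exact: (@Banach_Steinhauss R L2 W). Qed.

Lemma hilbert_inner : hilbert (@inner _ _ R mu).
Proof.
have fi := positive_form_inner mu.
split => //; last 1 first.
- move=> S hS.
  pose F : set (L2 -> R^o) := [set inner x | x in S].
  have [_ [x _ <-]|y|M hM] := @Banach_Steinhaus_L2 R^o F _ _ 1.
  + split; last by move=> a y z; rewrite (pfDr fi)// (pfZr fi).
    move=> r; exists (`|x| * r) => y yr.
    apply: le_trans (form_CauchySchwarz fi I I) _.
    by rewrite -!normE_inner ler_wpM2l.
  + by have [M hM] := hS y; exists M => _ [x Sx <-]; exact: hM.
  exists (Num.max 0 M) => x Sx.
  have [x0|x0] := eqVneq `|x| 0; first by rewrite -normE_inner x0 le_max lexx.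
  have x_gt0 : 0 < `|x| by rewrite lt_def x0/=.
  (* The functional [inner x] attains its norm at the unit vector along [x]. *)
  have := hM _ (imageP _ Sx) (`|x|^-1 *: x); rewrite normrZ gtr0_norm ?invr_gt0//.
  rewrite mulVf// lexx => /(_ isT); rewrite (pfZr fi)// inner_norm expr2 mulKf//.
  by rewrite normr_id -normE_inner le_max orbC => ->.
- by move=> x; rewrite inner_norm => /eqP; rewrite sqrf_eq0 normr_eq0 => /eqP.
- exact: L2_form_complete.
Qed.

End RieszFischer.

(** * Lattice operations on L^2 *)

Section Lattice.
Context d (T : measurableType d) (R : realType).
Variable mu : {measure set T -> \bar R}.
Local Notation L2 := (L2 mu).

Lemma truncation_ae (a : R) (u : L2) : 0 <= a ->
  {ae mu, forall x, truncation a u x = Num.min (u x) a}.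
Proof.
move=> a0; apply: Lp_class_ae; apply: (@Lfun2_le _ _ _ _ _ u).
  by apply: measurable_funTS; apply: measurable_minr => //; exact: Lp_measurable.
apply: aeW => x; case: (leP (u x) a) => // ua.
by rewrite !ger0_norm ?(le_trans a0)// ltW.
Qed.

(** Both parts are expressed through [truncation 0] so that the Markov property at level 0 applies
    to them verbatim. *)
Definition L2_pos (u : L2) : L2 := u - truncation 0 u.
Definition L2_neg (u : L2) : L2 := - truncation 0 u.

Lemma L2_pos_ae u : {ae mu, forall x, L2_pos u x = Num.max (u x) 0}.
Proof.
apply: filterS2 (Lp_sub_ae u (truncation 0 u)) (truncation_ae u (lexx 0)) => x -> ->.
by case: (leP (u x) 0) => ux; [rewrite subrr|rewrite subr0].
Qed.

Lemma L2_neg_ae u : {ae mu, forall x, L2_neg u x = Num.max (- u x) 0}.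
Proof.
apply: filterS2 (Lp_opp_ae (truncation 0 u)) (truncation_ae u (lexx 0)) => x -> ->.
case: (leP (u x) 0) => ux; first by rewrite max_l// oppr_ge0.
by rewrite oppr0 max_r// oppr_le0 ltW.
Qed.

Lemma L2_posBneg u : u = L2_pos u - L2_neg u.
Proof. by rewrite /L2_pos /L2_neg opprK subrK. Qed.

Lemma L2_pos_ge0 u : {ae mu, forall x, 0 <= L2_pos u x}.
Proof. by apply: filterS (L2_pos_ae u) => x ->; rewrite le_max lexx orbT. Qed.

Lemma L2_neg_ge0 u : {ae mu, forall x, 0 <= L2_neg u x}.
Proof. by apply: filterS (L2_neg_ae u) => x ->; rewrite le_max lexx orbT. Qed.

Lemma L2_neg_eq0 u : L2_neg u = 0 <-> {ae mu, forall x, 0 <= u x}.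
Proof.
split => [u0|u0].
  have := L2_neg_ae u; rewrite u0 => h; apply: filterS2 (Lp_zero_ae mu (le1_two R)) h => x ->.
  by case: (leP (- u x) 0) => [h _|h h0]; lra.
apply: Lp_ext; apply: filterS3 (L2_neg_ae u) (Lp_zero_ae mu (le1_two R)) u0 => x -> -> ux.
by rewrite max_r// oppr_le0.
Qed.

Lemma inner_neg_pos u : inner (L2_neg u) (L2_pos u) = 0.
Proof.
rewrite (@inner_mul_ae _ _ _ _ _ _ (cst 0)) ?Rintegral_cst ?mul0r//.
apply: filterS2 (L2_pos_ae u) (L2_neg_ae u) => x -> ->.
case: (leP (u x) 0) => ux; first by rewrite mulr0.
by rewrite max_r ?mul0r// oppr_le0 ltW.
Qed.

Lemma norm_negB u v : `|L2_neg u - L2_neg v| <= `|u - v|.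
Proof.
apply: le_norm_L2.
apply: filterS3 (filterI (Lp_sub_ae (L2_neg u) (L2_neg v)) (Lp_sub_ae u v))
  (L2_neg_ae u) (L2_neg_ae v) => x [-> ->] -> ->.
case: (leP (- u x) 0) => h1; case: (leP (- v x) 0) => h2;
  rewrite ler_norml; have h3 := ler_norm (u x - v x);
  have h4 := ler_norm (- (u x - v x)); rewrite normrN in h4;
  have h5 := normr_ge0 (u x - v x); apply/andP; split; lra.
Qed.

Lemma norm_posB u v : `|L2_pos u - L2_pos v| <= `|u - v|.
Proof.
apply: le_norm_L2.
apply: filterS3 (filterI (Lp_sub_ae (L2_pos u) (L2_pos v)) (Lp_sub_ae u v))
  (L2_pos_ae u) (L2_pos_ae v) => x [-> ->] -> ->.
case: (leP (u x) 0) => h1; case: (leP (v x) 0) => h2;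
  rewrite ler_norml; have h3 := ler_norm (u x - v x);
  have h4 := ler_norm (- (u x - v x)); rewrite normrN in h4;
  have h5 := normr_ge0 (u x - v x); apply/andP; split; lra.
Qed.

Lemma norm_truncationB (a : R) (u v : L2) : 0 <= a ->
  `|truncation a u - truncation a v| <= `|u - v|.
Proof.
move=> a0; apply: le_norm_L2.
apply: filterS3 (filterI (Lp_sub_ae (truncation a u) (truncation a v)) (Lp_sub_ae u v))
  (truncation_ae u a0) (truncation_ae v a0) => x [-> ->] -> ->.
case: (leP (u x) a) => h1; case: (leP (v x) a) => h2;
  rewrite ler_norml; have h3 := ler_norm (u x - v x);
  have h4 := ler_norm (- (u x - v x)); rewrite normrN in h4;
  have h5 := normr_ge0 (u x - v x); apply/andP; split; lra.
Qed.

Lemma norm_truncation_le (a : R) (u : L2) : 0 <= a -> `|truncation a u| <= `|u|.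
Proof.
move=> a0; apply: le_norm_L2; apply: filterS (truncation_ae u a0) => x ->.
by case: (leP (u x) a) => // ua; rewrite !ger0_norm ?(le_trans a0)// ltW.
Qed.

End Lattice.

(** * Resolvents of Dirichlet forms *)

Section DirichletForm.
Context (R : realType) (X : ptopologicalType).
Variable m : {measure set (borel X) -> \bar R}.
Context (F : set (L2 m)) (E : L2 m -> L2 m -> R).
Hypothesis hE : regular_symmetric_dirichlet_form F E.
Let sd := rsdf_semi_dirichlet hE.
Local Notation L2 := (L2 m).

Definition energy1 (u v : L2) : R := E u v + inner u v.
Local Notation E1 := energy1.
Let N1 := form_norm E1.

Lemma subspace_dom : subspace F.
Proof. by split; [exact: sdf_zero sd|exact: sdf_linear sd]. Qed.
Let sF := subspace_dom.

Lemma positive_form_E1 : positive_form F E1.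
Proof.
have fi := positive_form_inner m.
split => //.
- move=> a u v w Fu Fv Fw; rewrite /E1 (sdf_bilinear_l sd)// (pf_linear fi)//; ring.
- by move=> u v Fu Fv; rewrite /E1 (rsdf_symmetric hE)// (pf_sym fi).
- by move=> u Fu; rewrite addr_ge0 ?(sdf_ge0 sd)// (pf_ge0 fi).
Qed.
Let f1 := positive_form_E1.

Lemma energy_normE u : energy_norm E u = N1 u.
Proof. by rewrite /energy_norm -inner_norm. Qed.

Lemma norm_le_E1 u : F u -> `|u| <= N1 u.
Proof.
move=> Fu; rewrite normE_inner /N1 /form_norm ler_wsqrtr// /E1 lerDr.
exact: (sdf_ge0 sd).
Qed.

Lemma form_complete_E1 : form_complete F E1.
Proof.
move=> u_ Fu cu.
have [//|e e0|u Fu' uu] := sdf_complete sd (u_ := u_).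
  by have [N hN] := cu e e0; exists N => i j Ni Nj; rewrite energy_normE hN.
exists u => // e e0; move/cvgrPdist_lt: uu => /(_ e e0)[N _ hN].
exists N => n Nn; have := hN n Nn; rewrite sub0r normrN ger0_norm ?sqrtr_ge0//.
by rewrite energy_normE.
Qed.

Lemma E1_definite u : F u -> E1 u u = 0 -> u = 0.
Proof.
move=> Fu u0; apply/eqP; rewrite -normr_le0; apply: le_trans (norm_le_E1 Fu) _.
by rewrite /N1 /form_norm u0 sqrtr0.
Qed.

Lemma E1_le0 u : F u -> E1 u u <= 0 -> u = 0.
Proof.
by move=> Fu u0; apply: E1_definite => //; apply/eqP; rewrite eq_le u0 (pf_ge0 f1).
Qed.

Lemma dom_truncation a u : 0 <= a -> F u -> F (truncation a u).
Proof. by move=> a0 Fu; case: (sdf_markov sd Fu a0). Qed.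
Lemma dom_neg u : F u -> F (L2_neg u).
Proof. by move=> Fu; apply: subspaceN => //; exact: dom_truncation. Qed.
Lemma dom_pos u : F u -> F (L2_pos u).
Proof. by move=> Fu; apply: subspaceB => //; exact: dom_truncation. Qed.
Hint Resolve dom_neg dom_pos dom_truncation : core.

Lemma positive_form_E : positive_form F E.
Proof.
by split; [exact: sF|exact: (sdf_bilinear_l sd)|exact: (rsdf_symmetric hE)|exact: (sdf_ge0 sd)].
Qed.

(** The Markov property at level 0, the L^2 part vanishing by disjointness of supports. It is the
    source of the minimum and comparison principles below. *)
Lemma E1_neg_pos u : F u -> E1 (L2_neg u) (L2_pos u) <= 0.
Proof.
move=> Fu; have Ft := dom_truncation (lexx 0) Fu.
have [_] := sdf_markov sd Fu (lexx 0).
have -> : E1 (L2_neg u) (L2_pos u) = - E (truncation 0 u) (u - truncation 0 u).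
  rewrite /E1 inner_neg_pos addr0 (pfNl positive_form_E)//.
  exact: dom_pos.
by rewrite oppr_le0.
Qed.

Lemma E1_self_neg u : F u -> E1 u (L2_neg u) <= - E1 (L2_neg u) (L2_neg u).
Proof.
move=> Fu; have Fp := dom_pos Fu; have Fn := dom_neg Fu.
have -> : E1 u (L2_neg u) = E1 (L2_neg u) (L2_pos u) - E1 (L2_neg u) (L2_neg u).
  by rewrite (pf_sym f1 Fn Fp) -(pfBl f1)// -L2_posBneg.
by have := E1_neg_pos Fu; lra.
Qed.

Lemma E1_self_pos u : F u -> E1 (L2_pos u) (L2_pos u) <= E1 u (L2_pos u).
Proof.
move=> Fu; have Fp := dom_pos Fu; have Fn := dom_neg Fu.
have -> : E1 u (L2_pos u) = E1 (L2_pos u) (L2_pos u) - E1 (L2_neg u) (L2_pos u).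
  by rewrite -(pfBl f1)// -L2_posBneg.
by have := E1_neg_pos Fu; lra.
Qed.

Lemma E1_pos_le u : F u -> E1 (L2_pos u) (L2_pos u) <= E1 u u.
Proof.
move=> Fu; have Fp := dom_pos Fu; have Fn := dom_neg Fu.
have -> : E1 u u = E1 (L2_pos u) (L2_pos u) - 2 * E1 (L2_neg u) (L2_pos u) +
    E1 (L2_neg u) (L2_neg u).
  by rewrite (pf_sym f1 Fn Fp) -(pf_sqrB f1)// -L2_posBneg.
by have := E1_neg_pos Fu; have := pf_ge0 f1 Fn; lra.
Qed.

Lemma E1_neg_le u : F u -> E1 (L2_neg u) (L2_neg u) <= E1 u u.
Proof.
move=> Fu; have Fp := dom_pos Fu; have Fn := dom_neg Fu.
have -> : E1 u u = E1 (L2_pos u) (L2_pos u) - 2 * E1 (L2_neg u) (L2_pos u) +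
    E1 (L2_neg u) (L2_neg u).
  by rewrite (pf_sym f1 Fn Fp) -(pf_sqrB f1)// -L2_posBneg.
by have := E1_neg_pos Fu; have := pf_ge0 f1 Fp; lra.
Qed.

(** With t = [truncation a u], E u u = E t t + 2 E t (u - t) + E (u - t) (u - t), and the last two
    terms are nonnegative. *)
Lemma E1_truncation_le a u : 0 <= a -> F u ->
  E1 (truncation a u) (truncation a u) <= E1 u u.
Proof.
move=> a0 Fu; have [Ft tu] := sdf_markov sd Fu a0.
have fE := positive_form_E.
rewrite /E1 lerD//; last first.
  by rewrite !inner_norm ler_pXn2r ?nnegrE//; exact: norm_truncation_le.
have := pf_ge0 fE (subspaceB sF Fu Ft); rewrite (pf_sqrB fE)// (pf_sym fE Fu Ft).
by move: tu; rewrite (pfBr fE)//; lra.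
Qed.

Section Resolvent.
Context (S : set L2) (sS : subspace S) (SF : S `<=` F).

(** [form_closure] ranges over the whole space, where the form has arbitrary values off [F]; hence
    the intersection. *)
Definition form_hull : set L2 := F `&` form_closure E1 S.

Lemma subspace_hull : subspace form_hull.
Proof.
split; first by split; [exact: (subspace0 sF)|move=> e e0; exists 0;
  [exact: subspace0|rewrite subrr /form_norm (pf0l f1) ?sqrtr0//; exact: (subspace0 sF)]].
move=> a u v [Fu cu] [Fv cv]; split; first exact: (sF.2).
move=> e e0; have a1 : 0 < `|a| + 1 by rewrite ltr_wpDl.
have [|s Ss us] := cu (e / 2 / (`|a| + 1)); first by rewrite !divr_gt0.
have [|t St vt] := cv (e / 2); first by rewrite divr_gt0.
have Fs := SF Ss; have Ft := SF St.
exists (a *: s + t); first exact: sS.2.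
have -> : a *: u + v - (a *: s + t) = a *: (u - s) + (v - t).
  by rewrite scalerBr opprD addrACA.
have Fus := subspaceB sF Fu Fs; have Fvt := subspaceB sF Fv Ft.
apply: le_lt_trans (form_normD f1 (subspaceZ sF a Fus) Fvt) _.
rewrite (form_normZ f1)// [e]splitr ler_ltD//.
move: us; rewrite ltr_pdivlMr// => /ltW; apply: le_trans.
by rewrite mulrC ler_wpM2l ?form_norm_ge0// lerDl.
Qed.

Lemma closed_hull u : F u -> form_closure E1 form_hull u -> form_hull u.
Proof.
move=> Fu cu; split => // e e0; have e2 : 0 < e / 2 by rewrite divr_gt0.
have [v [Fv cv] uv] := cu _ e2; have [s Ss vs] := cv _ e2; exists s => //.
apply: le_lt_trans (form_norm_triangle f1 Fu Fv (SF Ss)) _.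
by rewrite [e]splitr ltrD.
Qed.

Lemma sub_hull : S `<=` form_hull.
Proof.
move=> s Ss; split; first exact: SF.
move=> e e0; exists s => //; rewrite subrr /form_norm (pf0l f1) ?sqrtr0//.
exact: (subspace0 sF).
Qed.

Lemma exists_resolvent : exists G : L2 -> L2,
  (forall f, form_hull (G f)) /\ forall f v, form_hull v -> E1 (G f) v = inner f v.
Proof.
suff /choice[G hG] f : exists u, form_hull u /\ forall v, form_hull v -> E1 u v = inner f v.
  by exists G; split => [f|f v]; case: (hG f) => // _; apply.
have fi := positive_form_inner m.
have [|||q [Fq cq qs]] := @form_representation _ _ _ _ f1 S (inner f) `|f| form_complete_E1 sS.
- exact: SF.
- by move=> a u v _ _; rewrite (pfDr fi)// (pfZr fi).
- move=> u Su; apply: le_trans (form_CauchySchwarz fi I I) _.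
  by rewrite -!normE_inner ler_wpM2l// norm_le_E1//; exact: SF.
exists q; split => // v [Fv cv].
apply/eqP; rewrite -subr_eq0 -normr_le0; apply/ler_addgt0Pr => e e0; rewrite add0r.
pose K := N1 q + `|f| + 1.
have K0 : 0 < K by rewrite ltr_wpDl// addr_ge0// form_norm_ge0.
have [|s Ss vs] := cv (e / K); first by rewrite divr_gt0.
have Fs := SF Ss; have Fvs := subspaceB sF Fv Fs.
have -> : E1 q v - inner f v = E1 q (v - s) - inner f (v - s).
  by rewrite (pfBr f1 Fv Fs Fq) (pfBr fi)// (qs _ Ss); ring.
apply: le_trans (ler_normB _ _) _.
have h1 := form_CauchySchwarz f1 Fq Fvs.
have h2 := form_CauchySchwarz fi (I : setT f) (I : setT (v - s)).
rewrite -!normE_inner in h2; have h3 := norm_le_E1 Fvs.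
have : `|E1 q (v - s)| + `|inner f (v - s)| <= (N1 q + `|f|) * N1 (v - s).
  rewrite mulrDl lerD//; apply: le_trans h2 _; exact: ler_wpM2l.
move=> h; apply: le_trans h _; apply: (@le_trans _ _ (K * (e / K))).
  by apply: ler_pM; rewrite ?addr_ge0 ?form_norm_ge0// ?lerDl// ltW.
by rewrite mulrC divfK// gt_eqF.
Qed.

End Resolvent.
End DirichletForm.

(** * Multiplication by indicators *)

Section CutoffL2.
Context d (T : measurableType d) (R : realType).
Variable mu : {measure set T -> \bar R}.
Local Notation L2 := (L2 mu).

Lemma Rintegral_ae_ge0 (f : T -> R) : measurable_fun setT f ->
  {ae mu, forall x, 0 <= f x} -> 0 <= (\int[mu]_x f x)%R.
Proof.
move=> mf f0; rewrite (@Rintegral_ae _ _ _ _ _ (fun x => Num.max (f x) 0))//.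
- by apply: Rintegral_ge0 => x _; rewrite le_max lexx orbT.
- by apply: measurable_funTS; exact: measurable_maxr.
- by apply: filterS f0 => x fx; rewrite max_l.
Qed.

Lemma cutoff_ae (A : set T) (u : L2) : measurable A ->
  {ae mu, forall x, cutoff A u x = \1_A x * u x}.
Proof.
move=> mA; apply: Lp_class_ae; apply: (@Lfun2_le _ _ _ _ _ u).
  by apply: measurable_funM; [exact: measurable_indic|exact: Lp_measurable].
by apply: aeW => x; rewrite indicE; case: (x \in A); rewrite ?mul1r ?mul0r ?normr0.
Qed.

Lemma norm_cutoff_le (A : set T) (u : L2) : measurable A -> `|cutoff A u| <= `|u|.
Proof.
move=> mA; apply: le_norm_L2; apply: filterS (cutoff_ae u mA) => x ->.
by rewrite indicE; case: (x \in A); rewrite ?mul1r ?mul0r ?normr0.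
Qed.

Lemma cutoffD (A : set T) (u : L2) : measurable A -> u = cutoff A u + cutoff (~` A) u.
Proof.
move=> mA; apply: Lp_ext; have mA' := measurableC mA.
apply: filterS3 (Lp_add_ae (cutoff A u) (cutoff (~` A) u)) (cutoff_ae u mA)
  (cutoff_ae u mA') => x -> -> ->.
by rewrite !indicE in_setC; case: (x \in A); rewrite ?mul1r ?mul0r ?addr0 ?add0r.
Qed.

Lemma cutoff_linear (A : set T) : measurable A -> linear (@cutoff _ _ _ mu _ (le1_two R) A).
Proof.
move=> mA a u v; apply: Lp_ext.
apply: filterS3 (filterI (cutoff_ae (a *: u + v) mA) (Lp_add_ae (a *: u) v))
  (filterI (cutoff_ae u mA) (cutoff_ae v mA))
  (filterI (Lp_add_ae (a *: cutoff A u) (cutoff A v))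
    (filterI (Lp_scale_ae a u) (Lp_scale_ae a (cutoff A u)))) => x.
by move=> [-> ->] [hu hv] [-> [-> ->]]; rewrite hu hv; ring.
Qed.

Lemma inner_cutoff (A : set T) (u v : L2) : measurable A ->
  inner (cutoff A u) v = inner u (cutoff A v).
Proof.
move=> mA; apply: inner_mul_ae.
  by apply: measurable_funM; exact: Lp_measurable.
by apply: filterS2 (cutoff_ae u mA) (cutoff_ae v mA) => x -> ->; ring.
Qed.

Lemma cutoff_approx (A : nat -> set T) (z : L2) : (forall n, measurable (A n)) ->
  (forall x, z x != 0 -> exists N : nat, forall n, (N <= n)%N -> A n x) ->
  forall e : R, 0 < e -> exists n, `|z - cutoff (A n) z| < e.
Proof.
move=> mA zA e e0.
pose f n x := (\1_(~` A n) x * (z x * z x))%:E.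
have mf n : measurable_fun setT (f n).
  apply/measurable_EFinP; apply: measurable_funM.
    by apply: measurable_indic; exact: measurableC.
  by apply: measurable_funM; exact: Lp_measurable.
have [_ _ cf] : [/\ mu.-integrable setT (cst 0%E : T -> \bar R),
    (\int[mu]_x `|f n x - 0|)%E @[n --> \oo] --> 0%E &
    (\int[mu]_x f n x)%E @[n --> \oo] --> (\int[mu]_x (cst 0%E : T -> \bar R) x)%E].
  apply: (@dominated_convergence _ _ _ mu setT measurableT f (cst 0%E)
    (fun x => (z x * z x)%:E)) => //.
  - apply: aeW => x _; have [z0|z0] := eqVneq (z x) 0.
      by apply: cvg_near_cst; apply: nearW => n; rewrite /f z0 mul0r mulr0.
    have [N hN] := zA x z0; apply: cvg_near_cst; exists N => // n /= /hN Ax.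
    by rewrite /f indicE in_setC mem_set//= mul0r.
  - exact: L2_int.
  - apply: aeW => x n _; rewrite /f lee_fin ger0_norm.
      by rewrite indicE; case: (_ \in _); rewrite ?mul1r// mul0r -expr2 sqr_ge0.
    by rewrite mulr_ge0// -expr2 sqr_ge0.
have {}cf : (fun n => `|z - cutoff (A n) z| ^+ 2) @ \oo --> (0 : R).
  rewrite integral0 in cf.
  rewrite (_ : (fun n => _) = fine \o (fun n => \int[mu]_x f n x)%E).
    exact: (fine_cvg cf).
  apply/funext => n /=; rewrite -inner_norm /inner; congr fine.
  apply: ae_eq_integral => //.
    by apply/measurable_EFinP; apply: measurable_funM; exact: Lp_measurable.
  apply: filterS2 (Lp_sub_ae z (cutoff (A n) z)) (cutoff_ae z (mA n)) => x h1 h2 _.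
  rewrite /f h1 h2; congr EFin; rewrite !indicE in_setC.
  by case: (_ \in _) => /=; ring.
move/cvgrPdist_lt: cf => /(_ (e ^+ 2)); rewrite exprn_gt0// => /(_ isT)[n _].
move=> /(_ n (leqnn n)); rewrite /= sub0r normrN ger0_norm ?sqr_ge0// => h.
by exists n; rewrite -(@ltr_pXn2r _ 2)// ?nnegrE// ltW.
Qed.

End CutoffL2.

(** An uncountable family of almost everywhere inequalities has no common null set; rational
    parameters have one, and continuity recovers the real ones. [K] bounds the difference quotient
    for parameters at distance at most 1. *)
Lemma quadratic_rat_ge0 (R : realType) (a b c : R) :
  (forall q : rat, 0 <= a + ratr q * b + ratr q ^+ 2 * c) ->
  forall t : R, 0 <= a + t * b + t ^+ 2 * c.
Proof.
move=> h t; apply/ler_addgt0Pr => e e0.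
pose K := `|b| + (2 * `|t| + 1) * `|c| + 1.
have K0 : 0 < K by rewrite ltr_wpDl// addr_ge0// mulr_ge0// addr_ge0// mulr_ge0.
have [q] : exists q : rat, ratr q \in `]t, (t + Num.min 1 (e / K))[.
  by apply: rat_in_itvoo; rewrite ltrDl lt_min ltr01 divr_gt0.
rewrite in_itv/= -ltrBlDl lt_min => /andP[tq /andP[q1 qe]].
apply: le_trans (h q) _; set s := ratr q in tq q1 qe *.
have -> : a + s * b + s ^+ 2 * c = a + t * b + t ^+ 2 * c + (s - t) * (b + (s + t) * c) by ring.
rewrite lerD2l; apply: le_trans (ler_norm _) _; rewrite normrM gtr0_norm ?subr_gt0//.
have : `|b + (s + t) * c| <= K.
  apply: le_trans (ler_normD _ _) _; rewrite /K normrM -addrA lerD2l ler_wpDr//.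
  rewrite ler_wpM2r//; have -> : s + t = 2 * t + (s - t) by ring.
  apply: le_trans (ler_normD _ _) _; rewrite normrM ger0_norm// lerD2l.
  by rewrite gtr0_norm ?subr_gt0// ltW.
move=> hK; apply: (@le_trans _ _ (e / K * K)); last by rewrite divfK// gt_eqF.
by rewrite ler_pM// ?subr_ge0 ltW.
Qed.

(** * A Schur test for positivity preserving operators *)

Section SchurBound.
Context d (T : measurableType d) (R : realType).
Variable mu : {measure set T -> \bar R}.
Local Notation L2 := (L2 mu).
Context (D : L2 -> L2) (lD : linear D).
Hypothesis D_sym : forall u v, inner (D u) v = inner u (D v).
Hypothesis D_pos : forall u : L2, {ae mu, forall x, 0 <= u x} ->
  {ae mu, forall x, 0 <= D u x}.
Context (C : R) (D_norm : forall u, `|D u| <= C * `|u|).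
Context (g : L2).
Hypothesis D_le : forall u : L2, {ae mu, forall x, 0 <= u x <= 1} ->
  {ae mu, forall x, D u x <= g x}.

(* [D ((z - t)^2 1_A) >= 0] for every real [t]; evaluating at [t = z x] and
   integrating over [A] gives a symmetric form of the Schur test. *)
Lemma schur_bound_bounded (z q a : L2) (e : R) :
  {ae mu, forall x, q x = z x ^+ 2} ->
  {ae mu, forall x, a x = 1 \/ a x = 0 /\ z x = 0} ->
  {ae mu, forall x, z x != 0 -> g x <= e} ->
  inner z (D z) <= e * `|z| ^+ 2.
Proof.
move=> qE aE ge.
have fi := positive_form_inner mu.
(* Here [a] is the indicator of the bounded region and [q] is z^2, so that the vector fed to [D] is
   (z - r)^2 where [a] is 1, and 0 elsewhere. *)
have qpos (r : rat) : {ae mu, forall x,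
    0 <= D q x + ratr r * (-2 * D z x) + ratr r ^+ 2 * D a x}.
  pose f : L2 := ratr r ^+ 2 *: a + (ratr r * -2 *: z + q).
  have f0 : {ae mu, forall x, 0 <= f x}.
    apply: filterS3 (filterI qE aE)
      (filterI (Lp_add_ae (ratr r ^+ 2 *: a) (ratr r * -2 *: z + q))
        (Lp_add_ae (ratr r * -2 *: z) q))
      (filterI (Lp_scale_ae (ratr r ^+ 2) a) (Lp_scale_ae (ratr r * -2) z)) => x.
    move=> [hq ha] [-> ->] [-> ->]; rewrite hq.
    case: ha => [->|[-> ->]]; last by rewrite !mulr0 expr0n/= !addr0.
    have -> : ratr r ^+ 2 * 1 + (ratr r * -2 * z x + z x ^+ 2) = (z x - ratr r) ^+ 2 by ring.
    exact: sqr_ge0.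
  have := D_pos f0; rewrite /f lD lD => Df.
  apply: filterS3 (filterI (Lp_scale_ae (ratr r ^+ 2) (D a)) (Lp_scale_ae (ratr r * -2) (D z)))
    (filterI (Lp_add_ae (ratr r ^+ 2 *: D a) (ratr r * -2 *: D z + D q))
    (Lp_add_ae (ratr r * -2 *: D z) (D q))) Df => x [h1 h2] [h3 h4].
  rewrite h3 h4 h1 h2 => h; apply: le_trans h _; lra.
have {}qpos : {ae mu, forall x, forall r : rat,
    0 <= D q x + ratr r * (-2 * D z x) + ratr r ^+ 2 * D a x}.
  have := ae_foralln (fun n => qpos (odflt 0 (unpickle n))).
  by apply: filterS => x h r; have := h (pickle r); rewrite pickleK.
(* The quadratic inequality at t = z x, integrated where [a] is 1; elsewhere [z] and [q] vanish as
   well. By symmetry the outer terms agree, so <z, D z> <= <q, D a>. *)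
have key : 0 <= inner a (D q) - 2 * inner z (D z) + inner q (D a).
  have -> : inner a (D q) - 2 * inner z (D z) + inner q (D a) =
    (\int[mu]_x (a x * D q x + (-2 * (z x * D z x)) + q x * D a x))%R.
    have i1 := L2_int a (D q); have i2 := L2_int z (D z); have i3 := L2_int q (D a).
    have i2' : mu.-integrable setT (EFin \o (fun x => -2 * (z x * D z x))).
      have := integrableZl measurableT (-2) i2.
      by apply: eq_integrable => // x _ /=; rewrite EFinM.
    have i12 : mu.-integrable setT (EFin \o (fun x => a x * D q x + (-2 * (z x * D z x)))).
      by have := integrableD measurableT i1 i2'; apply: eq_integrable.
    by rewrite RintegralD// RintegralD// RintegralZl// mulNr.
  apply: Rintegral_ae_ge0.
  - apply: measurable_funD; last by apply: measurable_funM; exact: Lp_measurable.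
    apply: measurable_funD; first by apply: measurable_funM; exact: Lp_measurable.
    by apply: measurable_funM => //; apply: measurable_funM; exact: Lp_measurable.
  - apply: filterS3 qpos qE aE => x h hq [ax|[ax zx]]; last first.
      by rewrite hq ax zx expr0n/= !mul0r mulr0 !addr0.
    by rewrite hq ax; have := quadratic_rat_ge0 h (z x); lra.
have sym : inner a (D q) = inner q (D a) by rewrite -D_sym (pf_sym fi).
have a01 : {ae mu, forall x, 0 <= a x <= 1}.
  by apply: filterS aE => x [->|[-> _]]; rewrite ?ler01 ?lexx.
have bound : inner q (D a) <= inner (e *: z) z.
  apply: inner_le; apply: filterS3 (filterI qE (Lp_scale_ae e z)) ge (D_le a01) => x.
  move=> [-> ->] zx Da; have [->|/zx gx] := eqVneq (z x) 0.
    by rewrite expr0n/= mulr0 !mul0r.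
  have -> : e * z x * z x = z x ^+ 2 * e by ring.
  by rewrite ler_wpM2l ?sqr_ge0// (le_trans Da).
rewrite (pfZl fi)// inner_norm in bound; move: key; rewrite sym; lra.
Qed.

(** On [A n] the lower bound on |z| makes the indicator square integrable and the upper bound does
    so for z^2; the cutoffs of [z] to these sets converge to [z] in L^2. *)
Lemma schur_bound (z : L2) (e : R) : 0 <= e ->
  {ae mu, forall x, z x != 0 -> g x <= e} -> inner z (D z) <= e * `|z| ^+ 2.
Proof.
move=> e0 ge; have fi := positive_form_inner mu.
pose A n : set T := [set x | n.+1%:R^-1 <= `|z x| /\ `|z x| <= n.+1%:R].
have mz : measurable_fun setT (fun x => `|z x|).
  by apply: measurableT_comp => //; exact: Lp_measurable.
have mA n : measurable (A n).
  have -> : A n = (fun x => `|z x|) @^-1` `[n.+1%:R^-1, n.+1%:R].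
    by apply/seteqP; split => x /=; rewrite in_itv/= => /andP.
  by rewrite -[X in measurable X]setTI; exact: mz.
have zA x : z x != 0 -> exists N : nat, forall n, (N <= n)%N -> A n x.
  rewrite -normr_gt0 => zx.
  have [N1 h1] := inv_nat_small zx.
  pose N2 := Num.truncn `|z x|.
  exists (maxn N1 N2) => n; rewrite geq_max => /andP[n1 n2]; split; first exact/ltW/h1.
  apply/ltW; apply: lt_le_trans (truncnS_gt _) _; by rewrite ler_nat ltnS.
have bnd n : inner (cutoff (A n) z) (D (cutoff (A n) z)) <= e * `|cutoff (A n) z| ^+ 2.
  have cz := cutoff_ae z (mA n).
  pose a := Lp_class mu (le1_two R) (\1_(A n)).
  have aA : {ae mu, forall x, a x = \1_(A n) x}.
    apply: Lp_class_ae; apply: (@Lfun2_le _ _ _ _ _ (n.+1%:R *: z)).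
      exact: measurable_indic.
    apply: filterS (Lp_scale_ae n.+1%:R z) => x ->; rewrite indicE.
    have [|_] := boolP (x \in A n); last by rewrite normr0.
    rewrite inE => -[+ _]; rewrite normr1 normrM ger0_norm// => h.
    by rewrite -ler_pdivrMl// mulr1.
  pose q := Lp_class mu (le1_two R) (fun x => \1_(A n) x * z x ^+ 2).
  have qA : {ae mu, forall x, q x = \1_(A n) x * z x ^+ 2}.
    apply: Lp_class_ae; apply: (@Lfun2_le _ _ _ _ _ (n.+1%:R *: z)).
      by apply: measurable_funM => //; apply: measurable_funX; exact: Lp_measurable.
    apply: filterS (Lp_scale_ae n.+1%:R z) => x ->; rewrite indicE.
    have [|_] := boolP (x \in A n); last by rewrite mul0r normr0.
    rewrite inE => -[_ h]; rewrite mul1r expr2 !normrM [ `|n.+1%:R|]ger0_norm//.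
    by rewrite ler_wpM2r.
  apply: (@schur_bound_bounded _ q a).
  - apply: filterS2 cz qA => x -> ->; rewrite indicE.
    by case: (x \in A n); rewrite ?mul1r// !mul0r expr0n.
  - apply: filterS2 cz aA => x -> ->; rewrite indicE.
    by case: (x \in A n); [left|right; rewrite mul0r].
  - apply: filterS2 cz ge => x -> h zx; apply: h; apply: contra_neq zx => ->.
    by rewrite mulr0.
apply/ler_addgt0Pr => d0 d0_gt0; pose K := 2 * (`|C| * `|z|) + 1.
have K0 : 0 < K by rewrite ltr_wpDl// mulr_ge0// mulr_ge0.
have [|n hn] := cutoff_approx mA zA (e := d0 / K); first by rewrite divr_gt0.
set y := cutoff (A n) z in hn; have yz : `|y| <= `|z| by exact: norm_cutoff_le.
have hy : inner y (D y) <= e * `|z| ^+ 2.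
  by apply: le_trans (bnd n) _; rewrite ler_wpM2l// ler_pXn2r ?nnegrE.
have CS (u v : L2) : `|inner u v| <= `|u| * `|v|.
  by rewrite !normE_inner; exact: (form_CauchySchwarz fi).
have DC u : `|D u| <= `|C| * `|u|.
  by apply: le_trans (D_norm u) _; rewrite ler_wpM2r// ler_norm.
have -> : inner z (D z) = inner y (D y) + (inner (z - y) (D z) + inner (D y) (z - y)).
  by rewrite (pfBl fi)// (pfBr fi)// (D_sym y z) (pf_sym fi (u := D y))//; ring.
rewrite lerD//; apply: le_trans (ler_norm _) (le_trans (ler_normD _ _) _).
have h1 : `|inner (z - y) (D z)| <= `|z - y| * (`|C| * `|z|).
  by apply: le_trans (CS _ _) _; rewrite ler_wpM2l.
have h2 : `|inner (D y) (z - y)| <= `|z - y| * (`|C| * `|z|).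
  apply: le_trans (CS _ _) _; rewrite mulrC ler_wpM2l//.
  by apply: le_trans (DC _) _; rewrite ler_wpM2l.
have h3 : `|z - y| * K <= d0 by rewrite -ler_pdivlMr// ltW.
apply: le_trans (lerD h1 h2) (le_trans _ h3); rewrite /K mulrDr mulr1.
by have := normr_ge0 (z - y); lra.
Qed.

End SchurBound.

(** * Order properties of resolvents, and the difference of the two resolvents *)

Section Resolvent.
Context (R : realType) (X : ptopologicalType).
Variable m : {measure set (borel X) -> \bar R}.
Context (F : set (L2 m)) (E : L2 m -> L2 m -> R).
Hypothesis hE : regular_symmetric_dirichlet_form F E.
Local Notation L2 := (L2 m).
Local Notation E1 := (energy1 E).
Let f1 := positive_form_E1 hE.
Let fi := positive_form_inner m.
Let sF := subspace_dom hE.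

Lemma norm_inner_CS (u v : L2) : `|inner u v| <= `|u| * `|v|.
Proof. by rewrite !normE_inner; exact: (form_CauchySchwarz fi). Qed.

Definition resolvent_on (D : set L2) (G : L2 -> L2) : Prop :=
  (forall f, D (G f)) /\ forall f v, D v -> E1 (G f) v = inner f v.

Section ResolventOn.
Context (D : set L2) (sD : subspace D) (DF : D `<=` F) (G : L2 -> L2).
Hypothesis hG : resolvent_on D G.
Let GD f : D (G f). Proof. by case: hG. Qed.
Let GE f v : D v -> E1 (G f) v = inner f v. Proof. by case: hG => _; apply. Qed.
Let GF f : F (G f). Proof. exact/DF/GD. Qed.

Lemma resolvent_unique u f : D u -> (forall v, D v -> E1 u v = inner f v) -> u = G f.
Proof.
move=> Du uf; apply/eqP; rewrite -subr_eq0; apply/eqP.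
have Dw : D (u - G f) by exact: subspaceB.
apply: (E1_definite hE); first exact: DF.
by rewrite (pfBl f1) ?uf ?GE ?subrr//; exact: DF.
Qed.

Lemma resolvent_linear : linear G.
Proof.
move=> a u v; apply/esym/resolvent_unique; first exact: sD.2.
move=> w Dw; have Fw := DF Dw.
by rewrite (pf_linear f1)// !GE// (pf_linear fi).
Qed.

Lemma resolvent_sym u v : inner (G u) v = inner u (G v).
Proof. by rewrite (pf_sym fi)// -GE// (pf_sym f1)// GE. Qed.

Lemma resolvent_quad f : inner f (G f) = E1 (G f) (G f).
Proof. by rewrite GE. Qed.

Lemma resolvent_norm f : `|G f| <= `|f|.
Proof.
have [->|G0] := eqVneq (G f) 0; first by rewrite normr0.
have G_gt0 : 0 < `|G f| by rewrite normr_gt0.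
rewrite -(ler_pM2r G_gt0) -expr2 -inner_norm.
apply: (@le_trans _ _ (E1 (G f) (G f))); first by rewrite lerDr (sdf_ge0 (rsdf_semi_dirichlet hE)).
by rewrite -resolvent_quad; apply: le_trans (ler_norm _) (norm_inner_CS _ _).
Qed.

(** Testing the equation of [G f] with its own negative part gives a nonnegative right side and a
    left side at most minus the energy of that part. *)
Lemma resolvent_ge0 (f : L2) : (forall u, D u -> D (L2_neg u)) ->
  {ae m, forall x, 0 <= f x} -> {ae m, forall x, 0 <= G f x}.
Proof.
move=> Dneg f0; apply/L2_neg_eq0; have Dn := Dneg _ (GD f).
apply: (E1_le0 hE); first exact: DF.
have := E1_self_neg hE (GF f); rewrite GE//.
by have := inner_ge0 f0 (L2_neg_ge0 (G f)); lra.
Qed.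

End ResolventOn.

(** Test with v = (u - a)^+. The Markov property makes E u v >= 0, while E u v = <f - u, v> is at
    most -<v, v>, since f <= a and u = a + v where v > 0. *)
Lemma resolvent_le G (f : L2) (a : R) : resolvent_on F G -> 0 <= a ->
  {ae m, forall x, f x <= a} -> {ae m, forall x, G f x <= a}.
Proof.
move=> [GF GE] a0 fa; set u : L2 := G f; have Fu : F u by exact: GF.
have [Ft tu] := sdf_markov (rsdf_semi_dirichlet hE) Fu a0.
pose v : L2 := u - truncation a u; have Fv : F v by exact: subspaceB.
have fE := positive_form_E hE.
have vE : {ae m, forall x, v x = Num.max (u x - a) 0}.
  apply: filterS2 (Lp_sub_ae u (truncation a u)) (truncation_ae u a0) => x -> ->.
  case: (leP (u x) a) => ux; first by rewrite subrr max_r// subr_le0.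
  by rewrite max_l// subr_ge0 ltW.
have h1 : E u v = inner f v - inner u v by rewrite -GE// /energy1 addrK.
have h2 : inner f v - inner u v <= - inner v v.
  rewrite -(pfBl fi)// -(pfNl fi)//; apply: inner_le.
  apply: filterS3 (filterI (Lp_sub_ae f u) (Lp_opp_ae v)) vE fa => x [-> ->] -> fxa.
  case: (leP (u x - a) 0) => ux; first by rewrite !mulr0.
  by apply: ler_wpM2r; [exact: ltW|lra].
have h3 : 0 <= E u v.
  have -> : u = truncation a u + v by rewrite addrC subrK.
  rewrite (pfDl fE)// addr_ge0// (pf_ge0 fE)//.
have v0 : v = 0.
  apply/eqP; rewrite -normr_eq0 -sqrf_eq0 -inner_norm eq_le (pf_ge0 fi)// andbT; lra.
have := vE; rewrite v0 => v0E; apply: filterS2 (Lp_zero_ae m (le1_two R)) v0E => x ->.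
case: (leP (u x - a) 0) => [ux _|ux ux0]; first by rewrite -subr_le0.
by rewrite -ux0 ltxx in ux.
Qed.

Lemma resolvent_dense G r : resolvent_on F G -> F r ->
  forall e : R, 0 < e -> exists f, form_norm E1 (r - G f) < e.
Proof.
move=> hG Fr; have [GF GE] := hG.
have lG := resolvent_linear sF (fun _ => id) hG.
have sG : subspace (range G).
  split; first by exists 0 => //; exact: (lin0 lG).
  by move=> a _ _ [x _ <-] [y _ <-]; exists (a *: x + y) => //; rewrite lG.
have GF' : range G `<=` F by move=> _ [x _ <-].
have [||q [Fq cq qs]] := @form_representation _ _ _ _ f1 (range G) (E1 r) (form_norm E1 r)
   (form_complete_E1 hE) sG GF'.
- by move=> a u v /GF' Fu /GF' Fv; rewrite (pfDr f1)// ?(pfZr f1)//; exact: (subspaceZ sF).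
- by move=> u /GF' Fu; exact: (form_CauchySchwarz f1).
(* The difference is tested on its own resolvent: |r - q|^2 = E1 (G (r - q)) (r - q), which is 0 as
   [q] represents [E1 r] on the range. *)
have -> : r = q.
  apply/eqP; rewrite -subr_eq0 -normr_eq0 -sqrf_eq0 -inner_norm; apply/eqP.
  have Frq := subspaceB sF Fr Fq.
  rewrite -GE// (pf_sym f1)// (pfBl f1)// qs ?subrr//.
by move=> e /cq[_ [f _ <-] qf]; exists f.
Qed.

(** L^2 convergence with bounded energy is weak convergence in the energy space, and closed
    subspaces are weakly closed. Weak convergence is tested on the dense range of [G], where
    [E1 (G f)] is just [inner f]. *)
Lemma weakly_closed D G v (C : R) : resolvent_on F G -> subspace D -> D `<=` F ->
  (forall u, F u -> form_closure E1 D u -> D u) -> F v ->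
  (forall e : R, 0 < e -> exists w, [/\ D w, form_norm E1 w <= C & `|v - w| < e]) ->
  D v.
Proof.
move=> hG sD DF cD Fv vw; have [GF GE] := hG.
have [||p [Fp cp ps]] := @form_representation _ _ _ _ f1 D (E1 v) (form_norm E1 v)
   (form_complete_E1 hE) sD DF.
- move=> a s t /DF Fs /DF Ft.
  by rewrite (pfDr f1)// ?(pfZr f1)//; exact: (subspaceZ sF).
- by move=> u /DF Fu; exact: (form_CauchySchwarz f1).
have Dp : D p by exact: cD.
suff -> : v = p by [].
apply/eqP; rewrite -subr_eq0; apply/eqP; set r := v - p.
have Fr : F r by exact: subspaceB.
have rD s : D s -> E1 r s = 0 by move=> Ds; rewrite (pfBl f1) ?ps ?subrr//; exact: DF.
have C0 : 0 <= C.
  by have [//|w [_ wC _]] := vw 1; apply: le_trans wC; exact: form_norm_ge0.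
apply: (E1_le0 hE) => //; apply/ler_addgt0Pr => e e0; rewrite add0r.
pose K := form_norm E1 v + C + 1.
have K0 : 0 < K by rewrite ltr_wpDl// addr_ge0// form_norm_ge0.
have [|f rf] := resolvent_dense hG Fr (e := e / 2 / K); first by rewrite !divr_gt0.
have L0 : 0 < `|f| + 1 by rewrite ltr_wpDl.
have [|w [Dw wC vwe]] := vw (e / 2 / (`|f| + 1)); first by rewrite !divr_gt0.
have Fw := DF _ Dw; have Fvw := subspaceB sF Fv Fw; have FGf := GF f.
have FrG := subspaceB sF Fr FGf.
have -> : E1 r r = E1 (r - G f) (v - w) + inner f (v - w).
  rewrite (pfBl f1 Fr FGf Fvw) (GE _ _ Fvw) subrK {2}/r (pfBr f1 Fv Fp Fr).
  by rewrite (pfBr f1 Fv Fw Fr) (rD p)// (rD w).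
have h1 := form_CauchySchwarz f1 FrG Fvw.
have h2 := norm_inner_CS f (v - w).
have h3 : form_norm E1 (v - w) <= K.
  apply: le_trans (form_normD f1 Fv (subspaceN sF Fw)) _.
  by rewrite (form_normN f1)// /K -addrA lerD2l ler_wpDr.
have h4 : `|E1 (r - G f) (v - w)| <= e / 2.
  apply: le_trans h1 _; apply: (@le_trans _ _ (e / 2 / K * K)); last by rewrite divfK// gt_eqF.
  by rewrite ler_pM ?form_norm_ge0// ltW.
have h5 : `|inner f (v - w)| <= e / 2.
  apply: le_trans h2 _; apply: (@le_trans _ _ ((`|f| + 1) * (e / 2 / (`|f| + 1)))).
    by rewrite ler_pM// ?lerDl// ltW.
  by rewrite mulrC divfK// gt_eqF.
have := ler_norm (E1 (r - G f) (v - w)); have := ler_norm (inner f (v - w)); lra.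
Qed.

Section Difference.
Context (G GU : L2 -> L2) (DU : set L2).
Hypothesis hG : resolvent_on F G.
Context (sDU : subspace DU) (DUF : DU `<=` F).
Hypothesis hGU : resolvent_on DU GU.
Hypothesis DU_neg : forall u, DU u -> DU (L2_neg u).
Hypothesis DU_ideal : forall v w : L2, F v -> DU w -> {ae m, forall x, 0 <= v x <= w x} -> DU v.
Let FF : F `<=` F. Proof. by []. Qed.

Definition resolvent_diff (f : L2) : L2 := G f - GU f.
Let D := resolvent_diff.
Let lG := resolvent_linear sF FF hG.
Let lGU := resolvent_linear sDU DUF hGU.
Let FG f : F (G f). Proof. by case: hG. Qed.
Let FGU f : F (GU f). Proof. by apply: DUF; case: hGU. Qed.
Let FD f : F (D f). Proof. by apply: subspaceB. Qed.

Lemma diff_linear : linear D.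
Proof.
move=> a u v; rewrite /D /resolvent_diff lG lGU scalerBr opprD.
by rewrite addrACA.
Qed.

Lemma diff_sym u v : inner (D u) v = inner u (D v).
Proof.
by rewrite /D /resolvent_diff (pfBl fi)// (pfBr fi)// (resolvent_sym DUF hGU)
  (resolvent_sym FF hG).
Qed.

(** So [D f] is the energy projection of [G f] onto the complement of [DU]: a solution of (H + 1) u
    = 0 on the open set, in the weak sense. *)
Lemma diff_harmonic f v : DU v -> E1 (D f) v = 0.
Proof.
move=> DUv; have Fv := DUF DUv; rewrite (pfBl f1)//.
by case: hG => _ ->//; case: hGU => _ ->//; rewrite subrr.
Qed.

Lemma diff_quad f : inner f (D f) = E1 (D f) (D f).
Proof.
rewrite {3}/D /resolvent_diff (pfBr f1)// (diff_harmonic f (proj1 hGU f)) subr0.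
by rewrite (pf_sym f1)//; case: hG => _ ->.
Qed.

Lemma diff_quad_ge f : `|D f| ^+ 2 <= inner f (D f).
Proof.
by rewrite diff_quad -inner_norm lerDr (sdf_ge0 (rsdf_semi_dirichlet hE)).
Qed.

Lemma diff_quad_le f : inner f (D f) <= inner f (G f).
Proof.
rewrite /D /resolvent_diff (pfBr fi)// gerBl (resolvent_quad hGU).
exact: (pf_ge0 f1).
Qed.

Lemma diff_norm f : `|D f| <= 2 * `|f|.
Proof.
apply: le_trans (ler_normB _ _) _.
have := resolvent_norm FF hG f; have := resolvent_norm DUF hGU f; lra.
Qed.

(** The negative part of G f - GU f lies below [GU f], hence in [DU] by the ideal property, where it
    is orthogonal to [D f]. *)
Lemma diff_ge0 (f : L2) : {ae m, forall x, 0 <= f x} -> {ae m, forall x, 0 <= D f x}.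
Proof.
move=> f0; have hG0 := resolvent_ge0 FF hG (fun u => @dom_neg _ _ _ _ _ hE u) f0.
have hGU0 := resolvent_ge0 DUF hGU DU_neg f0.
apply/L2_neg_eq0; have Fn := dom_neg hE (FD f).
have DUn : DU (L2_neg (D f)).
  apply: (DU_ideal Fn (proj1 hGU f)).
  apply: filterS3 (filterI (L2_neg_ae (D f)) (Lp_sub_ae (G f) (GU f))) hG0 hGU0.
  move=> x [-> ->] h1 h2; rewrite le_max lexx orbT/= ge_max h2 andbT.
  by rewrite opprB gerBl.
apply: (E1_le0 hE) => //; have := E1_self_neg hE (FD f).
by rewrite diff_harmonic//; lra.
Qed.

Context (O : set (borel X)) (w g : L2).
Hypothesis DU_local : forall v : L2, F v -> {ae m, forall x, 0 <= v x <= 1} ->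
  {ae m, forall x, O x -> v x = 0} -> DU v.
Hypothesis w_ge0 : {ae m, forall x, 0 <= w x}.
Hypothesis gE : g = G w.
Hypothesis g_ge1 : {ae m, forall x, O x -> 1 <= g x}.

(** A maximum principle. On [O] one has D f <= G f <= 1 <= g, so (D f - g)^+ vanishes there and
    belongs to [DU]; testing with it leaves only -<w, (D f - g)^+>, which is nonpositive. *)
Lemma diff_le (f : L2) : {ae m, forall x, 0 <= f x <= 1} -> {ae m, forall x, D f x <= g x}.
Proof.
move=> f01.
have f_ge0 : {ae m, forall x, 0 <= f x} by apply: filterS f01 => x /andP[].
have f_le1 : {ae m, forall x, f x <= 1} by apply: filterS f01 => x /andP[].
have Gf1 := resolvent_le hG ler01 f_le1.
have GU0 := resolvent_ge0 DUF hGU DU_neg f_ge0.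
have g0 : {ae m, forall x, 0 <= g x}.
  by rewrite gE; exact: (resolvent_ge0 FF hG (fun u => @dom_neg _ _ _ _ _ hE u)).
have Fg : F g by rewrite gE.
pose u : L2 := D f - g; have Fu : F u by exact: subspaceB.
have Fp := dom_pos hE Fu.
have uE : {ae m, forall x, u x = G f x - GU f x - g x}.
  by apply: filterS2 (Lp_sub_ae (D f) g) (Lp_sub_ae (G f) (GU f)) => x -> ->.
have DUp : DU (L2_pos u).
  apply: DU_local => //.
    apply: filterS3 (filterI (L2_pos_ae u) uE) (filterI g0 Gf1) GU0 => x [-> ->] [h1 h2] h3.
    by rewrite le_max lexx orbT/= ge_max ler01 andbT; lra.
  apply: filterS3 (filterI (L2_pos_ae u) uE) (filterI g_ge1 Gf1) GU0 => x [-> ->] [h1 h2] h3.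
  by move=> /h1 h1'; rewrite max_r//; lra.
have Fpos := DUF DUp.
have pos0 : L2_pos u = 0.
  apply: (E1_le0 hE) => //; apply: le_trans (E1_self_pos hE Fu) _.
  rewrite (pfBl f1)// diff_harmonic// sub0r oppr_le0 gE.
  rewrite (proj2 hG)//; apply: inner_ge0; [exact: w_ge0|exact: L2_pos_ge0].
have := L2_pos_ae u; rewrite pos0 => h.
apply: filterS3 h (Lp_zero_ae m (le1_two R)) (Lp_sub_ae (D f) g) => x h1 h2 h3.
rewrite h2 -/u h3 in h1; rewrite -subr_le0 leNgt; apply/negP => h4.
by rewrite max_l ?ltW// in h1; rewrite -h1 ltxx in h4.
Qed.

Hypothesis g_small : forall e : R, 0 < e -> exists2 K : set (borel X), measurable K &
  {ae m, forall x, ~ K x -> g x <= e} /\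
  compact_along_ultra (@inner _ _ R m) (fun x => cutoff K (G (cutoff K x))).

Lemma diff_compact : compact_along_ultra (@inner _ _ R m) D.
Proof.
move=> I U f UU [M fM] e e0.
pose M' := `|M| + 1; have M0 : 0 < M' by rewrite ltr_wpDl.
have {}fM : U [set i | `|f i| <= M'].
  apply: filterS fM => i /=; rewrite -normE_inner => h; apply: le_trans h _.
  by rewrite (le_trans (ler_norm M))// lerDl.
(* For [|z| <= 2 * M'] the two pieces satisfy |D z2|^2 <= eta (2 M')^2 and |D z1|^2 < 2 M' d; [eta]
   and [d] make both smaller than (e/2)^2. *)
pose eta := (e / 2) ^+ 2 / (2 * M') ^+ 2 / 2.
have eta0 : 0 < eta by rewrite !divr_gt0// ?exprn_gt0// ?divr_gt0// mulr_gt0.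
have [K mK [gK cK]] := g_small eta0.
pose d := (e / 2) ^+ 2 / (2 * M').
have d0 : 0 < d by rewrite divr_gt0 ?exprn_gt0// ?divr_gt0// mulr_gt0.
have fM1 : exists M1, U [set i | form_norm (@inner _ _ R m) (f i) <= M1].
  by exists M'; apply: filterS fM => i /=; rewrite -normE_inner.
have [S US hS] := cK I U f UU fM1 _ d0.
exists (S `&` [set i | `|f i| <= M']); first exact: filterI.
move=> x y [Sx /= xM] [Sy /= yM]; rewrite -normE_inner.
pose z := f x - f y.
have lB (L : L2 -> L2) : linear L -> L (f x) - L (f y) = L z.
  by move=> lL; rewrite /z (linB lL).
have lc := @cutoff_linear _ _ _ m _ mK.
have zM : `|z| <= 2 * M'.
  apply: le_trans (ler_normB _ _) _; lra.
rewrite (lB _ diff_linear) (cutoffD z mK).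
set z1 := cutoff K z; set z2 := cutoff (~` K) z.
have DzE : D (z1 + z2) = D z1 + D z2.
  by have := diff_linear 1 z1 z2; rewrite !scale1r.
rewrite DzE; apply: le_lt_trans (ler_normD _ _) _; rewrite [e]splitr.
have e2 : 0 < e / 2 by rewrite divr_gt0.
have M2 : 0 < 2 * M' by rewrite mulr_gt0.
rewrite ltrD//.
  rewrite -(@ltr_pXn2r _ 2)// ?nnegrE ?(ltW e2)//.
  apply: le_lt_trans (diff_quad_ge z1) _; apply: le_lt_trans (diff_quad_le z1) _.
  rewrite {1}/z1 inner_cutoff//; apply: le_lt_trans (ler_norm _) _.
  apply: le_lt_trans (norm_inner_CS _ _) _.
  have := hS _ _ Sx Sy; rewrite -normE_inner /=.
  have -> : cutoff K (G (cutoff K (f x))) - cutoff K (G (cutoff K (f y))) = cutoff K (G z1).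
    by rewrite -(linB lc) -(linB lG) -(linB lc).
  rewrite /d ltr_pdivlMr// => h; apply: le_lt_trans h.
  by rewrite mulrC ler_wpM2l.
rewrite -(@ltr_pXn2r _ 2)// ?nnegrE ?(ltW e2)//.
apply: le_lt_trans (diff_quad_ge z2) _.
have mK' := measurableC mK.
have z2g : {ae m, forall x, z2 x != 0 -> g x <= eta}.
  apply: filterS2 (cutoff_ae z mK') gK => t -> gt; rewrite indicE in_setC.
  have [|tK _] := boolP (t \in K); first by rewrite mul0r eqxx.
  by apply: gt => Kt; rewrite mem_set in tK.
apply: le_lt_trans (schur_bound diff_linear diff_sym diff_ge0 diff_norm diff_le (ltW eta0) z2g) _.
apply: (@le_lt_trans _ _ (eta * (2 * M') ^+ 2)).
  rewrite ler_wpM2l ?(ltW eta0)// ler_pXn2r ?nnegrE ?(ltW M2)//.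
  exact: le_trans (norm_cutoff_le _ mK') zM.
rewrite /eta mulrAC divfK ?gt_eqF ?exprn_gt0//.
by rewrite ltr_pdivrMr// ltr_pMr ?exprn_gt0// ltr1n.
Qed.

End Difference.
End Resolvent.

(** * The part of a form on an open set *)

Section CompactlySupported.
Context (R : realType) (X : topologicalType).
Implicit Types (U K O : set X) (f g h : X -> R).

Lemma Cc_dominated U f g h : Cc U f -> Cc U g -> continuous h ->
  (forall x, f x = 0 -> g x = 0 -> h x = 0) -> Cc U h.
Proof.
move=> [cf kf sf] [cg kg sg] ch fgh.
have hfg : closure [set x | h x != 0] `<=`
    closure [set x | f x != 0] `|` closure [set x | g x != 0].
  rewrite -closureU; apply: closureS => x /= hx.
  have [f0|] := eqVneq (f x) 0; last by left.
  have [g0|] := eqVneq (g x) 0; last by right.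
  by rewrite fgh ?eqxx in hx.
split => //.
  apply: subclosed_compact hfg; first exact: closed_closure.
  exact: compactU.
by move=> x /hfg[/sf|/sg].
Qed.

Lemma Cc_lin U a f g : Cc U f -> Cc U g -> Cc U (fun x => a * f x + g x).
Proof.
move=> Cf Cg; apply: (Cc_dominated Cf Cg) => [x|x -> ->]; last by rewrite mulr0 addr0.
by case: Cf => cf _ _; case: Cg => cg _ _; apply: cvgD; [apply: cvgMr; exact: cf|exact: cg].
Qed.

Lemma Cc0 U : Cc U (fun=> 0 : R).
Proof.
have -> : Cc U (fun=> 0 : R) = Cc U (cst 0 : X -> R) by [].
split; first by move=> x; exact: cvg_cst.
  by rewrite (_ : [set x | _] = set0) ?closure0; [exact: compact0|
    apply/seteqP; split => x //=; rewrite eqxx].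
by rewrite (_ : [set x | _] = set0) ?closure0//; apply/seteqP; split => x //=; rewrite eqxx.
Qed.

Lemma Cc_bounded U f : Cc U f -> exists2 M : R, 0 < M & forall x, `|f x| <= M.
Proof.
move=> [cf kf _].
have /compact_bounded[M [_ hM]] : compact (f @` closure [set x | f x != 0]).
  by apply: continuous_compact => //; exact: continuous_subspaceT.
have M1 : M < `|M| + 1 by rewrite (le_lt_trans (ler_norm M))// ltrDl.
exists (`|M| + 1) => [|x]; first by rewrite ltr_wpDl.
have [->|fx] := eqVneq (f x) 0; first by rewrite normr0 addr_ge0.
by apply: hM M1 _ _; exists x => //; apply: subset_closure.
Qed.

Lemma CcW U V f : U `<=` V -> Cc U f -> Cc V f.
Proof. by move=> UV [cf kf sf]; split => // x /sf/UV. Qed.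

End CompactlySupported.

Section Metrizable.
Context (R : realType) (X : ptopologicalType).
Hypothesis X_locally_compact : locally_compact [set: X].
Hypothesis X_metrizable : metrizable R X.

Lemma metrizable_hausdorff : hausdorff_space X.
Proof.
have [dist [d0 deq dsym dtri dn]] := X_metrizable.
move=> p q pq; apply: contrapT => npq.
have d_gt0 : 0 < dist p q.
  by rewrite lt_def d0 andbT; apply/eqP => /deq.
have e0 : 0 < dist p q / 2 by rewrite divr_gt0.
have [||x [/= px qx]] := pq [set x | dist p x < dist p q / 2] [set x | dist q x < dist p q / 2].
- by apply/dn; exists (dist p q / 2).
- by apply/dn; exists (dist p q / 2).
by have := dtri p x q; rewrite (dsym x q); lra.
Qed.

(* A compactly supported function exceeding 2 near [x] is a multiple of
   [max 0 (1 - dist x y / e)]; finitely many of them are summed. *)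
Lemma compact_bump (K O : set X) : compact K -> open O -> K `<=` O ->
  exists f : X -> R, [/\ Cc O f, forall x, 0 <= f x & forall x, K x -> 3 <= f x].
Proof.
move=> cK oO KO; have [dist [d0 deq dsym dtri dn]] := X_metrizable.
have dxx x : dist x x = 0 by apply/deq.
have cd x : continuous (dist x).
  move=> y; apply/cvgrPdist_lt => e e0.
  suff : nbhs y [set z | dist y z < e].
    apply: filterS => z /= yz; rewrite ltr_norml.
    by have := dtri x y z; have := dtri x z y; rewrite (dsym z y); lra.
  by apply/dn; exists e.
have step x : O x -> exists f : X -> R, [/\ Cc O f, forall x, 0 <= f x & 3 < f x].
  move=> Ox; have [B nB [cB clB]] := X_locally_compact (I : setT x).
  have nB' : nbhs x B by apply: (filterS _ (nB : nbhs x [set y | setT y -> B y])) => y /= /(_ I).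
  have : nbhs x (B `&` O) by apply: filterI => //; exact: open_nbhs_nbhs.
  move=> /dn[e e0 eB].
  (* Radius e/2 keeps the closed support inside the ball of radius [e]; the peak 6 exceeds the
     threshold 3. *)
  pose f y := 6 * Num.max 0 (1 - dist x y / (e / 2)).
  have e2 : 0 < e / 2 by rewrite divr_gt0.
  have cf : continuous f.
    move=> y; apply: cvgMr; apply: (@continuous_max R X (cst 0)); first exact: cvg_cst.
    by apply: cvgB; [exact: cvg_cst|apply: cvgMl; exact: cd].
  have sf : closure [set y | f y != 0] `<=` [set y | dist x y <= e / 2].
    have cl : closed [set y | dist x y <= e / 2].
      exact: (closed_comp (fun y _ => cd x y) (@closed_le _ (e / 2))).
    rewrite [X in _ `<=` X](closure_id _).1//; apply: closureS => y /=.
    rewrite /f; apply: contra_neqT; rewrite -ltNge => xy.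
    rewrite max_l ?mulr0// subr_le0 ler_pdivlMr// mul1r; exact: ltW.
  have sB : [set y | dist x y <= e / 2] `<=` B `&` O.
    by move=> y /= xy; apply: eB => /=; lra.
  exists f; split.
  - split => //.
      by apply: (subclosed_compact _ cB); [exact: closed_closure|move=> y /sf/sB[]].
    by move=> y /sf/sB[].
  - by move=> y; rewrite mulr_ge0// le_max lexx.
  - by rewrite /f dxx mul0r subr0 max_r// mulr1 ltr_nat.
have /choice[F hF] x : exists f : X -> R, O x -> [/\ Cc O f, forall x, 0 <= f x & 3 < f x].
  have [Ox|nOx] := pselect (O x); last by exists (fun=> 0).
  by have [f hf] := step x Ox; exists f.
move: cK; rewrite compact_cover => /(_ X K (fun x => [set y | O x /\ 3 < F x y])).
case.
- move=> x Kx; have Ox := KO _ Kx; have [[cF _ _] _ _] := hF x Ox.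
  rewrite (_ : [set y | _] = F x @^-1` [set r | 3 < r]).
    by apply: open_comp => //; exact: open_gt.
  by apply/seteqP; split => y //= -[].
- move=> x Kx; exists x => //=; have Ox := KO _ Kx; split => //.
  by case: (hF x Ox).
move=> s sK Ks.
have hs x : x \in finmap.enum_fset s -> O x.
  by move=> xs; apply/KO/set_mem/sK.
pose f y := \sum_(x <- finmap.enum_fset s) F x y.
have gen (l : seq X) : (forall x, x \in l -> O x) ->
    Cc O (fun y => \sum_(x <- l) F x y) /\ forall y, 0 <= \sum_(x <- l) F x y.
  elim: l => [_|x l IH hl].
    split; last by move=> y; rewrite big_nil.
    by rewrite (_ : (fun _ => _) = fun=> 0); [exact: Cc0|apply/funext => y; rewrite big_nil].
  have [|Cl l0] := IH; first by move=> y yl; apply: hl; rewrite inE yl orbT.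
  have [Cx x0 _] := hF x (hl _ (mem_head _ _)).
  split; last by move=> y; rewrite big_cons addr_ge0.
  rewrite (_ : (fun _ => _) = fun y => 1 * F x y + \sum_(x <- l) F x y).
    exact: Cc_lin.
  by apply/funext => y; rewrite big_cons mul1r.
have [Cf f0] := gen _ hs.
exists f; split => // y Ky; have [x /= xs [Ox xy]] := Ks y Ky.
apply: le_trans (ltW xy) _; rewrite /f (big_rem x)//= lerDl.
rewrite big_seq sumr_ge0// => z /mem_rem zs; have Oz := hs z zs.
by case: (hF z Oz).
Qed.

End Metrizable.

Lemma subBB (V : zmodType) (a b c : V) : (a - b) - (a - c) = c - b.
Proof. by rewrite opprB addrC addrA subrK. Qed.

(** * The domain of the part as an order ideal of the form domain *)

Section FormPart.
Context (R : realType) (X : ptopologicalType).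
Hypothesis X_locally_compact : locally_compact [set: X].
Hypothesis X_metrizable : metrizable R X.
Variable m : {measure set (borel X) -> \bar R}.
Context (F : set (L2 m)) (E : L2 m -> L2 m -> R).
Hypothesis hE : regular_symmetric_dirichlet_form F E.
Local Notation L2 := (L2 m).
Local Notation E1 := (energy1 E).
Let f1 := positive_form_E1 hE.
Let fi := positive_form_inner m.
Let sF := subspace_dom hE.

Context (U : set X) (U_open : open U) (U_cocompact : compact (~` U)).

Lemma subspace_core V : subspace (form_core V F).
Proof.
split.
  split; first exact: (subspace0 sF).
  by exists (fun=> 0); [exact: Cc0|apply/ae_setT; exact: Lp_zero_ae].
move=> a u v [Fu [f Cf /ae_setT uf]] [Fv [g Cg /ae_setT vg]]; split; first exact: sF.2.
exists (fun x => a * f x + g x); first exact: Cc_lin.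
apply/ae_setT; apply: filterS3 (filterI (Lp_add_ae (a *: u) v) (Lp_scale_ae a u)) uf vg.
by move=> x [-> ->] -> ->.
Qed.

Lemma sub_core_dom V : form_core V F `<=` F. Proof. by move=> u []. Qed.

Lemma form_partE V : form_part V F E = form_hull F E (form_core V F).
Proof.
apply/seteqP; split => u [Fu h]; split => // e /h[v cv uv]; exists v => //.
  by rewrite -(energy_normE E).
by rewrite (energy_normE E).
Qed.

Let DU := form_hull F E (form_core U F).
Let sDU : subspace DU := subspace_hull hE (@subspace_core U) (@sub_core_dom U).
Let DUF : DU `<=` F. Proof. by move=> u []. Qed.

(** Lattice operations applied to core approximants are seen to converge in L^2 only, while their
    energies stay bounded; this is the closedness suited to them. *)
Lemma part_closed_bounded v (C : R) : F v ->
  (forall e : R, 0 < e -> exists w, [/\ DU w, form_norm E1 w <= C & `|v - w| < e]) ->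
  DU v.
Proof.
have [G hG] := exists_resolvent hE sF (fun _ => id).
have hG' : resolvent_on E F G.
  by case: hG => G1 G2; split => [f|f u Fu]; [case: (G1 f)|apply: G2; exact: sub_hull].
apply: (weakly_closed hE hG' sDU DUF) => u Fu cu.
exact: (closed_hull hE (@sub_core_dom U)).
Qed.

Lemma part_neg u : DU u -> DU (L2_neg u).
Proof.
move=> [Fu cu]; apply: (@part_closed_bounded _ (form_norm E1 u + 1)); first exact: (dom_neg hE).
move=> e e0; have [|w [Fw [f Cf wf]] uw] := cu (Num.min 1 e); first by rewrite lt_min ltr01.
move: uw; rewrite lt_min => /andP[uw1 uwe]; exists (L2_neg w); split.
- apply: (sub_hull hE (@sub_core_dom U)); split; first exact: (dom_neg hE).
  exists (fun x => Num.max (- f x) 0).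
    apply: (Cc_dominated Cf Cf) => [x|x -> _]; last by rewrite oppr0 maxxx.
    case: Cf => cf _ _; apply: (@continuous_max R X _ (cst 0)); last exact: cvg_cst.
    by apply: cvgN; exact: cf.
  by apply/ae_setT; move/ae_setT: wf; apply: filterS2 (L2_neg_ae w) => x -> ->.
- apply: (@le_trans _ _ (form_norm E1 w)).
    by rewrite /form_norm ler_wsqrtr// (E1_neg_le hE).
  have -> : w = u - (u - w) by rewrite opprB addrC subrK.
  apply: le_trans (form_normD f1 Fu (subspaceN sF (subspaceB sF Fu Fw))) _.
  by rewrite (form_normN f1) ?lerD2l ?ltW//; exact: subspaceB.
- apply: le_lt_trans (norm_negB u w) _; apply: le_lt_trans uwe.
  by apply: (norm_le_E1 hE); exact: subspaceB.
Qed.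

(** Regularity gives an element of the form domain only within 1/2 of a bump [f], with no control of
    its support. Removing min(g, 1/2) kills it wherever [f] is 0 and still leaves 3 - 1/2 - 1/2 = 2
    on [K]. *)
Lemma exists_cutoff (K O : set X) : compact K -> open O -> K `<=` O ->
  exists c : L2, exists chi : X -> R,
    [/\ F c, {ae m, forall x, c x = chi x}, Cc setT chi,
        (forall x, 0 <= chi x) /\ (forall x, ~ O x -> chi x = 0) &
        forall x, K x -> 2 <= chi x].
Proof.
move=> cK oO KO.
have [f [Cf f0 fK]] := compact_bump X_locally_compact X_metrizable cK oO KO.
have half : 0 < 2^-1 :> R by [].
have [g [Cg [u Fu /ae_setT ug] fg]] :=
  regular_uniform (rsdf_regular hE) (CcW (@subsetT _ O) Cf) half.
have Ft := dom_truncation hE (ltW half) Fu.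
exists (u - truncation 2^-1 u), (fun x => g x - Num.min (g x) 2^-1); split.
- exact: subspaceB.
- apply: filterS3 (Lp_sub_ae u (truncation 2^-1 u)) (truncation_ae u (ltW half)) ug.
  by move=> x -> -> ->.
- apply: (Cc_dominated Cg Cg) => [x|x -> _]; last first.
    by rewrite min_l ?subrr// ltW.
  case: Cg => cg _ _; apply: cvgB; first exact: cg.
  by apply: (@continuous_min R X _ (cst 2^-1)); [exact: cg|exact: cvg_cst].
- split => x; first by rewrite subr_ge0 ge_min lexx.
  move=> nOx; have fx0 : f x = 0.
    apply: contrapT => /eqP fx; apply: nOx; case: Cf => _ _; apply.
    exact: subset_closure.
  have := fg x; rewrite fx0 sub0r normrN => h; rewrite min_l ?subrr//.
  by rewrite (le_trans (ler_norm _))// ltW.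
- move=> x /fK fx; have := fg x; rewrite ltr_norml => /andP[h1 h2].
  by case: (leP (g x) 2^-1) => h3; lra.
Qed.

(* If [chi >= 2] on the complement of [U] and [chi] vanishes off [O], then
   [max 0 (min phi a - a chi)] is supported in [U], and for [phi] close to [v]
   it is close to [v] in L^2. *)
Lemma part_local (O : set (borel X)) (v : L2) (a : R) : open (O : set X) -> ~` U `<=` O ->
  0 < a -> F v -> {ae m, forall x, 0 <= v x <= a} ->
  {ae m, forall x, O x -> v x = 0} -> DU v.
Proof.
move=> oO UO a0 Fv v01 vO.
have [c [chi [Fc cchi Cchi [chi0 chiO] chiU]]] := exists_cutoff U_cocompact oO UO.
have Fac := subspaceZ sF a Fc.
pose h (u : L2) : L2 := L2_pos (truncation a u - a *: c).
have Ft u : F u -> F (truncation a u) by exact: (dom_truncation hE (ltW a0)).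
have Fh u : F u -> F (h u) by move=> Fu; apply: (dom_pos hE); apply: subspaceB => //; exact: Ft.
have hae u : {ae m, forall x, h u x = Num.max (Num.min (u x) a - a * chi x) 0}.
  apply: filterS3 (filterI (L2_pos_ae (truncation a u - a *: c)) cchi)
    (filterI (Lp_sub_ae (truncation a u) (a *: c)) (Lp_scale_ae a c))
    (truncation_ae u (ltW a0)) => x [-> cx] [-> ->] ->.
  by rewrite cx.
(* [v] vanishes on [O], [chi] vanishes off [O], and [v] is already between 0 and [a]. *)
have hv : h v = v.
  apply: Lp_ext; apply: filterS3 (hae v) v01 vO => x -> /andP[h1 h2] h3.
  rewrite min_l//; have [Ox|nOx] := pselect (O x).
    by rewrite h3// sub0r max_r// oppr_le0 mulr_ge0 ?(ltW a0).
  by rewrite chiO// mulr0 subr0 max_l.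
apply: (@part_closed_bounded _ (form_norm E1 v + 1 + form_norm E1 (a *: c))) => //.
move=> e e0.
have [|w [Fw [f Cf wf]] uw] := regular_energy (rsdf_regular hE) Fv (e := Num.min 1 e).
  by rewrite lt_min ltr01.
move: uw; rewrite (energy_normE E) lt_min => /andP[vw1 vwe]; exists (h w).
have Fvw := subspaceB sF Fv Fw.
split.
- apply: (sub_hull hE (@sub_core_dom U)); split; first exact: Fh.
  pose hf x := Num.max (Num.min (f x) a - a * chi x) 0.
  have chf : continuous hf.
    case: Cf => cf _ _; case: Cchi => cchi' _ _ x.
    apply: (@continuous_max R X _ (cst 0)); last exact: cvg_cst.
    apply: cvgB; last by apply: cvgMr; exact: cchi'.
    by apply: (@continuous_min R X _ (cst a)); [exact: cf|exact: cvg_cst].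
  have [_ khf _] : Cc setT hf.
    apply: (Cc_dominated Cf Cf) => // x fx _.
    by rewrite /hf fx min_l ?(ltW a0)// sub0r max_r// oppr_le0 mulr_ge0 ?(ltW a0).
  exists hf; last first.
    by apply/ae_setT; move/ae_setT: wf; apply: filterS2 (hae w) => x -> ->.
  split => //.
  (* The gap between [chi <= 1] on the closed support and [chi >= 2] off [U] keeps the support
     inside [U]. *)
  have cl : closed [set x | chi x <= 1].
    by case: Cchi => cchi' _ _; apply: (closed_comp (fun x _ => cchi' x) (@closed_le _ 1)).
  have : closure [set x | hf x != 0] `<=` [set x | chi x <= 1].
    rewrite [X in _ `<=` X](closure_id _).1//; apply: closureS => x /=.
    apply: contra_neqT; rewrite -ltNge => cx; rewrite /hf max_r// subr_le0.
    rewrite ge_min; apply/orP; right.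
    by rewrite ler_peMr ?(ltW a0)// ltW.
  move=> hsub x /hsub /= cx; apply: contrapT => nUx; have := chiU x nUx; lra.
- apply: (@le_trans _ _ (form_norm E1 (truncation a w - a *: c))).
    by rewrite /form_norm ler_wsqrtr// (E1_pos_le hE)//; apply: subspaceB => //; exact: Ft.
  apply: le_trans (form_normD f1 (Ft _ Fw) (subspaceN sF Fac)) _.
  rewrite (form_normN f1)// lerD2r; apply: (@le_trans _ _ (form_norm E1 w)).
    by rewrite /form_norm ler_wsqrtr// (E1_truncation_le hE)// ltW.
  have -> : w = v - (v - w) by rewrite opprB addrC subrK.
  apply: le_trans (form_normD f1 Fv (subspaceN sF Fvw)) _.
  by rewrite (form_normN f1) ?lerD2l ?ltW.
- rewrite -{1}hv; apply: le_lt_trans (norm_posB _ _) _.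
  rewrite opprB addrA subrK; apply: le_lt_trans (norm_truncationB _ _ (ltW a0)) _.
  by apply: le_lt_trans vwe; exact: (norm_le_E1 hE).
Qed.

(** [h u] is min(v, u^+) written with positive parts, which the form controls. For [u] in the core
    it need not have a continuous version, but it is bounded and vanishes off the support of [u], so
    [part_local] applies with the complement of that support as [O]. *)
Lemma part_ideal (v w : L2) : F v -> DU w -> {ae m, forall x, 0 <= v x <= w x} -> DU v.
Proof.
move=> Fv [Fw cw] vw.
have w_pos : L2_pos w = w.
  apply: Lp_ext; apply: filterS2 (L2_pos_ae w) vw => x -> /andP[h1 h2].
  by rewrite max_l// (le_trans h1).
pose h (u : L2) : L2 := v - L2_pos (v - L2_pos u).
have Fp u : F u -> F (L2_pos u) by exact: (dom_pos hE).
have Fvp u : F u -> F (v - L2_pos u) by move=> Fu; apply: subspaceB => //; exact: Fp.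
have Fh u : F u -> F (h u) by move=> Fu; apply: subspaceB => //; apply: (dom_pos hE); exact: Fvp.
have hae u : {ae m, forall x, h u x = v x - Num.max (v x - Num.max (u x) 0) 0}.
  apply: filterS3 (filterI (Lp_sub_ae v (L2_pos (v - L2_pos u))) (L2_pos_ae (v - L2_pos u)))
    (Lp_sub_ae v (L2_pos u)) (L2_pos_ae u) => x [-> ->] -> ->.
  by [].
have hw : h w = v.
  apply: Lp_ext; apply: filterS2 (hae w) vw => x -> /andP[h1 h2].
  rewrite (max_l (le_trans h1 h2)) max_r ?subr0// subr_le0//.
apply: (@part_closed_bounded _ (2 * form_norm E1 v + form_norm E1 w + 1)) => //.
move=> e e0; have [|u [Fu [f Cf uf]] wu] := cw (Num.min 1 e); first by rewrite lt_min ltr01.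
move: wu; rewrite lt_min => /andP[wu1 wue]; exists (h u).
have Fwu := subspaceB sF Fw Fu.
split.
- have [M M0 fM] := Cc_bounded Cf.
  have [cf kf sf] := Cf.
  pose O : set X := ~` closure [set x | f x != 0].
  apply: (@part_local O _ M) => //.
  + by apply: closed_openC; exact: closed_closure.
  + by move=> x nUx /sf.
  + exact: Fh.
  + move/ae_setT: uf => uf; apply: filterS3 (hae u) vw uf => x -> /andP[h1 h2] ->.
    have := ler_norm (f x); have := fM x.
    case: (leP (f x) 0) => h3; case: (leP _ 0) => h4 h5 h6; apply/andP; split; lra.
  + move/ae_setT: uf => uf; apply: filterS3 (hae u) vw uf => x -> /andP[h1 h2] -> Ox.
    have -> : f x = 0.
      by apply: contrapT => /eqP fx; apply: Ox; exact: subset_closure.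
    by rewrite maxxx subr0 max_l ?subrr.
- apply: le_trans (form_normD f1 Fv (subspaceN sF (Fp _ (Fvp _ Fu)))) _.
  rewrite (form_normN f1); last by apply: Fp; exact: Fvp.
  have h1 : form_norm E1 (L2_pos (v - L2_pos u)) <= form_norm E1 (v - L2_pos u).
    by rewrite /form_norm ler_wsqrtr// (E1_pos_le hE)//; exact: Fvp.
  have h2 := form_normD f1 Fv (subspaceN sF (Fp _ Fu)).
  rewrite (form_normN f1) in h2; last exact: Fp.
  have h3 : form_norm E1 (L2_pos u) <= form_norm E1 u.
    by rewrite /form_norm ler_wsqrtr// (E1_pos_le hE).
  have h4 : form_norm E1 u <= form_norm E1 w + 1.
    have -> : u = w - (w - u) by rewrite opprB addrC subrK.
    apply: le_trans (form_normD f1 Fw (subspaceN sF Fwu)) _.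
    by rewrite (form_normN f1) ?lerD2l ?ltW.
  lra.
- have -> : v - h u = L2_pos (v - L2_pos u) - L2_pos (v - L2_pos w).
    by transitivity (h w - h u); [rewrite hw|exact: subBB].
  apply: le_lt_trans (norm_posB _ _) _.
  have -> : v - L2_pos u - (v - L2_pos w) = L2_pos w - L2_pos u.
    exact: subBB.
  apply: le_lt_trans (norm_posB _ _) _.
  by apply: le_lt_trans wue; exact: (norm_le_E1 hE).
Qed.

End FormPart.

(** * Semigroups and the weak Feller property *)

Section Semigroup.
Context (R : realType) (V : completeNormedModType R).
Context (A : set (V * V)) (T : R -> V -> V) (hT : semigroup_of A T).

Let T_linear t : 0 <= t -> linear (T t).
Proof. by move=> t0 a u v; exact: (sg_linear hT). Qed.

Lemma sg_near0 u (e : R) : 0 < e ->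
  exists2 h : R, 0 < h & forall t, 0 <= t -> t < h -> `|T t u - u| < e.
Proof.
move=> e0; have /cvgrPdist_lt/(_ e e0) := @sg_strong _ _ _ _ hT u.
rewrite near_withinE => /nbhs_ballP[h /= h0 hh]; exists h => // t t0 th.
have [->|tn0] := eqVneq t 0; first by rewrite (sg_0 hT) subrr normr0.
rewrite distrC; apply: hh; last by rewrite lt_def tn0.
by rewrite /ball/= sub0r normrN ger0_norm.
Qed.

Lemma sg_generator0 u f (e : R) : A (u, f) -> 0 < e ->
  exists2 h : R, 0 < h & forall t, 0 < t -> t < h -> `|t^-1 *: (u - T t u) - f| < e.
Proof.
move=> /(sg_generator hT)/cvgrPdist_lt/(_ e) h e0; have := h e0.
rewrite near_withinE => /nbhs_ballP[d /= d0 hd]; exists d => // t t0 td.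
rewrite distrC; apply: hd => //.
by rewrite /ball/= sub0r normrN gtr0_norm.
Qed.

(** Uniform boundedness: if no such bound existed, operators [T t_n] with t_n tending to 0 would
    have unbounded norms although strong continuity at 0 bounds them on each vector. *)
Lemma sg_bounded_near0 : exists d M : R, [/\ 0 < d, 1 <= M &
  forall t u, 0 <= t -> t <= d -> `|T t u| <= M * `|u|].
Proof.
apply: contrapT => nb.
have /choice[p hp] (n : nat) : exists p : R * V,
    [/\ 0 <= p.1, p.1 <= n.+1%:R^-1 & n.+1%:R * `|p.2| < `|T p.1 p.2|].
  apply: contrapT => np; apply: nb; exists n.+1%:R^-1, n.+1%:R; split => //.
    by rewrite ler1n.
  move=> t u t0 tn; rewrite leNgt; apply/negP => h; apply: np.
  by exists (t, u).
pose F : set (V -> V) := [set T (p n).1 | n in setT].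
have [_ [n _ <-]|u|M hM] := @Banach_Steinhauss R V V F _ _ 1.
- have [t0 _ _] := hp n; split; last exact: T_linear.
  have lT : linear (T (p n).1) := T_linear t0.
  pose TL : {linear V -> V} := HB.pack (T (p n).1) (GRing.isLinear.Build _ _ _ _ _ lT).
  apply/(bounded_funP TL); apply/linear_bounded_continuous.
  exact: (sg_continuous hT t0).
- have [h h0 hh] := sg_near0 u (@ltr01 R).
  have [N hN] := inv_nat_small h0.
  (* From [N] on, [T u] is within 1 of [u]; the finitely many earlier terms are simply summed. *)
  exists (`|u| + 1 + \sum_(n < N) `|T (p n).1 u|) => _ [n _ <-].
  have [Nn|nN] := leqP N n; last first.
    rewrite (bigD1 (Ordinal nN))//= addrCA lerDl.
    by rewrite addr_ge0// ?addr_ge0// sumr_ge0.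
  have [t0 tn _] := hp n.
  have -> : T (p n).1 u = u + (T (p n).1 u - u) by rewrite addrC subrK.
  apply: le_trans (ler_normD _ _) _; rewrite -addrA lerD2l ler_wpDr ?sumr_ge0//.
  by rewrite ltW// hh// (le_lt_trans tn)// hN.
have [N hN] : exists N : nat, M < N.+1%:R by exists (Num.truncn M); exact: truncnS_gt.
have [t0 _ hu] := hp N.
have u0 : 0 < `|(p N).2|.
  rewrite lt_def normr_ge0 andbT; apply/eqP => u0.
  have /eqP : `|(p N).2| = 0 by []. rewrite normr_eq0 => /eqP uE.
  by move: hu; rewrite uE (lin0 (T_linear t0)) !normr0 mulr0 ltxx.
have := hM (T (p N).1) (ex_intro2 _ _ N I erefl) (`|(p N).2|^-1 *: (p N).2).
rewrite normrZ gtr0_norm ?invr_gt0// mulVf ?gt_eqF// lexx => /(_ isT).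
have -> : T (p N).1 (`|(p N).2|^-1 *: (p N).2) = `|(p N).2|^-1 *: T (p N).1 (p N).2.
  by have := T_linear t0 `|(p N).2|^-1 (p N).2 0; rewrite (lin0 (T_linear t0)) !addr0.
rewrite normrZ gtr0_norm ?invr_gt0// ler_pdivrMl// => h.
have := lt_le_trans hu h; rewrite mulrC ltr_pM2l// => /lt_trans/(_ hN).
by rewrite ltxx.
Qed.

Lemma sg_bounded_on (b : R) : exists2 M : R, 1 <= M &
  forall t u, 0 <= t -> t <= b -> `|T t u| <= M * `|u|.
Proof.
have [d [M [d0 M1 hM]]] := sg_bounded_near0.
have M0 : 0 < M := lt_le_trans ltr01 M1.
have step n : forall t u, 0 <= t -> t <= n%:R * d -> `|T t u| <= M ^+ n.+1 * `|u|.
  elim: n => [|n IH] t u t0 tn.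
    by rewrite expr1 hM//; rewrite mul0r in tn; apply: le_trans tn (ltW d0).
  have [td|td] := leP t d.
    apply: le_trans (hM t u t0 td) _; rewrite ler_wpM2r// exprS.
    by rewrite ler_peMr ?(ltW M0)// exprn_ege1.
  have -> : t = d + (t - d) by rewrite addrC subrK.
  have td0 : 0 <= t - d by rewrite subr_ge0 ltW.
  rewrite (sg_add hT (ltW d0) td0); apply: le_trans (hM _ _ (ltW d0) (lexx _)) _.
  rewrite exprS -mulrA ler_wpM2l ?(ltW M0)// IH//.
  by rewrite lerBlDr; apply: le_trans tn _; rewrite -addn1 natrD mulrDl mul1r.
pose n := (Num.truncn (b / d)).+1; exists (M ^+ n.+1); first exact: exprn_ege1.
move=> t u t0 tb; apply: step => //; apply: le_trans tb _.
by rewrite -ler_pdivrMr// ltW// truncnS_gt.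
Qed.

Lemma sg_uniform_continuous (b : R) u (e : R) : 0 < e ->
  exists2 h : R, 0 < h & forall s t, 0 <= s -> s <= b -> 0 <= t -> t <= b ->
    `|s - t| < h -> `|T s u - T t u| < e.
Proof.
move=> e0; have [M M1 hM] := sg_bounded_on b.
have M0 : 0 < M := lt_le_trans ltr01 M1.
have [|h h0 hh] := @sg_near0 u (e / M); first by rewrite divr_gt0.
have key s t : 0 <= s -> s <= b -> s <= t -> t <= b -> t - s < h -> `|T t u - T s u| < e.
  move=> s0 sb st tb ts; have ts0 : 0 <= t - s by rewrite subr_ge0.
  have -> : T t u - T s u = T s (T (t - s) u - u).
    have tE : t = s + (t - s) by rewrite addrC subrK.
    by rewrite {1}tE (sg_add hT s0 ts0) (linB (T_linear s0)).
  apply: le_lt_trans (hM _ _ s0 sb) _.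
  by rewrite -ltr_pdivlMl// mulrC hh.
exists h => // s t s0 sb t0 tb st; have [ts|ts] := leP s t.
  by rewrite distrC key//; rewrite distrC ger0_norm ?subr_ge0 in st.
by rewrite key// ?ltW//; rewrite gtr0_norm ?subr_gt0 in st.
Qed.

(** Orbits are differentiated and integrated only after applying a bounded functional, so that
    scalar calculus suffices. *)
Context (l : V -> R) (L : R).
Hypothesis ll : forall a x y, l (a *: x + y) = a * l x + l y.
Hypothesis lL : forall x, `|l x| <= L * `|x|.

Let l0 : l 0 = 0.
Proof. by have := ll (-1) 0 0; rewrite scaler0 addr0 mulN1r addNr. Qed.
Let lZ k x : l (k *: x) = k * l x.
Proof. by have := ll k x 0; rewrite l0 !addr0. Qed.
Let lB x y : l (x - y) = l x - l y.
Proof. by have := ll (-1) y x; rewrite scaleN1r mulN1r addrC => ->; rewrite addrC. Qed.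

Lemma sg_functional_continuous (b : R) u : {within `[0, b], continuous (fun t => l (T t u))}.
Proof.
apply/subspace_continuousP => t; rewrite /= in_itv/= => /andP[t0 tb].
apply/cvgrPdist_lt => e e0.
have L1 : 0 < `|L| + 1 by rewrite ltr_wpDl.
have [|h h0 hh] := @sg_uniform_continuous b u (e / (`|L| + 1)); first by rewrite divr_gt0.
rewrite near_withinE; apply/nbhs_ballP; exists h => //= s ts.
rewrite in_itv/= => /andP[s0 sb].
rewrite -lB.
apply: le_lt_trans (lL _) _.
have := hh t s t0 tb s0 sb; rewrite -ball_normE /= in ts; move/(_ ts).
rewrite ltr_pdivlMr// mulrC; apply: le_lt_trans.
by rewrite ler_wpM2r// (le_trans (ler_norm L))// lerDl.
Qed.

(** The generator only gives a right quotient at 0. For h < 0 it gets transported to the moving base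
    point t + h; boundedness and uniform continuity on [0, t + 1] absorb this, each causing an error
    of at most [d]. *)
Lemma sg_functional_derive (t : R) u f : 0 < t -> A (u, f) ->
  is_derive t (1 : R) (fun s : R => l (T s u) : R) (- l (T t f)).
Proof.
move=> t_gt0 Auf.
have cv : (fun h : R => h^-1 *: (((fun s => l (T s u) : R) \o shift t) (h *: 1) - l (T t u)))
    @ 0^' --> - l (T t f).
  apply/cvgrPdist_lt => e e0.
  have L1 : 0 < `|L| + 1 by rewrite ltr_wpDl.
  have [M M1 hM] := sg_bounded_on (t + 1).
  have M0 : 0 < M := lt_le_trans ltr01 M1.
  pose d := e / 2 / (`|L| + 1).
  have d0 : 0 < d by rewrite !divr_gt0.
  have [h1 h10 hg] := sg_generator0 Auf (divr_gt0 d0 M0).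
  have [h2 h20 hc] := @sg_uniform_continuous (t + 1) f d d0.
  rewrite near_withinE; apply/nbhs_ballP.
  exists (Num.min (Num.min h1 h2) (Num.min 1 t)); first by rewrite /= !lt_min h10 h20 t_gt0 ltr01.
  move=> h; rewrite -ball_normE /= sub0r normrN !lt_min.
  move=> /andP[/andP[hh1 hh2] /andP[h_1 h_t]] hn0.
  (* both one-sided quotients have the form [T s ((u - T k u) / k)], [k = |h|] *)
  have key s k : 0 <= s -> s <= t + 1 -> 0 < k -> k < h1 -> `|s - t| < h2 ->
      `|l (k^-1 *: (T s u - T (s + k) u)) - l (T t f)| < e.
    move=> s0 st k0 kh sh.
    have -> : k^-1 *: (T s u - T (s + k) u) = T s (k^-1 *: (u - T k u)).
      have Ts := T_linear s0.
      rewrite (sg_add hT s0 (ltW k0)) -(linB Ts).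
      by have := Ts k^-1 (u - T k u) 0; rewrite (lin0 Ts) !addr0.
    rewrite -lB.
    apply: le_lt_trans (lL _) _.
    have n1 : `|T s (k^-1 *: (u - T k u)) - T s f| <= d.
      rewrite -(linB (T_linear s0)); apply: le_trans (hM _ _ s0 st) _.
      by rewrite mulrC -ler_pdivlMr// ltW// hg.
    have n2 : `|T s f - T t f| < d by apply: hc => //; [exact: ltW|rewrite lerDl].
    have n3 : `|T s (k^-1 *: (u - T k u)) - T t f| < d + d.
      have -> : T s (k^-1 *: (u - T k u)) - T t f =
        (T s (k^-1 *: (u - T k u)) - T s f) + (T s f - T t f) by rewrite addrA subrK.
      by apply: le_lt_trans (ler_normD _ _) _; rewrite ler_ltD.
    apply: (@le_lt_trans _ _ ((`|L| + 1) * `|T s (k^-1 *: (u - T k u)) - T t f|)).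
      by rewrite ler_wpM2r// (le_trans (ler_norm L))// lerDl.
    by rewrite -ltr_pdivlMl// (lt_le_trans n3)// /d -mulrDl -splitr mulrC.
  rewrite scaler1.
  have [h0|h0] := ltP 0 h.
    rewrite gtr0_norm// in hh1 hh2 h_1 h_t.
    have := key t h (ltW t_gt0) _ h0 hh1; rewrite subrr normr0 => /(_ _ h20).
    rewrite lerDl ler01 => /(_ isT); rewrite lZ lB.
    congr (`|_| < _); rewrite /GRing.scale/= [h + t]addrC; ring.
  have h_lt0 : h < 0 by rewrite lt_def eq_sym hn0.
  rewrite ltr0_norm// in hh1 hh2 h_1 h_t.
  have := key (t + h) (- h); rewrite addrK => hk.
  have th0 : 0 <= t + h by rewrite -lerBlDr sub0r ltW.
  have := hk th0 _ _ hh1; rewrite oppr_gt0 => /(_ _ h_lt0).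
  rewrite addrAC subrr add0r ltr0_norm// => /(_ _ hh2).
  rewrite lerD2l (le_trans h0 ler01) => /(_ isT); rewrite lZ lB.
  congr (`|_| < _); rewrite /GRing.scale/= [h + t]addrC invrN; ring.
split; first exact: (cvgP _ cv).
exact: (cvg_lim _ cv).
Qed.

Lemma sg_deviation (b M : R) : (forall t u, 0 <= t -> t <= b -> `|T t u| <= M * `|u|) ->
  0 < b -> forall u f, A (u, f) -> `|l (T b u) - l u| <= `|L| * (M * `|f|) * b.
Proof.
move=> hM b0 u f Auf.
have [|c] := @MVT R (fun s => l (T s u)) (fun s => - l (T s f)) 0 b b0 _ (@sg_functional_continuous b u).
  by move=> x; rewrite in_itv/= => /andP[x0 _]; exact: sg_functional_derive.
rewrite in_itv/= => /andP[c0 cb]; rewrite (sg_0 hT) subr0 => ->.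
rewrite normrM (gtr0_norm b0) ler_wpM2r ?(ltW b0)// normrN.
apply: le_trans (lL _) _; apply: (@le_trans _ _ (`|L| * `|T c f|)).
  by rewrite ler_wpM2r// ler_norm.
by rewrite ler_wpM2l// hM// ltW.
Qed.

(* the resolvent identity [l u - e^-b l (T_b u) = int_0^b e^-t l (T_t (u + f)) dt] *)
Lemma sg_laplace (b : R) u f : 0 < b -> A (u, f) ->
  (\int[lebesgue_measure]_(t in `[0%R, b]) (expR (- t) * l (T t (u + f)))%:E =
  (l u - expR (- b) * l (T b u))%:E)%E.
Proof.
move=> b0 Auf.
have cexp : continuous (fun t : R => expR (- t)).
  move=> t; apply: continuous_comp; first exact: opp_continuous.
  exact: continuous_expR.
have cG v : {within `[0, b], continuous (fun t => expR (- t) * l (T t v))}.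
  apply/subspace_continuousP => t tb; apply: cvgM.
    by apply: cvg_within_filter; exact: cexp.
  by have /subspace_continuousP := @sg_functional_continuous b v; exact.
(* An antiderivative of the integrand: the exponential contributes the term in [u], the semigroup
   the term in [f]. *)
pose G t := - (expR (- t) * l (T t u)).
have dG (t : R) : 0 < t -> is_derive t (1 : R) G (expR (- t) * l (T t (u + f))).
  move=> t0; have h1 := sg_functional_derive t0 Auf.
  have h2 : is_derive t (1 : R) (fun t : R => expR (- t)) (- expR (- t)).
    by apply: is_derive_eq; rewrite mulrN1.
  have lD : l (T t (u + f)) = l (T t u) + l (T t f).
    have := T_linear (ltW t0) 1 u f; rewrite !scale1r => ->.
    by have := ll 1 (T t u) (T t f); rewrite scale1r mul1r.
  apply: (@is_derive_eq _ _ _ _ _ _ _ _ (is_deriveN (is_deriveM h2 h1))).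
  by rewrite lD /GRing.scale/=; ring.
have := @continuous_FTC2 R (fun t => expR (- t) * l (T t (u + f))) G 0 b b0 (cG _) _ _.
rewrite /G oppr0 expR0 mul1r (sg_0 hT) => ->.
- by rewrite -EFinB opprK addrC.
- have cGw : {within `[0, b], continuous G}.
    apply/subspace_continuousP => t tb; apply: cvgN.
    by have /subspace_continuousP := cG u; exact.
  split.
  + by move=> t; rewrite in_itv/= => /andP[t0 _]; apply: ex_derive; exact: dG.
  + by move/continuous_within_itvP : cGw => /(_ b0)[].
  + by move/continuous_within_itvP : cGw => /(_ b0)[].
- move=> t; rewrite in_itv/= => /andP[t0 _]; rewrite derive1E.
  by have := dG t t0 => h; rewrite derive_val.
Qed.

End Semigroup.

(** * Exhaustion by compact sets *)

Section Exhaustion.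
Context (R : realType) (X : ptopologicalType).
Hypothesis X_locally_compact : locally_compact [set: X].
Hypothesis X_separable : separable X.
Hypothesis X_metrizable : metrizable R X.

(** Countably many balls, with centers in the dense sequence and radii 1/(k+1), suffice: each point
    lies in one having a compact superset, and a compact set is covered by finitely many of
    these. *)
Lemma compact_exhaustion : exists K : nat -> set X,
  [/\ forall n, compact (K n), forall i j, (i <= j)%N -> K i `<=` K j &
      forall C, compact C -> exists n, C `<=` K n].
Proof.
have [dist [d0 deq dsym dtri dn]] := X_metrizable.
have [D cD dD] := X_separable.
have [f fD] : exists f : nat -> X, D `<=` range f.
  have [D0|/set0P[x0 Dx0]] := eqVneq D set0; first by exists (fun=> point); rewrite D0.
  have /countable_injP[i inj_i] := cD.
  have /choice[f hf] n : exists x, forall y, D y -> i y = n -> x = y.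
    have [[y [Dy iy]]|ny] := pselect (exists y, D y /\ i y = n).
      by exists y => z Dz iz; apply: (inj_i _ _ (mem_set Dy) (mem_set Dz)); rewrite iy iz.
    by exists x0 => y Dy iy; exfalso; apply: ny; exists y.
  by exists f => y Dy; exists (i y) => //; exact: hf.
have ob x (e : R) : open [set y | dist x y < e].
  rewrite openE => y /= xy; apply/dn; exists (e - dist x y); first by rewrite subr_gt0.
  by move=> z /= yz; have := dtri x y z; lra.
pose b (p : nat * nat) := [set y | dist (f p.1) y < p.2.+1%:R^-1].
(* Balls contained in no compact set get the empty set, so that every [C p] is compact. *)
have /choice[C hC] p : exists B : set X, compact B /\
    ((exists B', compact B' /\ b p `<=` B') -> b p `<=` B).
  have [[B [cB bB]]|nB] := pselect (exists B', compact B' /\ b p `<=` B'); first by exists B.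
  by exists set0; split; [exact: compact0|move=> /nB].
pose K := fix K (n : nat) : set X := if n is k.+1 then K k `|` C (odflt (0, 0)%N (unpickle k)) else classical_sets.set0.
have CK p : C p `<=` K (pickle p).+1.
  by move=> x Cx; right; rewrite pickleK.
have Kmon i j : (i <= j)%N -> K i `<=` K j.
  elim: j => [|j IH]; first by rewrite leqn0 => /eqP->.
  rewrite leq_eqVlt => /orP[/eqP->//|/IH h]; apply: subset_trans h _.
  exact: subsetUl.
exists K; split => //.
  elim=> [|n IH] /=; first exact: compact0.
  by apply: compactU => //; case: (hC (odflt (0, 0)%N (unpickle n))).
have near x : exists p, b p x /\ b p `<=` C p.
  have [B nB [cB _]] := X_locally_compact (I : setT x).
  have /dn[e e0 eB] : nbhs x B.
    by apply: (filterS _ (nB : nbhs x [set y | setT y -> B y])) => y /= /(_ I).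
  have e2 : 0 < e / 2 by rewrite divr_gt0.
  have [N hN] := inv_nat_small e2.
  have [|y [/= xy Dy]] := dD [set y | dist x y < N.+1%:R^-1] _ (ob _ _).
    by exists x => /=; rewrite (_ : dist x x = 0) ?invr_gt0//; apply/deq.
  have [i _ fi] := fD _ Dy; exists (i, N); split.
    by rewrite /b/= fi dsym.
  have [_] := hC (i, N); apply; exists B; split => // z; rewrite /b/= fi => yz.
  apply: eB => /=; have := dtri x y z; move: (hN N (leqnn N)) xy yz.
  by move: (N.+1%:R^-1) => k; lra.
have /choice[p hp] := near.
move=> A; rewrite compact_cover => /(_ _ A (fun x => b (p x)))[].
- by move=> x _; exact: ob.
- by move=> x Ax; exists x => //; case: (hp x).
move=> s _ As; exists (\max_(x <- finmap.enum_fset s) (pickle (p x)).+1) => z /As[x /= xs bz].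
have [_ bC] := hp x; apply: (Kmon (pickle (p x)).+1); last exact/CK/bC.
by rewrite (big_rem x)//= leq_maxl.
Qed.

End Exhaustion.

Section Linf.
Context d (T : measurableType d) (R : realType).
Variable mu : {measure set T -> \bar R}.
Local Notation Linf := (Linf mu).

Lemma Linf_le (u : Linf) : {ae mu, forall x, `|u x| <= `|u|}.
Proof.
rewrite -[ `|u|]/(Lp_norm u) /Lp_norm.
have := Lfunction_finite _ (Lp_repr u); rewrite /finite_norm unlock -/(Lp_fun u).
(* If the total measure is 0 the essential supremum is not the norm, but every property holds almost
   everywhere. *)
case: ifPn => [mu0|mu0 _]; last first.
  have mu00 : mu setT = 0%E.
    by apply/eqP; rewrite eq_le measure_ge0 andbT leNgt.
  by exists setT; split.
move=> fy; have ge0 : (0 <= ess_sup mu (abse \o (EFin \o u)))%E.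
  by apply: ess_sup_gee => //; apply: nearW => x /=; rewrite lee_fin.
have := ess_sup_ge mu (abse \o (EFin \o u)); apply: filterS => x /= h.
by rewrite -lee_fin fineK// ge0_fin_numE.
Qed.

Lemma Lfun_infty_bounded (f : T -> R) (C : R) : measurable_fun setT f ->
  {ae mu, forall x, `|f x| <= C} -> f \in Lfun mu +oo%E.
Proof.
move=> mf fC; rewrite inE; apply/andP; split; rewrite inE//=.
rewrite /finite_norm unlock; case: ifPn => // _.
apply: (@le_lt_trans _ _ C%:E); last exact: ltry.
by apply/ess_supP; apply: filterS fC => x /=; rewrite lee_fin.
Qed.

Lemma Linf_cutoff_ae (A : set T) (u : Linf) : measurable A ->
  {ae mu, forall x, cutoff A u x = \1_A x * u x}.
Proof.
move=> mA; apply: Lp_class_ae; apply: (@Lfun_infty_bounded _ `|u|).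
  by apply: measurable_funM; [exact: measurable_indic|exact: Lp_measurable].
apply: filterS (Linf_le u) => x h; rewrite indicE.
by case: (x \in A); rewrite ?mul1r// mul0r normr0.
Qed.

End Linf.

Lemma ultra_fmap (I J : Type) (f : I -> J) (U : set_system I) :
  UltraFilter U -> UltraFilter (f @ U).
Proof.
move=> UU; split; first exact: fmap_proper_filter.
move=> G PG sG; apply/seteqP; split => [A GA|A]; last exact: sG.
have [//|nA] := in_ultra_setVsetC (f @^-1` A) UU.
have GnA : G (~` A) by apply: sG.
by have [x []] := filter_ex (filterI GA GnA).
Qed.

(** * Local compactness of the resolvent, and its decay at infinity *)

Section WeakFeller.
Context (R : realType) (X : ptopologicalType).
Hypothesis X_locally_compact : locally_compact [set: X].
Hypothesis X_separable : separable X.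
Hypothesis X_metrizable : metrizable R X.
Variable m : {measure set (borel X) -> \bar R}.
Context (F : set (L2 m)) (E : L2 m -> L2 m -> R).
Hypothesis hE : regular_symmetric_dirichlet_form F E.
Local Notation L2 := (L2 m).
Local Notation Linf := (Linf m).
Local Notation E1 := (energy1 E).
Let f1 := positive_form_E1 hE.
Let fi := positive_form_inner m.
Let sF := subspace_dom hE.
Context (T : R -> L2 -> L2) (hT : semigroup_of (form_operator setT F E) T).

Lemma compact_measurable_borel (K : set X) : compact K -> measurable (K : set (borel X)).
Proof.
move=> cK; rewrite -[K]setCK; apply: measurableC; apply: sub_sigma_algebra.
by apply: closed_openC; apply: compact_closed => //; exact: (metrizable_hausdorff X_metrizable).
Qed.

(** The scalar estimate is tested against the deviation [v] itself, giving |v|^2 <= |v| M |f| b. *)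
Lemma norm_deviation (b M : R) (u f : L2) : 0 < b ->
  (forall t u, 0 <= t -> t <= b -> `|T t u| <= M * `|u|) ->
  form_operator setT F E (u, f) -> `|T b u - u| <= M * `|f| * b.
Proof.
move=> b0 hM uf; set v := T b u - u.
have := @sg_deviation R _ _ T hT (inner v) `|v| _ (norm_inner_CS v) b M hM b0 u f uf.
rewrite -(pfBr fi)// -/v inner_norm ger0_norm ?sqr_ge0// normr_id expr2 -mulrA => h.
have [->|v0] := eqVneq v 0.
  rewrite normr0 mulr_ge0 ?(ltW b0)//; apply: le_trans (hM 0 f (lexx _) (ltW b0)).
  exact: normr_ge0.
by rewrite -(@ler_pM2l _ `|v|) ?normr_gt0//; apply: h => a x y; rewrite (pfDr fi)// (pfZr fi).
Qed.

Lemma resolvent_operator G (f : L2) : resolvent_on E F G ->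
  form_operator setT F E (G f, f - G f).
Proof.
move=> [GF GE]; split => //= v Fv.
by rewrite (pfBl fi)// -GE// /energy1 addrK.
Qed.

(** [G] maps bounded sets to sets bounded in the graph norm of the operator, on which [T b] is
    uniformly close to the identity for small [b]. Thus 1_K G 1_K is a norm limit of the compact
    operators 1_K T_b G 1_K. *)
Lemma cutoff_resolvent_compact (K : set X) G : resolvent_on E F G ->
  weakly_spatially_locally_compact T -> compact K ->
  compact_along_ultra (@inner _ _ R m)
    (fun x => cutoff (K : set (borel X)) (G (cutoff (K : set (borel X)) x))).
Proof.
move=> hG hw cK I U f UU [M fM] e e0; have mK := compact_measurable_borel cK.
pose cut (x : L2) : L2 := cutoff (K : set (borel X)) x.
have lcut : linear cut by exact: cutoff_linear.
have cut_le x : `|cut x| <= `|x| by exact: norm_cutoff_le.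
have G_le x : `|G x| <= `|x| by apply: (resolvent_norm hE _ hG).
pose M' := `|M| + 1; have M'0 : 0 < M' by rewrite ltr_wpDl.
have {}fM : U [set i | `|f i| <= M'].
  apply: filterS fM => i /=; rewrite -normE_inner => h; apply: le_trans h _.
  by rewrite (le_trans (ler_norm M))// lerDl.
have [M1 M11 hM1] := sg_bounded_on hT 1.
have M10 : 0 < M1 := lt_le_trans ltr01 M11.
have e4 : 0 < e / 4 by rewrite divr_gt0.
(* For |x| <= M' the vector cut x - G (cut x) has norm at most 2 M', so inserting [T b] costs at
   most e/4; two such errors and two distances to the limit [p] make up [e]. *)
pose b := Num.min 1 (e / 4 / (M1 * (2 * M'))).
have b0 : 0 < b by rewrite lt_min ltr01 !divr_gt0// !mulr_gt0.
have dev x : `|x| <= M' -> `|cut (G (cut x)) - cut (T b (G (cut x)))| <= e / 4.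
  move=> xM; rewrite -(linB lcut); apply: le_trans (cut_le _) _; rewrite distrC.
  have hb t (u : L2) : 0 <= t -> t <= b -> `|T t u| <= M1 * `|u|.
    by move=> t0 tb; apply: hM1 => //; apply: le_trans tb _; rewrite ge_min lexx.
  apply: le_trans (norm_deviation b0 hb (resolvent_operator (cut x) hG)) _.
  have h1 : `|cut x - G (cut x)| <= 2 * M'.
    apply: le_trans (ler_normB _ _) _; have := G_le (cut x); have := cut_le x; lra.
  apply: (@le_trans _ _ (M1 * (2 * M') * b)).
    by rewrite ler_wpM2r ?(ltW b0)// ler_wpM2l// ltW.
  by rewrite mulrC -ler_pdivlMr ?mulr_gt0// ge_min lexx orbT.
pose B : set L2 := [set G (cut x) | x in [set x | `|x| <= M']].
have bB : bounded_set B.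
  exists M'; split; first exact: num_real.
  move=> r Mr _ [x /= xM <-]; apply: le_trans (G_le _) _.
  by apply: le_trans (cut_le _) _; rewrite (le_trans xM)// ltW.
pose phi i := cut (T b (G (cut (f i)))).
have := hw K b cK b0 B bB; rewrite precompactE compact_ultra => cB.
have [|p [_ /= phip]] := cB (phi @ U) (ultra_fmap phi UU).
  apply: (@filterS _ U _ _ _ _ fM) => i /= fiM; apply: subset_closure.
  by exists (G (cut (f i))) => //; exists (f i).
have := phip _ (nbhsx_ballx p (e / 4) e4) => Up.
exists (phi @^-1` ball p (e / 4) `&` [set i | `|f i| <= M']); first exact: filterI.
move=> x y [/= px xM] [/= py yM]; rewrite -normE_inner.
have hx := dev _ xM; have hy := dev _ yM; rewrite distrC in hy.
move: px py; rewrite -ball_normE /= => px py; rewrite distrC in px.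
rewrite -/(cut _) -/(cut _) -/(cut _) -/(cut _).
set a := cut (G (cut (f x))) in hx *; set c := cut (G (cut (f y))) in hy *.
have -> : a - c = ((a - phi x) + (phi x - p)) + ((p - phi y) + (phi y - c)).
  by rewrite !addrA !subrK.
apply: le_lt_trans (ler_normD _ _) _.
have h1 := ler_normD (a - phi x) (phi x - p); have h2 := ler_normD (p - phi y) (phi y - c).
move: hx hy px py h1 h2; rewrite -/(phi x) -/(phi y); lra.
Qed.

Context (Tinf : R -> Linf -> Linf) (hTinf : Linf_extension T Tinf).
Hypothesis Tinf_feller : forall t, 0 < t -> forall u, Linf0 u -> Linf0 (Tinf t u).

(* [<g, v> - e^-b <T_b g, v> = int_0^b e^-t <T_t w, v> dt]. Were [g > delta] on
   a non-null set outside each member of an exhaustion [K n], testing against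
   its normalized indicators [v n] would give a contradiction by dominated
   convergence, since [<T_t w, v n>] tends to 0 for each [t > 0]. *)
Lemma resolvent_vanishes (w g : L2) (w' : Linf) (C : R) : w = w' %[ae m] -> Linf0 w' ->
  form_operator setT F E (g, w - g) -> {ae m, forall x, `|g x| <= C} ->
  forall delta : R, 0 < delta -> exists2 K : set X, compact K &
    {ae m, forall x : borel X, ~ K x -> g x <= delta}.
Proof.
move=> ww' w'0 Hg gC delta delta0; apply: contrapT => nK.
have [K [cK Kmon Kex]] := compact_exhaustion X_locally_compact X_separable X_metrizable.
pose A n : set (borel X) := [set x | ~ K n x /\ delta < g x].
have mA n : measurable (A n).
  have -> : A n = ~` (K n : set (borel X)) `&` (g @^-1` `]delta, +oo[).
    by apply/seteqP; split => x /=; rewrite in_itv/= andbT.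
  apply: measurableI; first exact: measurableC (compact_measurable_borel (cK n)).
  by rewrite -[X in measurable X]setTI; apply: (@Lp_measurable _ _ _ _ _ _ g).
(* On [A n] the function g / delta exceeds 1, so the indicator is square integrable. *)
pose a n := Lp_class m (le1_two R) (\1_(A n)).
have aE n : {ae m, forall x, a n x = \1_(A n) x}.
  apply: Lp_class_ae; apply: (@Lfun2_le _ _ _ _ _ (delta^-1 *: g)).
    exact: measurable_indic.
  apply: filterS (Lp_scale_ae delta^-1 g) => x ->; rewrite indicE.
  have [|_] := boolP (x \in A n); last by rewrite normr0.
  rewrite inE => -[_ gx]; rewrite normr1 normrM gtr0_norm ?invr_gt0//.
  by rewrite ler_pdivlMl// mulr1 (le_trans (ltW gx))// ler_norm.
have a0 n : 0 < inner (a n) (a n).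
  rewrite lt_def (pf_ge0 fi)// andbT inner_norm sqrf_eq0 normr_eq0; apply/eqP => an0.
  apply: nK; exists (K n) => //; have := aE n; rewrite an0 => h.
  apply: filterS2 h (Lp_zero_ae m (le1_two R)) => x h1 h2 nKx.
  rewrite leNgt; apply/negP => gx; move: h1; rewrite h2 indicE mem_set//=.
  by move=> /eqP; rewrite eq_sym oner_eq0.
(* Pairing with [v n] is the average over [A n]: it is bounded by the supremum there, however large
   [A n] is, and it is at least [delta] for [g]. *)
pose v n := (inner (a n) (a n))^-1 *: a n.
have v_le n (u : L2) (c : R) : {ae m, forall x, A n x -> `|u x| <= c} ->
    `|inner (v n) u| <= c.
  move=> uc; rewrite (pfZl fi)// normrM gtr0_norm ?invr_gt0// ler_pdivrMl// mulrC.
  have h1 : inner (a n) u <= inner (c *: a n) (a n).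
    apply: inner_le; apply: filterS3 (Lp_scale_ae c (a n)) (aE n) uc => x -> -> h.
    rewrite indicE; have [|_] := boolP (x \in A n); last by rewrite !(mul0r, mulr0).
    by rewrite inE => /h; rewrite !mul1r !mulr1; apply: le_trans; exact: ler_norm.
  have h2 : - inner (a n) u <= inner (c *: a n) (a n).
    rewrite -(pfNr fi)//; apply: inner_le.
    apply: filterS3 (filterI (Lp_scale_ae c (a n)) (Lp_opp_ae u)) (aE n) uc => x [-> ->] -> h.
    rewrite indicE; have [|_] := boolP (x \in A n); last by rewrite !(mul0r, mulr0).
    by rewrite inE => /h; rewrite !mul1r !mulr1 -normrN; apply: le_trans; exact: ler_norm.
  by rewrite (pfZl fi)// in h1 h2; rewrite ler_norml lerNl h1 h2.
have v_ge n : delta <= inner (v n) g.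
  rewrite (pfZl fi)// ler_pdivlMl// mulrC -(pfZl fi)//; apply: inner_le.
  apply: filterS2 (Lp_scale_ae delta (a n)) (aE n) => x -> ->; rewrite indicE.
  have [|_] := boolP (x \in A n); last by rewrite !(mul0r, mulr0).
  by rewrite inE => -[_ /ltW]; rewrite mul1r !mulr1.
have TE t : 0 <= t -> {ae m, forall x, T t w x = Tinf t w' x}.
  by move=> t0; apply/ae_setT; exact: (lie_consistent hTinf).
have bound t n : 0 <= t -> `|inner (v n) (T t w)| <= `|w'|.
  move=> t0; apply: v_le; apply: filterS2 (TE t t0) (Linf_le (Tinf t w')) => x -> h _.
  exact: le_trans h (lie_contraction hTinf t0 w').
have vanish t : 0 < t -> (fun n => inner (v n) (T t w)) @ \oo --> (0 : R).
  move=> t0; apply/cvgrPdist_le => e e0.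
  have [C' cC' hC'] := Tinf_feller t0 w'0 e0.
  have [N hN] := Kex _ cC'; exists N => // n /= Nn; rewrite sub0r normrN.
  apply: v_le; have mC' := measurableC (compact_measurable_borel cC').
  apply: filterS3 (TE t (ltW t0)) (Linf_cutoff_ae (Tinf t w') mC')
    (Linf_le (cutoff (~` C' : set (borel X)) (Tinf t w'))) => x -> h1 h2 [nKx _].
  rewrite h1 indicE mem_set/= ?mul1r in h2; first exact: le_trans h2 (ltW hC').
  by move=> C'x; apply: nKx; exact/(Kmon N n Nn)/hN.
(* The boundary term <T_b g, v n> has to be bounded uniformly in [n], which only the contraction on
   L^oo provides. *)
pose g' : Linf := Lp_class m (leey 1%E) (g : borel X -> R).
have g'E : {ae m, forall x, g' x = g x}.
  by apply: Lp_class_ae; apply: Lfun_infty_bounded gC; exact: Lp_measurable.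
have Tg t n : 0 <= t -> `|inner (v n) (T t g)| <= `|g'|.
  move=> t0; apply: v_le; have gg' : g = g' %[ae m].
    by apply/ae_setT; apply: filterS g'E => x ->.
  have := lie_consistent hTinf t0 gg' => /ae_setT h.
  apply: filterS2 h (Linf_le (Tinf t g')) => x -> h _.
  exact: le_trans h (lie_contraction hTinf t0 g').
(* Since e^b >= b >= 2 |g'| / delta, the boundary term is at most delta/2, and the integral stays
   above delta/2 for all [n]. *)
pose b := 2 * `|g'| / delta + 1.
have b0 : 0 < b by rewrite ltr_wpDl// divr_ge0 ?mulr_ge0// ltW.
have eb : expR (- b) * `|g'| <= delta / 2.
  rewrite expRN ler_pdivrMl ?expR_gt0//.
  apply: (@le_trans _ _ (b * (delta / 2))).
    rewrite /b mulrDl mul1r; have -> : 2 * `|g'| / delta * (delta / 2) = `|g'|.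
      by field; rewrite gt_eqF.
    by rewrite lerDl divr_ge0// ltW.
  rewrite ler_wpM2r ?divr_ge0 ?(ltW delta0)//.
  by apply: le_trans (expR_ge1Dx b); rewrite lerDr.
have lv n : forall k x y, inner (v n) (k *: x + y) = k * inner (v n) x + inner (v n) y.
  by move=> k x y; rewrite (pfDr fi)// (pfZr fi).
have Hw : w = g + (w - g) by rewrite addrC subrK.
have lap n : (\int[lebesgue_measure]_(t in `[0%R, b]) (expR (- t) * inner (v n) (T t w))%:E =
    (inner (v n) g - expR (- b) * inner (v n) (T b g))%:E)%E.
  rewrite [in LHS]Hw.
  exact: (@sg_laplace R _ _ T hT (inner (v n)) `|v n| (lv n) (norm_inner_CS (v n)) b g (w - g) b0 Hg).
have low n : delta / 2 <= inner (v n) g - expR (- b) * inner (v n) (T b g).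
  have h1 := v_ge n; have h2 := Tg b n (ltW b0).
  have : expR (- b) * inner (v n) (T b g) <= expR (- b) * `|g'|.
    by rewrite ler_wpM2l ?expR_ge0// (le_trans (ler_norm _)).
  lra.
pose h n t := (expR (- t) * inner (v n) (T t w))%:E.
have ch n : {within `[0, b], continuous (fun t => expR (- t) * inner (v n) (T t w))}.
  apply/subspace_continuousP => t tb; apply: cvgM.
    apply: cvg_within_filter; apply: continuous_comp; first exact: opp_continuous.
    exact: continuous_expR.
  have /subspace_continuousP := @sg_functional_continuous R _ _ T hT (inner (v n)) `|v n| (lv n)
    (norm_inner_CS (v n)) b w; exact.
have [|||||_ _ cvg_h] := @dominated_convergence _ _ _ lebesgue_measure `[0%R, b]%classic
  (measurable_itv _) h (cst 0%E) (cst `|w'|%:E).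
- move=> n; apply/measurable_EFinP; apply: subspace_continuous_measurable_fun => //.
  exact: ch.
- exact: measurable_cst.
(* The Feller property gives pointwise convergence for t > 0 only; t = 0 is the exceptional
   point. *)
- exists [set 0]; split => //; first exact: lebesgue_measure_set1.
  move=> t /= /not_implyP[]; rewrite in_itv/= => /andP[t0 _] nt; apply: contrapT => /eqP tn0.
  apply: nt; rewrite /h; apply: cvg_EFin; first exact: nearW.
  rewrite -[X in _ --> X](mulr0 (expR (- t))); apply: cvgMr; apply: vanish.
  by rewrite lt_def tn0.
- apply/integrableP; split; first exact: measurable_cst.
  rewrite integral_cst//= lebesgue_measure_itv/= lte_fin b0 -EFinD -EFinM; exact: ltry.
- apply: aeW => t n; rewrite /= in_itv/= => /andP[t0 _]; rewrite lee_fin normrM.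
  rewrite ger0_norm ?expR_ge0// -[leRHS]mul1r ler_pM ?expR_ge0//; last exact: bound.
  by rewrite -expR0 ler_expR oppr_le0.
have {}cvg_h : (\int[lebesgue_measure]_(t in `[0%R, b]) h n t)%E @[n --> \oo] --> 0%E.
  by rewrite integral0 in cvg_h.
have cv : (fun n => fine (\int[lebesgue_measure]_(t in `[0%R, b]) h n t)%E) @ \oo --> (0 : R).
  exact: (fine_cvg cvg_h).
move/cvgrPdist_lt: cv => /(_ (delta / 2)); rewrite divr_gt0// => /(_ isT)[n _].
move=> /(_ n (leqnn n)); rewrite /= lap/= sub0r normrN => h1.
by have := le_lt_trans (le_trans (low n) (ler_norm _)) h1; rewrite ltxx.
Qed.

End WeakFeller.

(** * The subspace L^2(U), and form operators through their resolvents *)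

Section L2on.
Context (R : realType) (X : ptopologicalType).
Variable m : {measure set (borel X) -> \bar R}.
Local Notation L2 := (L2 m).
Context (U : set X) (U_open : open U).

Lemma measurable_setC_open : measurable (~` U : set (borel X)).
Proof. by apply: measurableC; exact: sub_sigma_algebra. Qed.
Let mU := measurable_setC_open.

(** As the kernel of a bounded linear map, L^2(U) is visibly a closed subspace. *)
Lemma L2onP (u : L2) : L2on U u <-> cutoff (~` U : set (borel X)) u = 0.
Proof.
split => h.
  apply: Lp_ext; apply: filterS3 (cutoff_ae u mU) (Lp_zero_ae m (le1_two R)) h.
  move=> x -> -> hx; rewrite indicE.
  by have [|_] := boolP (x \in _); [rewrite inE => /hx ->; rewrite mulr0|rewrite mul0r].
have := cutoff_ae u mU; rewrite h => h'.
apply: filterS2 h' (Lp_zero_ae m (le1_two R)) => x h1 h2 Ux.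
by move: h1; rewrite h2 indicE mem_set// mul1r.
Qed.

Lemma subspace_L2on : subspace (L2on U : set L2).
Proof.
have lc := @cutoff_linear _ _ _ m _ mU.
split; first by apply/L2onP; rewrite (lin0 lc).
by move=> a u v /L2onP hu /L2onP hv; apply/L2onP; rewrite lc hu hv scaler0 addr0.
Qed.

Lemma closed_L2on : ip_closed (@inner _ _ R m) (L2on U).
Proof.
move=> u cu; apply/L2onP; apply/eqP; rewrite -normr_le0; apply/ler_addgt0Pr => e e0.
have [s /L2onP s0 us] := cu e e0; rewrite add0r.
rewrite -[X in `|X|]subr0 -s0 -(linB (@cutoff_linear _ _ _ m _ mU)).
by apply: le_trans (norm_cutoff_le _ mU) _; rewrite normE_inner ltW.
Qed.

End L2on.

Section Operators.
Context (R : realType) (X : ptopologicalType).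
Variable m : {measure set (borel X) -> \bar R}.
Context (F : set (L2 m)) (E : L2 m -> L2 m -> R).
Hypothesis hE : regular_symmetric_dirichlet_form F E.
Local Notation L2 := (L2 m).
Let fi := positive_form_inner m.

(** Adding <u, v> to both sides of E u v = <h, v> gives the equation that determines G (h + u). *)
Lemma form_operator_resolvent (W D : set L2) (G : L2 -> L2) :
  subspace D -> D `<=` F -> resolvent_on E D G ->
  forall u h, form_operator W D E (u, h) <-> W h /\ u = G (h + u).
Proof.
move=> sD DF hG u h; split => [[/= Du Wh uh]|[Wh uG]].
  split => //; apply: (resolvent_unique hE sD DF hG) => // v Dv.
  by rewrite /energy1 uh// (pfDl fi).
have [GD GE] := hG; split => //=; first by rewrite uG.
move=> v Dv; have := GE (h + u) v Dv; rewrite -uG /energy1 (pfDl fi)// => h1.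
by apply: (addIr (inner u v)).
Qed.

Lemma part_sub_L2on (U : set X) : open U ->
  form_hull F E (form_core U F) `<=` L2on U.
Proof.
move=> oU u [Fu cu]; apply: (closed_L2on oU) => e /cu[s [Fs [f Cf sf]] us].
exists s.
  move/ae_setT: sf; apply: filterS => x -> nUx; apply: contrapT => /eqP fx.
  by apply: nUx; case: Cf => _ _; apply; exact: subset_closure.
apply: le_lt_trans us; rewrite -normE_inner; apply: (norm_le_E1 hE).
by apply: (subspaceB (subspace_dom hE)).
Qed.

End Operators.

Theorem theorem1p2 (R : realType) (X : ptopologicalType)
    (X_locally_compact : locally_compact [set: X])
    (X_separable : separable X)
    (X_metrizable : metrizable R X)
    (m : {measure set (borel X) -> \bar R})
    (m_radon : radon_measure m)
    (m_support : full_support m)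
    (F : set (L2 m)) (E : L2 m -> L2 m -> R)
    (E_dirichlet : regular_symmetric_dirichlet_form F E)
    (T : R -> L2 m -> L2 m)
    (T_semigroup : semigroup_of (form_operator setT F E) T)
    (Tinf : R -> Linf m -> Linf m)
    (Tinf_extension : Linf_extension T Tinf)
    (E_weak_feller : weak_feller (form_operator setT F E) Tinf)
    (E_wslc : weakly_spatially_locally_compact T)
    (U : set X) (U_open : open U) (U_cocompact : compact (~` U)) :
  essential_spectrum (L2on U) (form_operator (L2on U) (form_part U F E) E) =
  essential_spectrum setT (form_operator setT F E).
Proof.
have hE := E_dirichlet; have sF := subspace_dom hE.
have FF : F `<=` F by [].
have fi := positive_form_inner m.
have [G hG] : exists G, resolvent_on E F G.
  have [G [GF GE]] := exists_resolvent hE sF FF; exists G; split => [f|f v Fv].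
    by case: (GF f).
  by apply: GE; exact: sub_hull.
pose DU := form_hull F E (form_core U F).
have DUF : DU `<=` F by move=> u [].
have sDU : subspace DU by apply: (subspace_hull hE (subspace_core hE U)) => u [].
have [GU hGU] : exists GU, resolvent_on E DU GU.
  by have [|GU [GUF GUE]] := exists_resolvent hE (subspace_core hE U); [move=> u []|exists GU].
have HG := form_operator_resolvent hE setT sF FF hG.
have HGU := form_operator_resolvent hE (L2on U) sDU DUF hGU.
(* One bump yields both an open neighbourhood [O] of the complement of [U], where f > 1, and a
   compact set [K] containing [O]; then G w >= 1_K makes [g] at least 1 on all of [O]. *)
have [f [Cf f0 f3]] := compact_bump X_locally_compact X_metrizable U_cocompact
  openT (@subsetT _ _).
pose O : set (borel X) := [set x | 1 < f x].
have oO : open (O : set X).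
  case: Cf => cf _ _; rewrite (_ : (O : set X) = f @^-1` [set r | 1 < r])//.
  by apply: open_comp => //; exact: open_gt.
have UO : ~` U `<=` O by move=> x /f3; rewrite /O/=; lra.
pose K := closure [set x | f x != 0]; have cK : compact K by case: Cf.
have OK : O `<=` K.
  by move=> x; rewrite /O/= => fx; apply: subset_closure; rewrite /= gt_eqF// (lt_trans _ fx).
have [w [w' [ww' w'0] [g [w_ge0 Hg g1]]]] := wf_resolvent E_weak_feller cK.
have gE : g = G w by have /HG[_] := Hg; rewrite subrK.
have g_ge0 : {ae m, forall x, 0 <= g x}.
  by rewrite gE; exact: (resolvent_ge0 hE FF hG (fun u => @dom_neg _ _ _ _ _ hE u)).
have g_ge1 : {ae m, forall x, O x -> 1 <= g x}.
  have g1' : {ae m, forall x : borel X, \1_K x <= g x} by exact: g1.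
  by apply: filterS g1' => x + /OK Kx; rewrite indicE mem_set.
(* [w] is essentially bounded and the resolvent preserves upper bounds; [resolvent_vanishes] asks
   for a bounded [g]. *)
have gC : {ae m, forall x, `|g x| <= `|w'|}.
  have wC : {ae m, forall x, w x <= `|w'|}.
    move/ae_setT: ww' => ww'; apply: filterS2 ww' (Linf_le w') => x ->.
    by apply: le_trans; exact: ler_norm.
  have := resolvent_le hE hG (normr_ge0 w') wC; rewrite -gE => g_le.
  by apply: filterS2 g_ge0 g_le => x g0; rewrite ger0_norm.
pose D := resolvent_diff G GU.
have cD : compact_along_ultra (@inner _ _ R m) D.
  apply: (@diff_compact _ _ _ _ _ hE G GU DU hG sDU DUF hGU _ _ O w g) => //.
  - by move=> u; exact: part_neg.
  - move=> u v; exact: (part_ideal X_locally_compact X_metrizable hE U_cocompact).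
  - move=> v Fv; exact: (part_local X_locally_compact X_metrizable hE U_cocompact oO UO ltr01 Fv).
  - move=> e e0.
    have [C cC gC'] := resolvent_vanishes X_locally_compact X_separable X_metrizable
      T_semigroup Tinf_extension (wf_semigroup E_weak_feller) ww' w'0 Hg gC e0.
    exists C; first exact: (compact_measurable_borel X_metrizable).
    split => //.
    exact: (cutoff_resolvent_compact X_metrizable hE T_semigroup hG E_wslc cC).
have nG H : (forall f, `|H f| <= `|f|) ->
    forall x, form_norm (@inner _ _ R m) (H x) <= 1 * form_norm (@inner _ _ R m) x.
  by move=> h x; rewrite mul1r -!normE_inner.
have hi := hilbert_inner m.
have lGU := resolvent_linear hE sDU DUF hGU.
have WGU x : L2on U (GU x) by apply: (part_sub_L2on hE U_open); exact: (proj1 hGU x).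
have bGU := nG _ (resolvent_norm hE DUF hGU).
have specU z := fredholm_shiftedP hi lGU (resolvent_sym hE DUF hGU) bGU
  (@subspace_L2on _ _ m _ U_open) (@closed_L2on _ _ m _ U_open) WGU (@normE_inner _ _ _ m) HGU z.
have spec z := fredholm_shiftedP hi (resolvent_linear hE sF FF hG)
  (resolvent_sym hE FF hG) (nG _ (resolvent_norm hE FF hG))
  (conj I (fun _ _ _ _ _ => I)) (@ip_closed_setT _ _ _) (fun=> I)
  (@normE_inner _ _ _ m) HG z.
have csetT : cset setT = setT :> set (L2 m * L2 m) by apply/seteqP.
have pert a b : proper_on (ip2 (@inner _ _ R m)) setT (one_minus a b G) <->
    proper_on (ip2 (@inner _ _ R m)) (cset (L2on U)) (one_minus a b GU).
  apply: (proper_on_perturbation hi a b lGU _ WGU (@subspace_L2on _ _ m _ U_open) _ cD).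
    by exists 1.
  by move=> x; rewrite /D /resolvent_diff addrC subrK.
rewrite form_partE; apply/seteqP; split => z; rewrite /essential_spectrum /= => nf fr; apply: nf.
  by apply/specU/pert; rewrite -csetT; apply/spec.
by apply/spec; rewrite csetT; apply/pert/specU.
Qed.
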